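(* Fix $\alpha\ge 0$ and a probability distribution $\mu$ on $[0,1]$ with $\mathbb{P}(\xi=0)<1$ and $\mathbb{P}(\xi=1)<1$ for $\xi\sim\mu$. Let $\{\mathcal{T}(n):n\ge 1\}$ be the delayed preferential attachment trees described in the context (macroscopic delay, attachment weight $\deg+\alpha$). Then $\mathcal{T}(n)$ converges in the expected fringe sense to $\varpi_{\mathrm{Mac},\alpha}$, i.e. for every finite rooted tree $\mathbf{t}$ (up to root-preserving isomorphism), $$\mathbb{E}\Big[\frac1n\#\{v\in\mathcal{T}(n): f_0(v,\mathcal{T}(n))\simeq \mathbf{t}\}\Big]\longrightarrow \varpi_{\mathrm{Mac},\alpha}(\mathbf{t})\quad (n\to\infty).$$ In particular, writing $N_k(n)$ for the number of vertices $v$ of $\mathcal{T}(n)$ with $\deg(v,n)=k$, for every $k\ge 1$, $$\mathbb{E}\Big(\frac{N_k(n)}{n}\Big)\to \mathbb{P}\Big(\sum_{j=1}^{k-1}\mathscr{E}_{j-1\leadsto j}\le T_1<\sum_{j=1}^{k}\mathscr{E}_{j-1\leadsto j}\Big)=:p_{\mathrm{Mac},\alpha}(k),$$ where $T_1\sim\mathrm{Exp}(1)$ is independent of $\{\mathscr{E}_{j-1\leadsto j}\}_{j\ge1}$.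
   Context: Model: Let $\xi\sim\mu$. Build random rooted trees: $\mathcal{T}(1)$ is a single vertex $v_1$ (the root); $\mathcal{T}(2)$ has vertices $v_1,v_2$ and an edge from $v_2$ to its parent $v_1$; set $\mathcal{T}(0):=\mathcal{T}(1)$. For $j\ge i$, $\deg(v_i,j)$ is the degree of $v_i$ in $\mathcal{T}(j)$ (equal to its number of children $+1$ for non-root vertices, and to its number of children for the root), with the convention $\deg(v_i,i)=1$ for all $i$. For $n\ge2$, given $\mathcal{T}(n)$, a new vertex $v_{n+1}$ arrives, an independent delay $\xi_{n+1}\sim\mu$ is drawn, and $v_{n+1}$ becomes a child of a vertex $v$ of $\mathcal{T}(\lfloor n-n\xi_{n+1}\rfloor)$ chosen with probability proportional to $\deg(v,\lfloor n-n\xi_{n+1}\rfloor)+\alpha$. Limit objects: let $\eta:=-\log(1-\xi)\in[0,\infty]$ ($\eta=\infty$ iff $\xi=1$) with law $F_\eta$, and $h(x):=\frac{1}{2+\alpha}\int_{[0,x]}e^u\,dF_\eta(u)$. Define $\mathscr{E}_{0\leadsto1},\mathscr{E}_{1\leadsto2},\dots$ recursively: with $\sigma_0=0$, $\sigma_i=\sum_{j=1}^i\mathscr{E}_{j-1\leadsto j}$, conditionally on $\mathscr{E}_{0\leadsto1},\dots,\mathscr{E}_{i-1\leadsto i}$ the variable $\mathscr{E}_{i\leadsto i+1}\in(0,\infty]$ has hazard rate $x\mapsto \sum_{j=0}^i h(x+\sigma_i-\sigma_j)+\alpha h(x+\sigma_i)$, $x\ge0$ (i.e. $\mathbb{P}(\mathscr{E}_{i\leadsto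 i+1}>s\mid\text{past})=\exp(-\int_0^s(\cdot)\,dx)$). Let $\mathrm{BP}_{\mathrm{Mac},\alpha}$ be the continuous-time branching process started from one individual at time $0$ in which an individual born at time $b$ has children at times $b+\sigma_1,b+\sigma_2,\dots$, using independent copies of the sequence $(\mathscr{E}_{i-1\leadsto i})_{i\ge1}$ for different individuals. With $T_1\sim\mathrm{Exp}(1)$ independent, $\varpi_{\mathrm{Mac},\alpha}$ is the law of the genealogical tree of $\mathrm{BP}_{\mathrm{Mac},\alpha}(T_1)$, a random finite rooted tree considered up to root-preserving isomorphism. Fringe: for a finite rooted tree and vertex $v$, $f_0(v,\cdot)$ denotes the subtree consisting of $v$ and all its descendants, rooted at $v$. *)

(* Defs.v *)
From HB Require Import structures.
From mathcomp Require Import all_boot all_order all_algebra.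
From mathcomp Require Import all_classical all_reals all_analysis.
From mathcomp Require Import measurable_realfun.
Set Implicit Arguments. Unset Strict Implicit. Unset Printing Implicit Defensive.
Import Order.TTheory GRing.Theory Num.Theory.
Import numFieldNormedType.Exports.
Local Open Scope classical_set_scope.
Local Open Scope ring_scope.

(* A tree on vertices 0..n-1 (vertex i is v_{i+1}, 0 is the root) is a    *)
(* list s of size n with nth 0 s 0 = 0 (dummy) and nth 0 s i < i (i>0).  *)

Definition par (s : seq nat) (w : nat) : nat := nth 0%N s w.

Definition is_desc (s : seq nat) (v w : nat) : bool :=
  has (fun j => iter j (par s) w == v) (iota 0 (size s).+1).

(* a "shape": a finite rooted tree given by k >= 1 vertices 0..k-1,
   root 0, and parent function tp with tp i < i for 0 < i < k *)
Definition valid_shape (k : nat) (tp : nat -> nat) : Prop :=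
  (0 < k)%N /\ forall i, (0 < i < k)%N -> (tp i < i)%N.

Definition fringe_iso (s : seq nat) (v : nat) (k : nat) (tp : nat -> nat) : Prop :=
  exists phi : nat -> nat,
    [/\ phi 0%N = v,
        (forall i, (i < k)%N -> (phi i < size s)%N /\ is_desc s v (phi i)),
        (forall i j, (i < k)%N -> (j < k)%N -> phi i = phi j -> i = j),
        (forall w, (w < size s)%N -> is_desc s v w -> exists2 i, (i < k)%N & phi i = w)
      & (forall i, (0 < i < k)%N -> par s (phi i) = phi (tp i))].

(* deg(v_{v+1}, m) computed inside T(m) = first m vertices of s,
   with the convention deg(v_i, i) = 1 and deg(v_1,1) = 1 *)
Definition degT (s : seq nat) (m v : nat) : nat :=
  if (m <= 1)%N then 1%N
  else (count (fun w => par s w == v) (iota 1 m.-1) + (v != 0%N))%N.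

Section Dynamics.
Context {R : realType}.

Definition delay_prob (mu : probability R R) (n m : nat) : R :=
  fine (mu [set x : R | Num.floor (n%:R - n%:R * x) = (m%:Z)%R]).

Definition attach_prob (mu : probability R R) (alpha : R) (s : seq nat) (v : nat) : R :=
  let n := size s in
  \sum_(0 <= m < n.+1)
     delay_prob mu n m *
     (let m' := maxn m 1 in
      if (v < m')%N then
        ((degT s m' v)%:R + alpha) /
        (\sum_(0 <= u < m') ((degT s m' u)%:R + alpha))
      else 0).

Fixpoint tree_law (mu : probability R R) (alpha : R) (n : nat) : seq (R * seq nat) :=
  match n with
  | 0 => [::]
  | 1 => [:: (1, [:: 0%N])]
  | 2 => [:: (1, [:: 0%N; 0%N])]
  | n'.+1 =>
      flatten [seq [seq (ws.1 * attach_prob mu alpha ws.2 v, rcons ws.2 v)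
                   | v <- iota 0 n'] | ws <- tree_law mu alpha n']
  end.

Definition expect_tree (mu : probability R R) (alpha : R) (n : nat)
  (f : seq nat -> R) : R :=
  \sum_(ws <- tree_law mu alpha n) ws.1 * f ws.2.

Definition fringe_count (s : seq nat) (k : nat) (tp : nat -> nat) : nat :=
  #|[set v : 'I_(size s) | `[< fringe_iso s v k tp >] ]|.

Definition deg_count (s : seq nat) (k : nat) : nat :=
  count (fun v => degT s (size s) v == k) (iota 0 (size s)).

Definition hset (x : R) : set R := [set t : R | t < 1 /\ - ln (1 - t) <= x].

(* h(x) = 1/(2+alpha) \int_{[0,x]} e^u dF_eta(u), eta = -log(1 - xi) *)
Definition hfun (mu : probability R R) (alpha : R) (x : R) : R :=
  (2 + alpha)^-1 *
  fine (\int[mu]_(t in hset x) (expR (- ln (1 - t)))%:E)%E.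

Definition sig (e : nat -> R) (i : nat) : R := \sum_(l < i) e l.

(* hazard rate of E_{i ~> i+1} given E_{0~>1},...,E_{i-1~>i} = e 0..e (i-1) *)
Definition hazard (mu : probability R R) (alpha : R) (e : nat -> R) (i : nat) (x : R) : R :=
  \sum_(j < i.+1) hfun mu alpha (x + sig e i - sig e j)
  + alpha * hfun mu alpha (x + sig e i).

Definition interval0 (s : R) : set R := [set x : R | (0 <= x)%R /\ (x <= s)%R].

Definition survival (mu : probability R R) (alpha : R) (e : nat -> R) (i : nat) (s : R) : R :=
  expR (- fine (\int[lebesgue_measure]_(x in interval0 s)
                  (hazard mu alpha e i x)%:E)%E).

(* birth time of the Ulam-Harris individual u, where E w j is the
   (j+1)-th inter-birth time E_{j ~> j+1} of individual w; the i-th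
   child (0-based) of w is rcons w i, born at b(w) + sigma_{i+1}(w) *)
Fixpoint birth_aux {T : Type} (E : seq nat -> nat -> T -> \bar R)
    (pre u : seq nat) (om : T) : \bar R :=
  match u with
  | [::] => 0%E
  | i :: u' => ((\sum_(j < i.+1) E pre j om) + birth_aux E (rcons pre i) u' om)%E
  end.

Definition birth {T : Type} (E : seq nat -> nat -> T -> \bar R) (u : seq nat) (om : T) :=
  birth_aux E [::] u om.

Definition geneal_iso {T : Type} (E : seq nat -> nat -> T -> \bar R) (T1 : T -> R)
   (k : nat) (tp : nat -> nat) (om : T) : Prop :=
  let alive u := (birth E u om <= (T1 om)%:E)%E in
  exists phi : nat -> seq nat,
    [/\ phi 0%N = [::],
        (forall i, (i < k)%N -> alive (phi i)),
        (forall i j, (i < k)%N -> (j < k)%N -> phi i = phi j -> i = j),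
        (forall u, alive u -> exists2 i, (i < k)%N & phi i = u)
      & (forall i, (0 < i < k)%N -> exists c, phi i = rcons (phi (tp i)) c)].

End Dynamics.

(* Main.v *)
(* A vertex of T(n) has exactly the plane tree L below it, with its descendant
   w at position I w, with a probability that is a product over the arrival
   times N = 2 .. n-1: a vertex i of out-degree c attracts the newcomer N at a
   rate that is a weighted sum over i and its c children j of a unit rate
   approximately h (ln (N / j)) / N, so the past enters only through the
   positions I.  The branching process is put on the same grid by sending an
   individual w to the position n * exp (birth w - T1); then the root position
   is uniform, and by independence the probability of the positions I is a
   product over individuals of probabilities about their inter-birth times,
   which the hazard rate evaluates.  At positions I w = floor (n * x w) both
   probabilities, multiplied by n^(|L|-1) and n^|L|, have the same limit
   whenever h does not jump at the ln (x w' / x w), that is for x outside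
   countably many values of each coordinate given the previous ones.  Dominated
   convergence, one coordinate at a time, then shows that the sums over all
   positions are asymptotically equal: given the root position the remaining
   coordinates are dominated pointwise, and the root coordinate is handled
   by the bound 1 on total probability. *)

Require Import Defs.
From HB Require Import structures.
From mathcomp Require Import all_boot all_order all_algebra.
From mathcomp Require Import all_classical all_reals all_analysis.
From mathcomp Require Import measurable_realfun.
From mathcomp Require Import zify ring lra.
Import Order.TTheory GRing.Theory Num.Theory.
Import numFieldNormedType.Exports.
Local Open Scope classical_set_scope.
Local Open Scope ring_scope.
Set Implicit Arguments. Unset Strict Implicit. Unset Printing Implicit Defensive.

(** * Finite plane trees as sets of words *)

Section words.
Local Open Scope nat_scope.
Implicit Types (w u v : seq nat) (L M : seq (seq nat)).

(** In logarithmic time a newcomer [N] with delay xi sees the tree as it was eta = - ln (1 - xi)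
    earlier: a half-edge created by vertex [j] counts when eta is at most about ln (N / j), and it
    competes against a total weight of about (2 + alpha) N e^(- eta). Averaging over eta produces h,
    with its factor e^u and its constant. The obstacle is regularity. As mu is arbitrary, h is only
    nondecreasing and may jump, and the conditional law of a waiting time is given only over
    rectangles of past values. Grid cells are such rectangles, and because the primitive H of h is
    convex, the unknown past inside a cell can be replaced by its two extremes, which brackets each
    cell probability without densities. The common limit at a generic point is never integrated;
    only the difference of the two sums is shown to vanish. Bounds at a fixed root position n y blow
    up as y tends to 0, which is why the root coordinate needs an argument of its own. An unordered
    shape is a finite disjoint union of plane trees, children being ordered by arrival; a degree is
    a star in which only the out-degree of the root is prescribed. *)

Definition kid_of w u := (0 < size u) && (take (size u).-1 u == w).

Definition kids L w := count (kid_of w) L.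

Lemma kid_of_rcons w u c : kid_of w (rcons u c) = (u == w).
Proof. by rewrite /kid_of size_rcons /= -cats1 take_size_cat. Qed.

Lemma kids_rcons L w u c : kids (rcons L (rcons u c)) w = kids L w + (u == w).
Proof. by rewrite /kids -cats1 count_cat /= kid_of_rcons addn0. Qed.

(* Finite left-closed sets of Ulam-Harris words, listed so that parents and
   older siblings come first. *)
Inductive ptree : seq (seq nat) -> Prop :=
| ptree1 : ptree [:: [::]]
| ptreeS L u : ptree L -> u \in L -> ptree (rcons L (rcons u (kids L u))).

Lemma rcons_neq0 (T : eqType) (s : seq T) x : (rcons s x == [::]) = false.
Proof. by case: s. Qed.

Lemma ptree_kids L : ptree L ->
  (forall w c, (rcons w c \in L) = (w \in L) && (c < kids L w)) /\
  (forall w, w \notin L -> kids L w = 0).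
Proof.
elim=> [|{}L u _ [IH1 IH2] uL].
  split=> [w c|w]; first by rewrite !inE rcons_neq0 andbF.
  by [].
have nL : rcons u (kids L u) \notin L by rewrite IH1 ltnn andbF.
split=> [w c|w]; rewrite ?mem_rcons !inE ?kids_rcons.
  rewrite eqseq_rcons (eq_sym u w) IH1.
  have [->|wu] := eqVneq w u; rewrite /=.
    by rewrite uL orbT /= addn1 ltnS -leq_eqVlt.
  have [->|_] := eqVneq w (rcons u (kids L u)); last by rewrite addn0.
  by rewrite (negPf nL) (IH2 _ nL).
rewrite negb_or => /andP[_ wL]; rewrite (IH2 _ wL).
by have [uw|] := eqVneq u w; rewrite // -uw uL in wL.
Qed.

Lemma ptree_mem_rcons L w c : ptree L ->
  (rcons w c \in L) = (w \in L) && (c < kids L w).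
Proof. by move=> /ptree_kids[]. Qed.

Lemma ptree_uniq L : ptree L -> uniq L.
Proof.
elim=> // {}L u tL IH uL.
by rewrite rcons_uniq IH (ptree_mem_rcons _ _ tL) ltnn andbF.
Qed.

Lemma ptree_head L : ptree L -> exists M, L = [::] :: M.
Proof. by elim=> [|{}L u _ [M ->] _]; [exists [::]|eexists]. Qed.

Lemma ptree_nil L : ptree L -> [::] \in L.
Proof. by move=> /ptree_head[M ->]; rewrite mem_head. Qed.

(** Enumerates growth histories rather than trees: a left-closed set appears once for every
    admissible listing order of its words, so representatives up to [perm_eq] are chosen in
    [plane_trees_of_shape]. *)
Fixpoint ptrees (k : nat) : seq (seq (seq nat)) :=
  if k is k'.+1 then
    if k' is 0 then [:: [:: [::]]] else
    [seq rcons L (rcons u (kids L u)) | L <- ptrees k', u <- L]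
  else [::].

Lemma ptrees_size k L : L \in ptrees k -> size L = k.
Proof.
elim: k L => // -[_ L /[!inE]/eqP->//|k IH] L.
move=> /allpairsPdep[M [u [Mp uM ->]]].
by rewrite size_rcons (IH _ Mp).
Qed.

Lemma ptreesP k L : L \in ptrees k -> ptree L.
Proof.
case: k => [//|k]; elim: k L => [L|k IH L].
  by rewrite inE => /eqP ->; exact: ptree1.
by move=> /allpairsPdep[M [u [Mp uM ->]]]; apply: ptreeS => //; exact: IH.
Qed.

Lemma ptree_ptrees L : ptree L -> L \in ptrees (size L).
Proof.
elim=> [|{}L u tL IH uL]; first by rewrite inE.
rewrite size_rcons; case: (size L) IH (size_eq0 L) => [//|n] IH _.
by apply/allpairsPdep; exists L, u.
Qed.

Definition left_closed (A : seq nat -> Prop) :=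
  (forall w, A (rcons w 0) -> A w) /\
  (forall w c, A (rcons w c.+1) -> A (rcons w c)).

Lemma left_closed_parent A w c : left_closed A -> A (rcons w c) -> A w.
Proof. by move=> [A0 AS]; elim: c => [/A0|c IH /AS]. Qed.

(** The out-degree is pinned only for the words of [obs]. With [obs = L] this describes the whole
    tree; with a star and [obs = [:: [::]]] it records the degree of the root and leaves the
    offspring of its children free, so one argument serves both conclusions. *)
Definition exactly (A : seq nat -> Prop) L (obs : seq (seq nat)) :=
  (forall w, w \in L -> A w) /\ (forall w, w \in obs -> ~ A (rcons w (kids L w))).

(** On the path to a word of [A] outside [L] there is a first [rcons w c] not in [L]; closure under
    older siblings then puts [rcons w (kids L w)] into [A], which is what the second half of
    [exactly] forbids. *)
Lemma exactlyP A L : left_closed A -> ptree L ->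
  exactly A L L <-> (forall w, A w <-> w \in L).
Proof.
move=> cA tL; split=> [[LA AL] w|AL]; last first.
  split=> w wL; first by apply/AL.
  by move=> /AL; rewrite (ptree_mem_rcons _ _ tL) ltnn andbF.
split; last exact: LA.
elim/last_ind: w => [_|w c IH Awc]; first exact: ptree_nil.
have wL : w \in L := IH (left_closed_parent cA Awc).
rewrite (ptree_mem_rcons _ _ tL) wL /= ltnNge; apply/negP => cw.
apply: (AL w wL); elim: c Awc cw {IH} => [|c IH] Awc.
  by rewrite leqn0 => /eqP->.
rewrite leq_eqVlt => /predU1P[->//|]; rewrite ltnS; apply: IH.
exact: cA.2.
Qed.

(** Strictly increases from a parent to each child and from a sibling to the next, so a word of
    maximal weight can be removed from a finite left-closed set without breaking left closure. *)
Definition weight w := sumn w + size w.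

Lemma weight_rcons w c : weight (rcons w c) = weight w + c.+1.
Proof. by rewrite /weight sumn_rcons size_rcons; lia. Qed.

Lemma left_closed_ptree (A : seq nat -> Prop) M : left_closed A -> uniq M ->
  M != [::] -> (forall w, A w <-> w \in M) -> exists2 L, ptree L & perm_eq L M.
Proof.
move=> cA uM M0 AM.
elim: {M}(size M) {-2}M (erefl (size M)) A cA uM M0 AM => [|n IH] M sM A cA uM M0 AM.
  by move: M0; rewrite -size_eq0 sM.
have [M' pM] : exists2 M', perm_eq M' M & exists x s, M' = x :: s /\
    forall y, y \in M -> weight y <= weight x.
  exists (sort (fun x y => weight y <= weight x) M); first by rewrite perm_sort.
  have := sort_sorted (leT := fun x y => weight y <= weight x)
     (fun x y => leq_total _ _) M.
  case E : (sort _ _) => [|x s].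
    by move: M0; rewrite -size_eq0 -(size_sort (fun x y => weight y <= weight x)) E.
  rewrite /= path_sortedE; last first.
    by move=> a b c /= ? ab; apply: leq_trans ab _.
  move=> /andP[/allP xs _]; exists x, s; split=> // y.
  rewrite -(mem_sort (fun x y => weight y <= weight x)) E inE => /predU1P[->//|/xs//].
move=> [x [s [eM' xmax]]]; rewrite {}eM' in pM.
have uxs : uniq (x :: s) by rewrite (perm_uniq pM).
have ss : size s = n by have := perm_size pM; rewrite sM /= => -[].
have Mxs y : (y \in M) = (y \in x :: s) by rewrite (perm_mem pM).
have A1 y : A y <-> (y = x \/ y \in s).
  by rewrite AM Mxs inE; split=> [/predU1P//|[->|->]]; rewrite ?eqxx ?orbT.
have wlex y : A y -> weight y <= weight x by move=> /AM/xmax.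
have [s0|s0] := eqVneq s [::].
  exists [:: [::]]; first exact: ptree1.
  rewrite (perm_trans _ pM)// s0.
  have Ax y : A y -> y = x by move=> /A1; rewrite s0 in_nil => -[].
  case/lastP: x Ax A1 {uxs Mxs xmax wlex pM} => [//|w c] Ax A1.
  have /left_closed_parent/(_ _)/Ax := cA => /(_ w c).
  have Awc : A (rcons w c) by apply/A1; left.
  have : A w by apply: left_closed_parent Awc.
  by move=> /Ax /(congr1 size); rewrite size_rcons; lia.
have cs : left_closed (fun y => y \in s).
  split=> [w|w c] ws.
    have /A1[wx|//] : A w by apply: cA.1; apply/A1; right.
    have : A (rcons w 0) by apply/A1; right.
    by move=> /wlex; rewrite weight_rcons wx; lia.
  have /A1[wx|//] : A (rcons w c) by apply: cA.2; apply/A1; right.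
  have : A (rcons w c.+1) by apply/A1; right.
  by move=> /wlex; rewrite -wx !weight_rcons; lia.
have [||L tL pL] := IH s ss _ cs _ s0; first by case/andP: uxs.
  by [].
have xL : x \notin L by rewrite (perm_mem pL); case/andP: uxs.
have Ax : A x by apply/A1; left.
have As y : A y -> y != x -> y \in L.
  by move=> /A1[->|]; rewrite ?eqxx// (perm_mem pL).
have [w wL xw] : exists2 w, w \in L & x = rcons w (kids L w).
  case/lastP: x xL Ax As {A1 pM uxs Mxs xmax wlex}=> [|w c] xL Ax As.
    by rewrite (ptree_nil tL) in xL.
  have wL : w \in L.
    apply: As; first exact: left_closed_parent Ax.
    by apply/eqP => /(congr1 size); rewrite size_rcons; lia.
  exists w => //; congr rcons; apply/eqP; rewrite eqn_leq.
  move: xL; rewrite (ptree_mem_rcons _ _ tL) wL /= -leqNgt => ->; rewrite andbT.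
  case: c Ax As => // c Ax As.
  have : rcons w c \in L.
    by apply: As; [exact: cA.2|rewrite eqseq_rcons eqxx/= ltn_eqF].
  by rewrite (ptree_mem_rcons _ _ tL) => /andP[].
exists (rcons L x); first by rewrite xw; exact: ptreeS.
by rewrite (perm_trans _ pM)// perm_rcons perm_cons.
Qed.

Definition isomorphic (A : seq nat -> Prop) (k : nat) (tp : nat -> nat) :=
  exists phi : nat -> seq nat,
    [/\ phi 0 = [::],
        (forall i, i < k -> A (phi i)),
        (forall i j, i < k -> j < k -> phi i = phi j -> i = j),
        (forall u, A u -> exists2 i, i < k & phi i = u)
      & (forall i, 0 < i < k -> exists c, phi i = rcons (phi (tp i)) c)].

Lemma isomorphic_ext A B k tp : (forall w, A w <-> B w) ->
  isomorphic A k tp -> isomorphic B k tp.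
Proof.
move=> AB [phi [p0 pA pi ps pt]]; exists phi; split=> //.
  by move=> i ik; apply/AB/pA.
by move=> u /AB/ps.
Qed.

Lemma nonequivalent_subseq (T : eqType) (e : rel T) (s : seq T) : reflexive e ->
  exists t : seq T, [/\ {subset t <= s}, pairwise (fun x y => ~~ e x y) t &
    forall x, x \in s -> exists2 y, y \in t & e x y].
Proof.
move=> er; elim: s => [|x s [t [ts pt st]]]; first by exists [::].
have [xt|xt] := boolP (has (e x) t).
  exists t; split=> // [y /ts ys|y]; first by rewrite inE ys orbT.
  by rewrite inE => /predU1P[->|/st//]; exact/hasP.
exists (x :: t); split.
- by move=> y; rewrite !inE => /predU1P[->|/ts->]; rewrite ?eqxx ?orbT.
- by rewrite pairwise_cons pt -all_predC in xt *; rewrite andbT.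
- move=> y; rewrite inE => /predU1P[->|/st[z zt yz]].
    by exists x; rewrite ?mem_head.
  by exists z => //; rewrite inE zt orbT.
Qed.

(** Turns the condition of having an unordered shape into a finite disjoint union of conditions
    [exactly A L L]: [WW] keeps one listing of each plane tree of that shape, and existence and
    uniqueness of [L] for a given [A] are the third and fifth clauses. *)
Lemma plane_trees_of_shape (k : nat) (tp : nat -> nat) : 0 < k ->
  exists WW : seq (seq (seq nat)),
  [/\ uniq WW, forall L, L \in WW -> ptree L /\ size L = k,
      forall A, left_closed A -> isomorphic A k tp ->
        exists2 L, L \in WW & exactly A L L,
      forall A L, left_closed A -> L \in WW -> exactly A L L ->
        isomorphic A k tp
    & forall A L M, left_closed A -> L \in WW -> M \in WW ->
        exactly A L L -> exactly A M M -> L = M].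
Proof.
move=> k0.
have [t [ts tpw st]] := nonequivalent_subseq
  [seq L <- ptrees k | `[< isomorphic (fun w => w \in L) k tp >]]
  (perm_refl (T := (seq nat : eqType))).
have tP L : L \in t ->
    [/\ ptree L, size L = k & isomorphic (fun w => w \in L) k tp].
  move=> /ts; rewrite mem_filter => /andP[/asboolP iL Lk].
  by split; [exact: ptreesP Lk|exact: ptrees_size|].
have tinj L M : L \in t -> M \in t -> perm_eq L M -> L = M.
  elim: t tpw {ts st tP} => //= x t IH => /andP[/allP xt pt].
  rewrite !inE => /predU1P[->|Lt] /predU1P[->|Mt]//.
  - by move=> ?; have := xt _ Mt => /negP.
  - by rewrite perm_sym => ?; have := xt _ Lt => /negP.
  - exact: IH.
exists t; split.
- elim: t tpw {ts st tP tinj} => //= x t IH => /andP[/allP xt pt].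
  rewrite IH// andbT; apply/negP => xx; have := xt _ xx.
  by rewrite perm_refl.
- by move=> L /tP[].
- move=> A cA iA.
  have [phi [p0 pA pi ps pt]] := iA.
  have [|||L tL pL] := @left_closed_ptree A [seq phi i | i <- iota 0 k] cA.
  + rewrite map_inj_in_uniq ?iota_uniq// => i j.
    by rewrite !mem_iota !add0n => /andP[_ ik] /andP[_ jk]; exact: pi.
  + by rewrite -size_eq0 size_map size_iota -lt0n.
  + move=> w; split=> [/ps[i ik <-]|/mapP[i]].
      by apply/mapP; exists i; rewrite ?mem_iota.
    by rewrite mem_iota => /andP[_ ik] ->; exact: pA.
  have AL w : A w <-> w \in L.
    rewrite (perm_mem pL); split=> [/ps[i ik <-]|/mapP[i]].
      by apply/mapP; exists i; rewrite ?mem_iota.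
    by rewrite mem_iota => /andP[_ ik] ->; exact: pA.
  have sL : size L = k by rewrite (perm_size pL) size_map size_iota.
  have [|M Mt LM] := st L.
    rewrite mem_filter -{2}sL ptree_ptrees// andbT.
    exact/asboolP/(isomorphic_ext AL).
  exists M => //; apply/exactlyP => //; first by have [] := tP _ Mt.
  by move=> w; rewrite -(perm_mem LM).
- move=> A L cA Lt; have [tL _ iL] := tP _ Lt.
  by move=> /(exactlyP cA tL) AL; apply: isomorphic_ext iL => w; rewrite AL.
- move=> A L M cA Lt Mt; have [tL _ _] := tP _ Lt; have [tM _ _] := tP _ Mt.
  move=> /(exactlyP cA tL) AL /(exactlyP cA tM) AM; apply: tinj => //.
  apply: uniq_perm; rewrite ?ptree_uniq// => w.
  by apply/idP/idP => [/AL/AM|/AM/AL].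
Qed.

End words.

(** * Recursive trees and their fringes *)

Section trees.
Local Open Scope nat_scope.
Implicit Types (s : seq nat) (u v : nat).

Definition is_tree s := forall w, 0 < w < size s -> par s w < w.

(** Being filtered from an increasing list, children come in order of arrival; this is the plane
    structure that corresponds to birth order in the branching process. *)
Definition children s u := [seq w <- iota 1 (size s).-1 | par s w == u].

(* The vertex reached from [v] along the Ulam-Harris word [w]; the value
   [size s] stands for a missing vertex. *)
Definition vertex_at s v w :=
  foldl (fun a c => nth (size s) (children s a) c) v w.

Lemma mem_children s u w :
  (w \in children s u) = [&& 0 < w, w < size s & par s w == u].
Proof.
rewrite mem_filter mem_iota andbC add1n; case: w => //= w; congr (_ && _).
by case: (size s) => [|n] //=.
Qed.

Lemma children_gt s u w : is_tree s -> w \in children s u -> u < w.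
Proof.
by move=> ts; rewrite mem_children => /and3P[w0 ws /eqP <-]; apply: ts; rewrite w0.
Qed.

Lemma children_lt s u w : w \in children s u -> w < size s.
Proof. by rewrite mem_children => /and3P[]. Qed.

Lemma children_default s u : is_tree s -> size s <= u -> children s u = [::].
Proof.
move=> ts su; apply/eqP; rewrite -[_ == _]negbK -has_filter.
apply/hasPn => w; rewrite mem_iota add1n => /andP[w0 ws].
have ws' : w < size s by move: ws; case: (size s) w0 => //; lia.
have := ts w; rewrite w0 ws' => /(_ isT) pw.
by apply/negP => /eqP e; move: pw; rewrite e; lia.
Qed.

Lemma children_sorted s u : sorted ltn (children s u).
Proof. by apply: sorted_filter; [exact: ltn_trans|exact: iota_ltn_sorted]. Qed.

Lemma children_uniq s u : uniq (children s u).
Proof. exact/filter_uniq/iota_uniq. Qed.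

Lemma vertex_at_rcons s v w c : vertex_at s v (rcons w c) =
  nth (size s) (children s (vertex_at s v w)) c.
Proof. by rewrite /vertex_at foldl_rcons. Qed.

Lemma vertex_at_lt s v w c : vertex_at s v (rcons w c) < size s ->
  c < size (children s (vertex_at s v w)).
Proof.
rewrite vertex_at_rcons => ws; rewrite ltnNge; apply/negP => cs.
by move: ws; rewrite nth_default// ltnn.
Qed.

Lemma vertex_at_child s v w c : vertex_at s v (rcons w c) < size s ->
  vertex_at s v (rcons w c) \in children s (vertex_at s v w).
Proof. by move=> /vertex_at_lt cs; rewrite vertex_at_rcons mem_nth. Qed.

Lemma vertex_at_left_closed s v : is_tree s ->
  left_closed (fun w => vertex_at s v w < size s).
Proof.
move=> ts; split=> [w|w c] ws.
  rewrite ltnNge; apply/negP => sw; move: ws.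
  by rewrite vertex_at_rcons children_default// ltnn.
rewrite vertex_at_rcons (children_lt (u := vertex_at s v w))//.
by rewrite mem_nth// ltnW// (vertex_at_lt ws).
Qed.

(** Labels strictly increase along descending paths, so only the empty word reaches [v] itself; the
    equality case starts the induction for injectivity. *)
Lemma vertex_at_ge s v w : is_tree s -> vertex_at s v w < size s ->
  v <= vertex_at s v w ?= iff (w == [::]).
Proof.
move=> ts; elim/last_ind: w => [_|w c IH ws]; first by split; rewrite ?eqxx.
have pw := left_closed_parent (vertex_at_left_closed v ts) ws.
have [le _] := IH pw; have gt := children_gt ts (vertex_at_child ws).
split; first exact: leq_trans le (ltnW gt).
rewrite rcons_neq0; apply/negbTE; rewrite neq_ltn.
by rewrite (leq_ltn_trans le gt).
Qed.

Lemma vertex_at_inj s v w w' : is_tree s -> vertex_at s v w < size s ->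
  vertex_at s v w = vertex_at s v w' -> w = w'.
Proof.
move=> ts; elim/last_ind: w w' => [w' vs e|w c IH w' ws].
  have /(vertex_at_ge ts)[_] : vertex_at s v w' < size s by rewrite -e.
  by rewrite -e eqxx => /esym/eqP.
have [_ vne] := vertex_at_ge ts ws.
case/lastP: w' => [e|w' c' e].
  by move: vne; rewrite e eqxx rcons_neq0.
have ws' : vertex_at s v (rcons w' c') < size s by rewrite -e.
have pw := left_closed_parent (vertex_at_left_closed v ts) ws.
have pe : vertex_at s v w = vertex_at s v w'.
  have := vertex_at_child ws; rewrite e mem_children => /and3P[_ _ /eqP <-].
  by have := vertex_at_child ws'; rewrite mem_children => /and3P[_ _ /eqP <-].
rewrite -(IH _ pw pe) in ws' e *; congr rcons.
apply/eqP; rewrite -(nth_uniq (size s) (vertex_at_lt ws) (vertex_at_lt ws') (children_uniq _ _)).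
by apply/eqP; rewrite -!vertex_at_rcons.
Qed.

Lemma is_descP s v u : reflect (exists j, j <= size s /\ iter j (par s) u = v)
  (is_desc s v u).
Proof.
apply: (iffP hasP) => [[j]|[j [js <-]]].
  by rewrite mem_iota add0n ltnS => /andP[_ js] /eqP; exists j.
by exists j; rewrite ?mem_iota ?add0n ?ltnS.
Qed.

Lemma is_desc_parent s v u : is_desc s v u -> u != v -> is_desc s v (par s u).
Proof.
move=> /is_descP[[|j] [js]]; first by move=> /= -> /[!eqxx].
by rewrite iterSr => e _; apply/is_descP; exists j; split=> //; exact: ltnW.
Qed.

Lemma vertex_at_desc s v w : is_tree s -> vertex_at s v w < size s ->
  is_desc s v (vertex_at s v w).
Proof.
move=> ts; suff H : vertex_at s v w < size s -> exists j,
    j <= vertex_at s v w /\ iter j (par s) (vertex_at s v w) = v.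
  move=> vs; have [j [js e]] := H vs; apply/is_descP; exists j.
  by split=> //; exact: leq_trans js (ltnW vs).
elim/last_ind: w => [_|w c IH ws]; first by exists 0.
have pw := left_closed_parent (vertex_at_left_closed v ts) ws.
have [j [js e]] := IH pw; exists j.+1.
have := vertex_at_child ws => cw; split.
  exact: leq_ltn_trans js (children_gt ts cw).
by rewrite iterSr; move: cw; rewrite mem_children => /and3P[_ _ /eqP ->].
Qed.

Lemma desc_vertex_at s v u : is_tree s -> 0 < v -> par s 0 = 0 -> u < size s ->
  is_desc s v u -> exists w, vertex_at s v w = u.
Proof.
move=> ts v0 p0; elim/ltn_ind: u => u IH us du.
have [->|uv] := eqVneq u v; first by exists [::].
have u0 : 0 < u.
  rewrite lt0n; apply: contraTneq du => ->; apply/is_descP => -[j [_]].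
  by elim: j => [|j IHj]; rewrite ?iterSr ?p0//=; lia.
have pu : par s u < u by apply: ts; rewrite u0.
have [||w ew] := IH _ pu; first exact: ltn_trans us.
  exact: is_desc_parent.
exists (rcons w (index u (children s (par s u)))).
by rewrite vertex_at_rcons ew nth_index// mem_children u0 us eqxx.
Qed.

(** For [v > 0] every descendant is reached by exactly one word. The dummy parent [0] of the root of
    the whole tree forms a loop, so that vertex is kept apart and counted separately. *)
Lemma fringe_isoP s v k tp : is_tree s -> par s 0 = 0 -> 0 < v < size s -> 0 < k ->
  (forall i, 0 < i < k -> tp i < i) ->
  fringe_iso s v k tp <-> isomorphic (fun w => vertex_at s v w < size s) k tp.
Proof.
move=> ts p0 /andP[v0 vs] k0 tpv; split=> [[phi [p1 p2 p3 p4 p5]]|[phi [p1 p2 p3 p4 p5]]].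
  have Pphi i : exists w, i < k -> vertex_at s v w = phi i.
    have [/p2[ps pd]|_] := ltnP i k; last by exists [::].
    by have [w] := desc_vertex_at ts v0 p0 ps pd; exists w.
  have [psi psiE] := choice Pphi; exists psi; split.
  - by apply: (vertex_at_inj (v := v) ts); rewrite psiE// p1.
  - by move=> i ik; rewrite psiE//; have [] := p2 _ ik.
  - by move=> i j ik jk e; apply: p3 => //; rewrite -psiE// e psiE.
  - move=> w ws; have [i ik e] := p4 _ ws (vertex_at_desc ts ws); exists i => //.
    by apply: (vertex_at_inj (v := v) ts); rewrite psiE// e.
  - move=> i /andP[i0 ik].
    have [ps pd] := p2 _ ik.
    have iv : phi i != v.
      by apply/eqP; rewrite -p1 => /(p3 _ _ ik k0) i00; rewrite i00 in i0.
    have pp := p5 i; rewrite i0 ik in pp; have {}pp := pp isT.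
    have phi0 : 0 < phi i.
      rewrite lt0n; apply/eqP => e0; move: pd; rewrite e0 => /is_descP[j [_]].
      by elim: j => [|j IHj]; rewrite ?iterSr ?p0//=; lia.
    case/lastP E : (psi i) => [|w c].
      by have := psiE _ ik; rewrite E /= => vv; rewrite -vv eqxx in iv.
    have e : vertex_at s v (rcons w c) = phi i by rewrite -E psiE.
    have es : vertex_at s v (rcons w c) < size s by rewrite e.
    exists c; congr rcons.
    have ew : vertex_at s v w = phi (tp i).
      rewrite -pp -e; have := vertex_at_child es.
      by rewrite mem_children => /and3P[_ _ /eqP ->].
    have ws : vertex_at s v w < size s.
      exact: left_closed_parent (vertex_at_left_closed v ts) es.
    have [j jk ej] := p4 _ ws (vertex_at_desc ts ws).
    have tk : tp i < k by apply: (ltn_trans _ ik); apply: tpv; rewrite i0 ik.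
    apply: (vertex_at_inj (v := v) ts ws). by rewrite ew psiE.
exists (vertex_at s v \o phi) => /=; split.
- by rewrite p1.
- by move=> i ik; split; [exact: p2|exact: vertex_at_desc (p2 _ ik)].
- by move=> i j ik jk e; apply: p3 => //; apply: (vertex_at_inj ts (p2 _ ik) e).
- move=> u us /(desc_vertex_at ts v0 p0 us)[w ew].
  by have [|i ik pw] := p4 w; [rewrite ew|exists i; rewrite ?pw].
- move=> i i0k; have [c e] := p5 _ i0k; have [i0 ik] := andP i0k.
  have := p2 _ ik; rewrite e => /vertex_at_child.
  by rewrite mem_children => /and3P[_ _ /eqP].
Qed.

End trees.

(** * Prescribed positions of descendants, followed one arrival at a time *)

Section patterns.
Local Open Scope nat_scope.
Implicit Types (s : seq nat) (L obs : seq (seq nat)) (I : seq nat -> nat).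

(** Every parent in [L] is observed, so the position of each non-root word is constrained by the
    child list of an observed vertex. *)
Definition observes L obs :=
  [/\ uniq obs, {subset obs <= L} & forall w c, rcons w c \in L -> w \in obs].

Lemma observes_all L : ptree L -> observes L L.
Proof.
move=> tL; split=> [||w c]; rewrite ?ptree_uniq//.
by rewrite (ptree_mem_rcons _ _ tL) => /andP[].
Qed.

Definition kid_values L I w := [seq I (rcons w c) | c <- iota 0 (kids L w)].

Lemma kid_valuesP L I w x : ptree L -> w \in L ->
  reflect (exists2 c, rcons w c \in L & x = I (rcons w c)) (x \in kid_values L I w).
Proof.
move=> tL wL; apply: (iffP mapP) => -[c].
  rewrite mem_iota add0n => /andP[_ ck] ->; exists c => //.
  by rewrite (ptree_mem_rcons _ _ tL) wL.
rewrite (ptree_mem_rcons _ _ tL) => /andP[_ ck] ->.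
by exists c; rewrite ?mem_iota.
Qed.

Definition pattern s L obs I :=
  all (fun w => children s (I w) == kid_values L I w) obs.

(** Replaces conditions on whole paths by equality of child lists, a condition that changes by at
    most one entry per arrival and can therefore be followed in time. *)
Lemma patternP s v L obs I : is_tree s -> ptree L -> observes L obs ->
  I [::] = v -> (forall w, w \in L -> I w < size s) ->
  ((forall w, w \in L -> vertex_at s v w = I w) /\
   (forall w, w \in obs -> ~ vertex_at s v (rcons w (kids L w)) < size s)) <->
  pattern s L obs I.
Proof.
move=> ts tL [uo oL Lo] Iv Is; split=> [[vI vn]|/allP pI].
  apply/allP => w wo; have wL := oL _ wo; apply/eqP.
  have nthE c : c < kids L w -> nth (size s) (children s (I w)) c = I (rcons w c).
    move=> ck; have wcL : rcons w c \in L by rewrite (ptree_mem_rcons _ _ tL) wL.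
    by rewrite -(vI _ wcL) vertex_at_rcons vI.
  have sz : size (children s (I w)) = kids L w.
    apply/eqP; rewrite eqn_leq; apply/andP; split.
      rewrite leqNgt; apply/negP => sk; apply: (vn w wo).
      rewrite vertex_at_rcons vI//.
      by rewrite (children_lt (u := I w))// mem_nth.
    case E : (kids L w) => [//|k].
    have ek := nthE k; rewrite E ltnSn in ek; have {}ek := ek isT.
    rewrite ltnNge; apply/negP => sk; move: ek; rewrite nth_default// => ek.
    have wkL : rcons w k \in L by rewrite (ptree_mem_rcons _ _ tL) wL E /=.
    by have := Is _ wkL; rewrite -ek ltnn.
  apply: (@eq_from_nth _ (size s)); first by rewrite size_map size_iota.
  move=> c; rewrite sz => ck; rewrite nthE// (nth_map 0) ?size_iota//.
  by rewrite nth_iota.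
have vI w : w \in L -> vertex_at s v w = I w.
  elim/last_ind: w => [|w c IH wcL]; first by rewrite Iv.
  have wo := Lo _ _ wcL.
  have ck : c < kids L w by move: wcL; rewrite (ptree_mem_rcons _ _ tL) => /andP[].
  rewrite vertex_at_rcons IH ?oL// (eqP (pI _ wo)) (nth_map 0) ?size_iota//.
  by rewrite nth_iota.
split=> // w wo.
rewrite vertex_at_rcons vI ?oL// (eqP (pI _ wo)) nth_default ?ltnn//.
by rewrite size_map size_iota.
Qed.

Definition good_values L I :=
  [/\ forall w c, rcons w c \in L -> I w < I (rcons w c),
      forall w c, rcons w c.+1 \in L -> I (rcons w c) < I (rcons w c.+1)
    & {in L &, injective I}].

Lemma pattern_good s L obs I : is_tree s -> ptree L -> observes L obs ->
  (forall w, w \in L -> I w < size s) -> pattern s L obs I -> good_values L I.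
Proof.
move=> ts tL oL Is pI.
have [vI _] := (patternP ts tL oL erefl Is).2 pI.
have [uo oL' Lo] := oL.
have kL w c : rcons w c \in L -> c < kids L w.
  by rewrite (ptree_mem_rcons _ _ tL) => /andP[].
have chE w c : rcons w c \in L -> children s (I w) = kid_values L I w.
  by move=> /Lo wo; have /allP/(_ _ wo)/eqP := pI.
split.
- move=> w c wcL; have wo := Lo _ _ wcL; apply: (children_gt ts).
  rewrite (chE _ _ wcL); apply/kid_valuesP => //; first exact: oL'.
  by exists c.
- move=> w c wcL; have := children_sorted s (I w).
  rewrite (chE _ _ wcL) => /(sortedP 0)/(_ c).
  have ck := kL _ _ wcL; have ck' := ltnW ck.
  rewrite size_map size_iota => /(_ ck).
  by rewrite !(nth_map 0) ?size_iota// !nth_iota.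
- move=> w w' wL w'L e; apply: (vertex_at_inj (v := I [::]) ts).
    by rewrite vI// Is.
  by rewrite !vI.
Qed.

Lemma kid_values_sorted L I w : ptree L -> good_values L I -> w \in L ->
  sorted ltn (kid_values L I w).
Proof.
move=> tL [_ I2 _] wL; apply/(sortedP 0) => c.
rewrite size_map size_iota => ck; have ck' := ltnW ck.
rewrite !(nth_map 0) ?size_iota// !nth_iota//.
by apply: I2; rewrite (ptree_mem_rcons _ _ tL) wL.
Qed.

Lemma filter_ltnS (N : nat) (t : seq nat) : sorted ltn t ->
  [seq x <- t | x < N.+1] =
  [seq x <- t | x < N] ++ (if N \in t then [:: N] else [::]).
Proof.
elim: t => //= x t IH; rewrite (path_sortedE ltn_trans) => /andP[/allP xt st].
rewrite IH// inE ltnS; have [xN|Nx|<-] := ltngtP x N => /=.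
- by rewrite ?(ltnW xN).
- have Nt : N \notin t by apply/negP => /xt; lia.
  by rewrite (negPf Nt).
- have Nt : x \notin t by apply/negP => /xt; lia.
  rewrite (negPf Nt) cats0 (_ : [seq y <- t | y < x] = [::])//.
  by apply/eqP; rewrite -[_ == _]negbK -has_filter; apply/hasPn => y /xt; lia.
Qed.

Lemma children_rcons s u v : 0 < size s ->
  (forall x, x < size s -> par (rcons s v) x = par s x) /\
  children (rcons s v) u = children s u ++ (if v == u then [:: size s] else [::]).
Proof.
move=> s0.
have pE x : x < size s -> par (rcons s v) x = par s x.
  by move=> xs; rewrite /par nth_rcons xs.
split=> //; rewrite /children size_rcons /=.
have -> : iota 1 (size s) = rcons (iota 1 (size s).-1) (size s).
  by case: (size s) s0 => // n _; rewrite -{1}[n.+1]addn1 iotaD cats1.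
rewrite filter_rcons /par nth_rcons ltnn eqxx.
have -> : [seq w <- iota 1 (size s).-1 | nth 0 (rcons s v) w == u] =
    [seq w <- iota 1 (size s).-1 | par s w == u].
  apply: eq_in_filter => x; rewrite mem_iota add1n => /andP[x0 xs].
  by rewrite -/(par _ _) pE//; move: xs; rewrite prednK.
by case: eqP => _; rewrite ?cats1 ?cats0.
Qed.

Lemma is_tree_rcons s v : is_tree s -> v < size s -> is_tree (rcons s v).
Proof.
move=> ts vs w; rewrite size_rcons ltnS => /andP[w0].
rewrite leq_eqVlt /par nth_rcons => /predU1P[->|ws]; first by rewrite ltnn eqxx.
by rewrite ws; apply: ts; rewrite w0.
Qed.

(** Kids whose prescribed position is at least [size s] are still to come; restricting to those
    already present makes the event factor over arrivals. *)
Definition partial_pattern s L obs I :=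
  all (fun w => children s (I w) == [seq x <- kid_values L I w | x < size s]) obs.

Lemma partial_patternE s L obs I : ptree L -> observes L obs ->
  (forall w, w \in L -> I w < size s) ->
  partial_pattern s L obs I = pattern s L obs I.
Proof.
move=> tL [_ oL _] Is; apply: eq_in_all => w wo; congr (_ == _).
apply/all_filterP/allP => x /kid_valuesP[//||c wcL ->]; first exact: oL.
exact: Is.
Qed.

Definition compatible_parent L obs I N v :=
  all (fun w => (v == I w) == (N \in kid_values L I w)) obs.

Lemma partial_pattern_rcons s v L obs I : ptree L -> observes L obs ->
  good_values L I -> 0 < size s -> is_tree s -> 
  partial_pattern (rcons s v) L obs I =
  partial_pattern s L obs I && compatible_parent L obs I (size s) v.
Proof.
move=> tL [_ oL _] gI s0 ts.
rewrite -all_predI; apply: eq_in_all => w wo /=.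
have [_ ->] := children_rcons (I w) v s0.
rewrite size_rcons filter_ltnS; last exact: kid_values_sorted (oL _ wo).
have nc : size s \notin children s (I w).
  by apply/negP => /children_lt; rewrite ltnn.
have nf : size s \notin [seq x <- kid_values L I w | x < size s].
  by rewrite mem_filter ltnn.
case: (v == I w); case: (size s \in _); rewrite /= ?cats0 ?andbT ?andbF//.
- by rewrite !cats1 eqseq_rcons eqxx andbT.
- by apply/negbTE/eqP => e; move: nf; rewrite -e mem_cat mem_head orbT.
- by apply/negbTE/eqP => e; move: nc; rewrite e mem_cat mem_head orbT.
Qed.

Lemma degTE s m v : is_tree s -> 0 < v < m -> m <= size s ->
  degT s m v = (count (fun x => x < m) (children s v)).+1.
Proof.
move=> ts /andP[v0 vm] ms; rewrite /degT leqNgt (leq_ltn_trans v0 vm) /= -lt0n v0 addn1.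
congr _.+1; rewrite /children count_filter.
have -> : (size s).-1 = m.-1 + (size s - m) by lia.
rewrite iotaD count_cat [X in _ = _ + X](_ : _ = 0) ?addn0.
  apply: eq_in_count => x; rewrite mem_iota => /andP[_ xm] /=.
  by have -> : x < m by lia.
apply/eqP; rewrite eqn0Ngt -has_count; apply/hasPn => x.
rewrite mem_iota => /andP[mx _] /=; rewrite negb_and.
by have -> : (x < m) = false by lia.
Qed.

(** With only the root observed, this encodes the event of having exactly [k] children; it makes the
    degree statement an instance of the pattern statement. *)
Definition star k : seq (seq nat) := [::] :: [seq [:: c] | c <- iota 0 k].

Lemma kids_star k : kids (star k) [::] = k.
Proof.
by rewrite /kids /= add0n count_map (eq_count (a2 := predT)) ?count_predT ?size_iota.
Qed.

Lemma ptree_star k : ptree (star k).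
Proof.
elim: k => [|k IH]; first exact: ptree1.
have -> : star k.+1 = rcons (star k) (rcons [::] (kids (star k) [::])).
  by rewrite kids_star /star -[k.+1]addn1 iotaD cats1 map_rcons.
exact: ptreeS (ptree_nil IH).
Qed.

Lemma observes_star k : observes (star k) [:: [::]].
Proof.
split=> // [w|w c]; first by rewrite inE => /eqP ->; exact: mem_head.
rewrite (ptree_mem_rcons _ _ (ptree_star k)) inE => /andP[].
rewrite inE => /predU1P[->//|/mapP[x _ ->]].
by rewrite /kids /= count_map (eq_count (a2 := pred0)) ?count_pred0.
Qed.

Lemma degT_star s v k : is_tree s -> 0 < v < size s ->
  exactly (fun w => vertex_at s v w < size s) (star k) [:: [::]] <->
  degT s (size s) v = k.+1.
Proof.
move=> ts vs; rewrite degTE// (eq_in_count (a2 := predT)); last first.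
  by move=> x /children_lt ->.
rewrite count_predT; split=> [[h1 h2]|[sk]].
  congr _.+1; apply/eqP; rewrite eqn_leq; apply/andP; split.
    rewrite leqNgt; apply/negP => ks; apply: (h2 [::]); rewrite ?mem_head//.
    by rewrite kids_star vertex_at_rcons (children_lt (u := v))// mem_nth.
  case: k h1 {h2} => // k h1; apply: (@vertex_at_lt s v [::]).
  apply: h1; rewrite inE; apply/orP; right; apply/mapP; exists k => //.
  by rewrite mem_iota add0n ltnSn.
split=> [w|w].
  rewrite inE => /predU1P[->|/mapP[c]]; first by case/andP: vs.
  rewrite mem_iota => /andP[_ ck] ->.
  by rewrite (children_lt (u := v))//= mem_nth// sk.
rewrite inE => /eqP ->; rewrite kids_star vertex_at_rcons nth_default ?ltnn//.
by rewrite sk.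
Qed.

End patterns.

(** * Pattern probabilities in the delayed attachment tree *)

Section delay.
Context {R : realType}.
Variable mu : probability R R.

Definition delay_set (n m : nat) : set R :=
  [set x : R | m%:R <= n%:R - n%:R * x < m.+1%:R].

Lemma measurable_delay_set n m : measurable (delay_set n m).
Proof.
rewrite (_ : delay_set n m = (fun x : R => n%:R - n%:R * x) @^-1` `[m%:R, m.+1%:R[%classic).
  rewrite -[X in measurable X]setTI.
  by apply: measurable_funB => //; apply: measurable_funM.
by apply/seteqP; split=> x /=; rewrite in_itv.
Qed.

Lemma delay_probE n m : delay_prob mu n m = fine (mu (delay_set n m)).
Proof.
rewrite /delay_prob; congr (fine (mu _)); apply/seteqP; split=> x /=.
  by move/eqP; rewrite floor_eq intrD /= natr1.
by move=> xm; apply/eqP; rewrite floor_eq intrD /= natr1.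
Qed.

Lemma trivIset_delay_set n : trivIset setT (delay_set n).
Proof.
apply/trivIsetP => i j _ _; apply: contraNeq => /set0P[x [/= /andP[i1 i2] /andP[j1 j2]]].
have := le_lt_trans i1 j2; have := le_lt_trans j1 i2; rewrite !ltr_nat !ltnS => ji ij.
by rewrite eqn_leq ij ji.
Qed.

Lemma delay_prob_ge0 n m : 0 <= delay_prob mu n m.
Proof. exact: fine_ge0. Qed.

(** Mass one on [[0, 1]] forces [n - n * x] into [[0, n]] almost surely, so its floor takes one of
    the values [0, ..., n]. *)
Lemma sum_delay_prob n : mu [set x : R | (0 <= x)%R /\ (x <= 1)%R] = 1%E ->
  \sum_(0 <= m < n.+1) delay_prob mu n m = 1.
Proof.
move=> mu01; rewrite big_mkord; apply: EFin_inj.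
rewrite (eq_bigr (fun m : 'I_n.+1 => fine (mu (delay_set n m)))); last first.
  by move=> m _; rewrite delay_probE.
rewrite EFin_sum_fine; last by move=> i _; apply: fin_num_measure; exact: measurable_delay_set.
rewrite -(measure_bigsetU mu (fun m => measurable_delay_set n m) (@trivIset_delay_set n)).
have mU : measurable (\big[setU/set0]_(i < n.+1) delay_set n i).
  by apply: bigsetU_measurable => i _; exact: measurable_delay_set.
apply/eqP; rewrite eq_le; apply/andP; split; first exact: probability_le1.
rewrite -mu01; apply: le_measure; rewrite ?inE//.
  rewrite (_ : [set x : R | _] = `[0%R, 1%R]%classic); first exact: measurable_itv.
  by apply/seteqP; split=> x /=; rewrite in_itv /= => /andP.
move=> x [x0 x1]; rewrite -bigcup_mkord.
have f0 : (0 <= Num.floor (n%:R - n%:R * x)).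
  by rewrite floor_ge0 subr_ge0 ler_piMr.
exists `|Num.floor (n%:R - n%:R * x)|%N => /=.
  rewrite ltnS -lez_nat gez0_abs// -(ler_int R).
  apply: le_trans (floor_le _) _; rewrite gerBl mulr_ge0//.
rewrite /delay_set /=.
have := floor_itv (n%:R - n%:R * x).
by rewrite -(gez0_abs f0) intrD /= natr1.
Qed.

End delay.

(** * Law of the tree and pattern probabilities as products over arrivals *)

Section expectation.
Context {R : realType}.
Variables (mu : probability R R) (alpha : R).
Hypothesis alpha0 : 0 <= alpha.
Hypothesis mu01 : mu [set x : R | (0 <= x)%R /\ (x <= 1)%R] = 1%E.

(** The [m - 1] edges contribute two half-edges each and every vertex adds [alpha]; the numbers of
    children are summed by exchanging with the sum over non-root vertices. *)
Lemma sum_degT s m : is_tree s -> (1 < m <= size s)%N ->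
  \sum_(0 <= u < m) ((degT s m u)%:R + alpha) = (2 * m.-1)%:R + alpha * m%:R.
Proof.
move=> ts /andP[m1 ms]; rewrite big_split /= sumr_const_nat subn0 mulr_natr.
congr (_ + _); rewrite -natr_sum; congr _%:R.
under eq_bigr do rewrite /degT leqNgt m1 /=.
rewrite big_split /= mul2n -addnn; congr addn.
  transitivity (\sum_(0 <= u < m) \sum_(x <- iota 1 m.-1) (par s x == u))%N.
    by apply: eq_bigr => u _; rewrite -sum1_count big_mkcond.
  rewrite exchange_big /= -[RHS](size_iota 1) -sum1_size.
  apply: eq_big_seq => x; rewrite mem_iota => /andP[x0 xm].
  have px : (par s x < m)%N.
    apply: (@ltn_trans x); last by lia.
    by apply: ts; rewrite x0; lia.
  rewrite (bigD1_seq (par s x)) ?mem_index_iota ?iota_uniq//= eqxx.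
  by rewrite big1 ?addn0// => u; rewrite eq_sym => /negPf ->.
case: m m1 {ms} => // m _; rewrite big_nat_recl//= add0n.
by rewrite big_mkord sum_nat_const card_ord muln1.
Qed.

Lemma attach_prob_ge0 s v : 0 <= attach_prob mu alpha s v.
Proof.
apply: sumr_ge0 => m _; apply: mulr_ge0; first exact: delay_prob_ge0.
rewrite /=; case: ifP => // _; apply: divr_ge0; first by rewrite addr_ge0.
by apply: sumr_ge0 => u _; rewrite addr_ge0.
Qed.

Lemma sum_attach_prob s : is_tree s -> (0 < size s)%N ->
  \sum_(v <- iota 0 (size s)) attach_prob mu alpha s v = 1.
Proof.
move=> ts s0; rewrite /attach_prob exchange_big /= -[RHS](sum_delay_prob (size s) mu01).
apply: eq_big_nat => m /andP[_ ms].
rewrite -mulr_sumr; set m' := maxn m 1; have m'0 : (0 < m')%N by rewrite leq_max orbT.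
have m's : (m' <= size s)%N by rewrite geq_max -ltnS ms.
rewrite -big_mkcond /= -big_filter.
have -> : [seq v <- iota 0 (size s) | (v < m')%N] = index_iota 0 m'.
  rewrite /index_iota subn0 -{1}(subnKC m's) iotaD filter_cat.
  have /all_filterP -> : all (fun v => (v < m')%N) (iota 0 m').
    by apply/allP => x; rewrite mem_iota.
  rewrite -[RHS]cats0; congr cat; apply/eqP; rewrite -[_ == _]negbK -has_filter.
  by apply/hasPn => x; rewrite mem_iota => /andP[]; rewrite leqNgt.
rewrite -mulr_suml mulfV ?mulr1//; apply: lt0r_neq0.
have [m1|m1] := ltnP 1 m'.
  rewrite sum_degT ?m1// ltr_wpDr ?mulr_ge0// ltr0n; lia.
have -> : m' = 1%N by lia.
by rewrite big_nat1 /degT ltr_pwDl.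
Qed.

Lemma tree_law_support n ws : ws \in tree_law mu alpha n ->
  [/\ 0 <= ws.1, size ws.2 = n, is_tree ws.2 & nth 0%N ws.2 0 = 0%N].
Proof.
elim: n ws => [//|[|[|n]] IH] ws.
- by rewrite /= inE => /eqP -> /=; split=> // -[].
- by rewrite /= inE => /eqP -> /=; split=> // -[|[]].
move=> /flattenP[t /mapP[ws' /IH[w0 sw tw w00] ->]] /mapP[v].
rewrite mem_iota add0n => /andP[_ vn] ->; split=> /=.
- by rewrite mulr_ge0// attach_prob_ge0.
- by rewrite size_rcons sw.
- by apply: is_tree_rcons; rewrite ?sw.
- by rewrite nth_rcons sw.
Qed.

Lemma expect_treeS n f : (1 < n)%N -> expect_tree mu alpha n.+1 f =
  expect_tree mu alpha n (fun s =>
    \sum_(v <- iota 0 n) attach_prob mu alpha s v * f (rcons s v)).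
Proof.
case: n => [|[|n]]// _; rewrite /expect_tree.
have -> : tree_law mu alpha n.+3 =
  flatten [seq [seq (ws.1 * attach_prob mu alpha ws.2 v, rcons ws.2 v)
             | v <- iota 0 n.+2] | ws <- tree_law mu alpha n.+2] by [].
move: (iota 0 n.+2) => r; rewrite big_flatten big_map; apply: eq_bigr => ws _.
by rewrite big_map mulr_sumr; apply: eq_bigr => v _ /=; rewrite mulrA.
Qed.

Lemma eq_expect_tree n f g :
  (forall s, size s = n -> is_tree s -> nth 0%N s 0 = 0%N -> f s = g s) ->
  expect_tree mu alpha n f = expect_tree mu alpha n g.
Proof.
move=> fg; apply: eq_big_seq => ws /tree_law_support[_ sn ts s0].
by rewrite fg.
Qed.

Lemma le_expect_tree n f g :
  (forall s, size s = n -> is_tree s -> nth 0%N s 0 = 0%N -> f s <= g s) ->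
  expect_tree mu alpha n f <= expect_tree mu alpha n g.
Proof.
move=> fg; rewrite /expect_tree big_seq [leRHS]big_seq.
apply: ler_sum => ws /tree_law_support[w0 sn ts s0].
by rewrite ler_wpM2l// fg.
Qed.

Lemma expect_tree_sum n (J : Type) (r : seq J) f :
  expect_tree mu alpha n (fun s => \sum_(j <- r) f j s) =
  \sum_(j <- r) expect_tree mu alpha n (f j).
Proof. by rewrite exchange_big; apply: eq_bigr => ws _; rewrite mulr_sumr. Qed.

Lemma expect_treeZ n c f :
  expect_tree mu alpha n (fun s => c * f s) = c * expect_tree mu alpha n f.
Proof. by rewrite /expect_tree mulr_sumr; apply: eq_bigr => ws _; rewrite mulrCA. Qed.

Lemma expect_tree_cst n c : (0 < n)%N -> expect_tree mu alpha n (fun=> c) = c.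
Proof.
rewrite -[c]mulr1 expect_treeZ => n0; congr (_ * _).
case: n n0 => // -[_|n _]; first by rewrite /expect_tree big_seq1 mulr1.
elim: n => [|n IH]; first by rewrite /expect_tree big_seq1 mulr1.
rewrite expect_treeS// (@eq_expect_tree _ _ (fun=> 1))//.
move=> s ss ts _; rewrite -[RHS](sum_attach_prob ts) ?ss//.
by apply: eq_bigr => v _; rewrite mulr1.
Qed.

(* Expected weight of a seen half-edge: the chance that the vertex arriving as
   number [N] attaches to a vertex [i > 0], per unit of degree acquired at [i]. *)
Definition unit_rate (N i : nat) : R :=
  \sum_(0 <= m < N.+1) delay_prob mu N m *
    (if (i < m)%N then ((2 * m.-1)%:R + alpha * m%:R)^-1 else 0).

Lemma unit_rate_ge0 N i : 0 <= unit_rate N i.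
Proof.
apply: sumr_ge0 => m _; rewrite mulr_ge0 ?delay_prob_ge0//; case: ifP => // _.
by rewrite invr_ge0 addr_ge0// mulr_ge0.
Qed.

Lemma unit_rate_eq0 N i : (N <= i)%N -> unit_rate N i = 0.
Proof.
move=> Ni; rewrite /unit_rate big_nat big1// => m /andP[_ mN].
by rewrite ifF ?mulr0//; apply/negbTE; rewrite -leqNgt; exact: leq_trans Ni.
Qed.

(** A delayed tree that contains vertex [i] has size [m > i], hence total weight at least
    [2 (m - 1) >= 2 i]. *)
Lemma unit_rate_le N i : (0 < i)%N -> unit_rate N i <= (2 * i)%:R^-1.
Proof.
move=> i0.
rewrite (_ : (2 * i)%:R^-1 = \sum_(0 <= m < N.+1) delay_prob mu N m * (2 * i)%:R^-1).
  2: by rewrite -mulr_suml sum_delay_prob// mul1r.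
apply: ler_sum => m _; rewrite ler_wpM2l ?delay_prob_ge0//.
case: ifP => im; last by rewrite invr_ge0 ler0n.
rewrite lef_pV2 ?posrE.
- by rewrite ler_wpDr ?mulr_ge0// ler_nat leq_mul2l/=; lia.
- by rewrite ltr_wpDr ?mulr_ge0// ltr0n; lia.
- by rewrite ltr0n; lia.
Qed.

Section one_pattern.
Variables (L obs : seq (seq nat)) (I : seq nat -> nat).
Hypothesis tL : ptree L.
Hypothesis oL : observes L obs.

(** Attraction of [I w] felt by newcomer [N]: the half-edge to its own parent and [alpha] count once
    [I w] is in the delayed tree, and each kid [x] adds one unit once [x] is in it. Future kids
    contribute nothing because [unit_rate] vanishes for [N <= x]. *)
Definition kid_rate (N : nat) (w : seq nat) : R :=
  (1 + alpha) * unit_rate N (I w) + \sum_(x <- kid_values L I w) unit_rate N x.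

Definition total_rate (N : nat) : R := \sum_(w <- obs) kid_rate N w.

Lemma kid_rate_ge0 N w : 0 <= kid_rate N w.
Proof.
apply: addr_ge0; first by rewrite mulr_ge0 ?unit_rate_ge0// addr_ge0.
by apply: sumr_ge0 => x _; exact: unit_rate_ge0.
Qed.

Definition parent_word (w : seq nat) := take (size w).-1 w.

Lemma parent_word_rcons w c : parent_word (rcons w c) = w.
Proof. by rewrite /parent_word size_rcons -cats1 take_size_cat. Qed.

(** An arrival at the position of a non-root word must attach to the parent of that word; at any
    other time the newcomer must miss all observed vertices. The empty word is left out since the
    parent of the fringe root is free. *)
Definition step_prob (N : nat) : R :=
  if [seq w <- L | (w != [::]) && (I w == N)] is w :: _
  then kid_rate N (parent_word w) else 1 - total_rate N.

Hypothesis gI : good_values L I.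
Hypothesis I0 : (0 < I [::])%N.

Lemma good_ge_root w : w \in L -> (I [::] <= I w)%N.
Proof.
elim/last_ind: w => // w c IH wc; apply: (leq_trans (IH _)).
  by move: wc; rewrite (ptree_mem_rcons _ _ tL) => /andP[].
by have [/(_ _ _ wc)/ltnW] := gI.
Qed.

Lemma step_prob_kid w c : rcons w c \in L ->
  step_prob (I (rcons w c)) = kid_rate (I (rcons w c)) w.
Proof.
move=> wc; have [_ _ inj] := gI; rewrite /step_prob.
rewrite (_ : [seq _ <- L | _] = [:: rcons w c]) ?parent_word_rcons//.
transitivity [seq u <- L | u == rcons w c]; last by rewrite filter_pred1_uniq// ptree_uniq.
apply: eq_in_filter => u uL; apply/andP/eqP => [[_ /eqP/inj]|->]; first exact.
by rewrite rcons_neq0.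
Qed.

Lemma step_prob_other N : (forall w, w \in L -> w != [::] -> I w <> N) ->
  step_prob N = 1 - total_rate N.
Proof.
move=> h; rewrite /step_prob (_ : [seq _ <- L | _] = [::])//.
apply/eqP; rewrite -[_ == _]negbK -has_filter; apply/hasPn => w wL.
by apply/negP => /andP[w0 /eqP]; exact: h.
Qed.

(** Compared term by term in the delayed size [m]: on the partial pattern the degree of [I w] in
    [T(m)] is one plus the number of prescribed kids below [m], and both sides vanish when
    [m <= I w]. *)
Lemma attach_prob_pattern s w : is_tree s -> partial_pattern s L obs I ->
  w \in obs -> (1 < size s)%N -> (I w < size s)%N ->
  attach_prob mu alpha s (I w) = kid_rate (size s) w.
Proof.
move=> ts /allP pp wo s1 ws; have [_ oL' _] := oL; have wL := oL' _ wo.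
have Iw0 : (0 < I w)%N := leq_trans I0 (good_ge_root wL).
rewrite /kid_rate /unit_rate mulr_sumr [X in _ + X]exchange_big /= -big_split /=.
rewrite /attach_prob; apply: eq_big_nat => m /andP[_ ms].
rewrite mulrCA -mulr_sumr -mulrDr; congr (_ * _).
have [Im|mI] := ltnP (I w) m; last first.
  rewrite ifF; last by apply/negbTE; rewrite -leqNgt geq_max mI Iw0.
  rewrite mulr0 add0r big_seq big1// => x /(kid_valuesP _ _ tL wL)[c wc ->].
  rewrite ifF//; apply/negbTE; rewrite -leqNgt (leq_trans mI)//.
  by have [/(_ _ _ wc)/ltnW] := gI.
have m1 : (1 < m)%N by lia.
have -> : maxn m 1 = m by lia.
rewrite Im sum_degT//; last by rewrite m1.
have vm : (0 < I w < m)%N by rewrite Iw0.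
rewrite (degTE ts vm)//.
rewrite (eqP (pp _ wo)) count_filter.
rewrite (_ : count _ _ = count (fun x => (x < m)%N) (kid_values L I w)); last first.
  apply: eq_count => x /=; apply/andP/idP => [[]//|xm]; split=> //.
  by apply: leq_trans xm _; rewrite -ltnS.
rewrite -big_mkcond /= big_const_seq iter_addr addr0 -mulr_natl.
by rewrite mulr1 -natr1 -[X in _ = _ + X]mulr_natl; ring.
Qed.

Lemma sum_compatible s : is_tree s -> partial_pattern s L obs I -> (1 < size s)%N ->
  \sum_(v <- iota 0 (size s)) attach_prob mu alpha s v *
     (compatible_parent L obs I (size s) v)%:R = step_prob (size s).
Proof.
move=> ts pp s1; have [uo oL' Lo] := oL; have [gI1 _ inj] := gI; set N := size s.
have sum1 w : w \in obs -> \sum_(v <- iota 0 N) attach_prob mu alpha s v * (v == I w)%:R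
    = kid_rate N w.
  move=> wo; have wL := oL' _ wo.
  have [wN|Nw] := ltnP (I w) N; last first.
    rewrite big_seq big1 => [|v]; last first.
      rewrite mem_iota add0n => /andP[_ vN].
      by rewrite (_ : (v == I w) = false) ?mulr0//; apply/negbTE; lia.
    rewrite /kid_rate unit_rate_eq0// mulr0 add0r big_seq big1// => x.
    move=> /(kid_valuesP _ _ tL wL)[c wc ->].
    by rewrite unit_rate_eq0// (leq_trans Nw)// ltnW// gI1.
  rewrite (bigD1_seq (I w)) ?iota_uniq ?mem_iota//= eqxx mulr1.
  rewrite big1 ?addr0 ?attach_prob_pattern// => v /negPf ->.
  by rewrite mulr0.
have kidP w : w \in obs ->
    reflect (exists2 c, rcons w c \in L & N = I (rcons w c)) (N \in kid_values L I w).
  by move=> wo; apply: kid_valuesP => //; exact: oL'.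
have [/hasP[w0 w0o Nw0]|/hasPn nN] := boolP (has (fun w => N \in kid_values L I w) obs).
  have [c wc NE] := kidP _ w0o Nw0.
  rewrite [in RHS]NE step_prob_kid// -NE -sum1//; apply: eq_bigr => v _; congr (_ * _%:R).
  congr nat_of_bool; apply/allP/eqP => [/(_ _ w0o)|->].
    by rewrite Nw0 eqb_id => /eqP.
  move=> w wo; apply/eqP; apply/eqP/kidP => //.
    move=> /inj e; rewrite -e ?oL'//; by exists c.
  by move=> [c' wc' NE']; congr I; have := inj _ _ wc wc'; rewrite -NE -NE' => /(_ erefl)/eqP;
     rewrite eqseq_rcons => /andP[/eqP].
rewrite step_prob_other; last first.
  move=> w wL w0 wN; case/lastP: w wL w0 wN => // w c wL _ wN.
  by have /negP := nN _ (Lo _ _ wL); apply; apply/kidP; [exact: Lo wL|exists c].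
transitivity (\sum_(v <- iota 0 N) attach_prob mu alpha s v -
    \sum_(v <- iota 0 N) \sum_(w <- obs) attach_prob mu alpha s v * (v == I w)%:R);
  last first.
  rewrite sum_attach_prob ?(ltnW s1)// exchange_big /=; congr (_ - _).
  by rewrite big_seq [RHS]big_seq; apply: eq_bigr => w wo; rewrite sum1.
rewrite -sumrB; apply: eq_bigr => v _.
rewrite -mulr_sumr -[X in X - _]mulr1 -mulrBr; congr (_ * _).
have -> : compatible_parent L obs I N v = ~~ has (fun w => v == I w) obs.
  rewrite -all_predC; apply: eq_in_all => w wo /=.
  by rewrite (negPf (nN _ wo)) eqbF_neg.
have [/hasP[w wo vw]|/hasPn nv] := boolP (has _ _).
  rewrite (bigD1_seq w)//= vw big_seq_cond big1 ?addr0 ?subrr//.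
  move=> w' /andP[w'o w'w]; case: eqP => // v'; move: w'w.
  by rewrite (inj w' w) ?eqxx ?oL'// -v'; exact/eqP.
rewrite big_seq big1 ?subr0// => w wo.
by rewrite (negPf (nv _ wo)).
Qed.

Lemma expect_partial_pattern n : (1 < n)%N ->
  expect_tree mu alpha n (fun s => (partial_pattern s L obs I)%:R) =
  \prod_(2 <= N < n) step_prob N.
Proof.
have [_ oL' _] := oL.
elim: n => // n IH; rewrite ltnS leq_eqVlt => /predU1P[<-|n1].
  (* In the two-vertex tree every observed position is at least [1] and every kid position at least
     [2], so nothing has been asked yet. *)
  rewrite /expect_tree big_seq1 mul1r big_geq//= (_ : partial_pattern _ _ _ _)//.
  apply/allP => w wo; have wL := oL' _ wo.
  have Iw0 : (0 < I w)%N := leq_trans I0 (good_ge_root wL).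
  apply/eqP; rewrite (_ : [seq x <- _ | _] = [::]); last first.
    apply/eqP; rewrite -[_ == _]negbK -has_filter; apply/hasPn => x.
    move=> /(kid_valuesP _ _ tL wL)[c wc ->]; rewrite -leqNgt.
    by have [+ _ _] := gI => /(_ _ _ wc) /=; lia.
  by rewrite /children /= /par /= ifF//; apply/negbTE; lia.
rewrite expect_treeS// big_nat_recr//= -IH// mulrC -expect_treeZ.
apply: eq_expect_tree => s sn ts _; rewrite -sn in n1 *.
have s0 : (0 < size s)%N by exact: ltnW.
under eq_bigr do rewrite partial_pattern_rcons// -mulnb natrM mulrCA.
rewrite -mulr_sumr mulrC; case: (boolP (partial_pattern s L obs I)) => pp.
  by rewrite sum_compatible.
by rewrite !mulr0.
Qed.

Lemma expect_pattern n : (1 < n)%N -> (forall w, w \in L -> (I w < n)%N) ->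
  expect_tree mu alpha n (fun s => (pattern s L obs I)%:R) =
  \prod_(2 <= N < n) step_prob N.
Proof.
move=> n1 In; rewrite -expect_partial_pattern//; apply: eq_expect_tree => s sn ts _.
by rewrite partial_patternE// sn.
Qed.

End one_pattern.

End expectation.

(** * Riemann sums, monotone functions and their primitives *)

Section grid_limits.
Context {R : realType}.
Let leb : {measure set (measurableTypeR R) -> \bar R} := @lebesgue_measure R.

Let leb_itv (a b : R) : a < b -> leb `[a, b[%classic = (b - a)%:E.
Proof.
move=> ab; transitivity (lebesgue_measure (`[a, b[%classic : set R)); first by [].
by rewrite lebesgue_measure_itv/= lte_fin ab -EFinB.
Qed.

Let cell (n i : nat) : set R := [set y | i%:R <= n%:R * y < i.+1%:R].

Let cellE n i : (0 < n)%N -> cell n i = `[i%:R / n%:R, i.+1%:R / n%:R[%classic.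
Proof.
move=> n0; have n0' : 0 < n%:R :> R by rewrite ltr0n.
by apply/seteqP; split=> y /=; rewrite in_itv /= ler_pdivrMr// ltr_pdivlMr// mulrC.
Qed.

Let measure_cell n i : (0 < n)%N -> leb (cell n i) = (n%:R^-1)%:E.
Proof.
move=> n0; have n0' : 0 < n%:R :> R by rewrite ltr0n.
rewrite cellE// leb_itv ?ltr_pM2r ?invr_gt0// ?ltr_nat ?ltnSn//.
by rewrite -mulrBl -natrB// subSnn mul1r.
Qed.

Let step (psi : nat -> nat -> R) (n : nat) (y : R) : \bar R :=
  (\sum_(i < n) (`|psi n i| * \1_(cell n i) y)%:E)%E.

Let integral_step psi n : (0 < n)%N ->
  (\int[leb]_(y in `[0%R, 1%R[) step psi n y = (n%:R^-1 * \sum_(i < n) `|psi n i|)%:E)%E.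
Proof.
move=> n0; have n0' : 0 < n%:R :> R by rewrite ltr0n.
rewrite /step ge0_integral_sum//; last first.
  move=> i; apply/measurable_EFinP; apply: measurable_funM => //.
  by apply: measurable_indic; rewrite cellE.
rewrite mulr_sumr -sumEFin; apply: eq_bigr => i _.
under eq_integral do rewrite EFinM.
rewrite ge0_integralZl//; last first.
  by apply/measurable_EFinP; apply: measurable_indic; rewrite cellE.
rewrite integral_indic//; last by rewrite cellE.
have sub : cell n i `<=` `[0%R, 1%R[%classic.
  move=> y /=; rewrite in_itv /= => /andP[y0 y1]; apply/andP; split.
    by rewrite -(pmulr_rge0 _ n0'); apply: le_trans y0.
  rewrite -(ltr_pM2l n0') mulr1; apply: lt_le_trans y1 _.
  by rewrite ler_nat.
rewrite (setIidl sub); rewrite measure_cell//.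
by rewrite -EFinM mulrC.
Qed.

Let stepE psi n y : 0 <= y < 1 -> (0 < n)%N ->
  step psi n y = (`|psi n (Num.truncn (n%:R * y))|)%:E.
Proof.
move=> /andP[y0 y1] n0; have n0' : 0 < n%:R :> R by rewrite ltr0n.
have ny0 : 0 <= n%:R * y by rewrite mulr_ge0.
have tn : (Num.truncn (n%:R * y) < n)%N by rewrite truncn_lt_nat// gtr_pMr.
rewrite /step (bigD1 (Ordinal tn))//= big1 ?adde0.
  by rewrite indicE mem_set ?mulr1//; exact: truncn_itv.
move=> i; rewrite -val_eqE /= => it; rewrite indicE memNset ?mulr0//.
by move=> yi; move: it; rewrite -(truncn_def yi) eqxx.
Qed.

(** The average is an integral over [[0, 1[] of the step function with value
    [psi n (truncn (n * y))] at [y]. Pointwise convergence fails at most on a countable, hence null,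
    set and the bound is constant, so dominated convergence applies. It is run on absolute values;
    the signed sum is squeezed at the end. *)
Lemma riemann_sum_cvg0 (psi : nat -> nat -> R) (C : R) (D : set R) (N0 : nat) :
  countable D ->
  (forall n i, (N0 <= n)%N -> (i < n)%N -> `|psi n i| <= C) ->
  (forall y, 0 < y < 1 -> ~ D y -> psi n (Num.truncn (n%:R * y)) @[n --> \oo] --> 0) ->
  n%:R^-1 * (\sum_(i < n) psi n i) @[n --> \oo] --> 0.
Proof.
move=> cD bpsi cpsi.
(* Zeroed below [N0], where no bound is assumed, so that domination holds for all [n]. *)
pose psi' n i := if (N0 <= n)%N then psi n i else 0.
have mstep n : measurable_fun (`[0%R, 1%R[%classic : set R) (step psi' n).
  case: n => [|n].
    rewrite (_ : step psi' 0 = cst 0%E); first exact: measurable_cst.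
    by apply/funext => y; rewrite /step big_ord0.
  apply: emeasurable_sum => i; apply/measurable_EFinP; apply: measurable_funM => //.
  by apply: measurable_indic; rewrite cellE.
have D0 : countable (D `|` [set 0]) by rewrite -bigcup2E; apply: bigcup_countable => // i _; case: i => [|[|i]] //=; exact: finite_set_countable.
have C0 : 0 <= C.
  by have := bpsi N0.+1 0%N (leqnSn _) isT; apply: le_trans.
have step_cvg : {ae leb, forall y, `[0%R, 1%R[%classic y ->
    (fun n => step psi' n.+1 y) @ \oo --> 0%E}.
  exists (D `|` [set 0]); split.
  - by apply: countable_measurable.
  - exact: countable_lebesgue_measure0.
  move=> y; apply: contra_notP => /not_orP[yD y0] /=.
  rewrite in_itv /= => /andP[y0' y1].
  have y01 : 0 < y < 1 by rewrite y1 andbT lt_neqAle y0' andbT eq_sym; exact/eqP.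
  have := cpsi y y01 yD => /cvg_norm; rewrite normr0 => cy.
  apply/fine_cvgP; split; first by apply: nearW => n; rewrite stepE// y0' y1.
  rewrite -(cvg_shiftn 1%N) in cy; move: cy; apply: cvg_trans; apply: near_eq_cvg.
  near=> n; rewrite /= stepE ?y0' ?y1// /psi' ifT//= ?addn1//.
  by apply: leqW; near: n; exists N0.
have step_le : {ae leb, forall y n, `[0%R, 1%R[%classic y ->
    (`|step psi' n.+1 y| <= C%:E)%E}.
  apply: aeW => y n /=; rewrite in_itv /= => y01; rewrite stepE// abse_EFin normr_id lee_fin.
  rewrite /psi'; case: ifP => [Nn|_]; last by rewrite normr0.
  have /andP[y0 y1] := y01; apply: bpsi => //.
  by rewrite truncn_lt_nat ?gtr_pMr// mulr_ge0.
have iC : leb.-integrable `[0%R, 1%R[%classic (cst C%:E).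
  apply/integrableP; split; first exact: measurable_cst.
  rewrite integral_cst//; have := leb_itv ltr01; rewrite subr0 => ->.
  by rewrite mule1 ltry.
have [_ _ cvgI] := @dominated_convergence _ (measurableTypeR R) R leb _
   (measurable_itv _) (fun n => step psi' n.+1) (cst 0%E) (cst C%:E)
   (fun n => mstep n.+1) (measurable_cst _) step_cvg iC step_le.
suff : n%:R^-1 * (\sum_(i < n) `|psi' n i|) @[n --> \oo] --> 0.
  move=> H; apply: (@squeeze_cvgr _ _ _ _ (fun n => - (n%:R^-1 * (\sum_(i < n) `|psi' n i|)))
    (fun n => n%:R^-1 * (\sum_(i < n) `|psi' n i|)) _ _ 0).
  - near=> n; rewrite -ler_norml normrM ger0_norm ?invr_ge0//.
    rewrite ler_wpM2l ?invr_ge0// (le_trans (ler_norm_sum _ _ _))//.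
    apply: ler_sum => i _; rewrite /psi' ifT//.
    by near: n; exists N0.
  - by have := cvgN H; rewrite oppr0; exact.
  - exact: H.
rewrite -(cvg_shiftn 1%N) /=.
move: cvgI; rewrite integral_cst// mul0e => /fine_cvgP[_]; apply: cvg_trans.
apply: near_eq_cvg; apply: nearW => n /=.
by rewrite integral_step// addn1.
Unshelve. all: by end_near.
Qed.

(** The prefix holds the coordinates already fixed, which lets dominated convergence act on one
    coordinate at a time. *)
Fixpoint box_sum (n r : nat) (f : seq nat -> R) (pre : seq nat) : R :=
  if r is r'.+1 then \sum_(i < n) box_sum n r' f (rcons pre i) else f pre.

Definition grid (n : nat) (X : seq R) : seq nat :=
  [seq Num.truncn (n%:R * x) | x <- X].

Lemma box_sum_norm n r f pre (C : R) :
  (forall t, size t = r -> all (fun i => (i < n)%N) t -> `|f (pre ++ t)| <= C) ->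
  `|box_sum n r f pre| <= n%:R ^+ r * C.
Proof.
elim: r pre => [|r IH] pre fC /=.
  by rewrite expr0 mul1r; have := fC [::] erefl isT; rewrite cats0.
rewrite (le_trans (ler_norm_sum _ _ _))//.
apply: (@le_trans _ _ (\sum_(i < n) n%:R ^+ r * C)); last first.
  by rewrite sumr_const card_ord -[leLHS]mulr_natl exprS mulrA.
rewrite ler_sum// => i _; apply: IH.
by move=> t st tn; rewrite -cats1 -catA fC//= ?st ?ltn_ord.
Qed.

(* [G] describes the generic points: every coordinate avoids a countable set
   that may depend on the previous ones. *)
Lemma box_sum_cvg0 (G : seq R -> Prop) (phi : nat -> seq nat -> R) r X :
  (forall Y, G Y -> exists2 D : set R, countable D &
    forall y, 0 < y < 1 -> ~ D y -> G (rcons Y y)) ->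
  G X ->
  (forall Y, size Y = r -> G (X ++ Y) -> phi n (grid n (X ++ Y)) @[n --> \oo] --> 0) ->
  (exists C : R, exists N0 : nat, forall n t, (N0 <= n)%N -> size t = r ->
     all (fun i => (i < n)%N) t -> `|phi n (grid n X ++ t)| <= C) ->
  n%:R ^- r * box_sum n r (phi n) (grid n X) @[n --> \oo] --> 0.
Proof.
move=> HG; elim: r X => [|r IH] X GX cphi [C [N0 bphi]].
  have := cphi [::] erefl; rewrite cats0 => /(_ GX).
  apply: cvg_trans; apply: near_eq_cvg; apply: nearW => n /=.
  by rewrite expr0 invr1 mul1r.
have [D cD GD] := HG _ GX.
rewrite (_ : (fun n => _) = (fun n => n%:R^-1 * \sum_(i < n)
   (n%:R ^- r * box_sum n r (phi n) (rcons (grid n X) i)))); last first.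
  by apply/funext => n /=; rewrite -mulr_sumr mulrA -invfM -exprS.
apply: (@riemann_sum_cvg0 (fun n i => n%:R ^- r *
  box_sum n r (phi n) (rcons (grid n X) i)) C D N0.+1) => //.
- move=> n i Nn ni; rewrite normrM ger0_norm ?invr_ge0 ?exprn_ge0//.
  have n0 : 0 < n%:R :> R by rewrite ltr0n; lia.
  rewrite ler_pdivrMl ?exprn_gt0// box_sum_norm// => t st tn.
  by rewrite -cats1 -catA bphi//= ?st ?ni//; exact: ltnW.
- move=> y y01 yD; have {}IH := IH (rcons X y) (GD _ y01 yD).
  have gE n : grid n (rcons X y) = rcons (grid n X) (Num.truncn (n%:R * y)).
    by rewrite /grid map_rcons.
  under eq_fun do rewrite -gE; apply: IH => [Y sY|].
    by rewrite cat_rcons => GY; apply: cphi => //=; rewrite sY.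
  exists C, N0.+1 => n t Nn st tn; rewrite gE cat_rcons bphi//=; first exact: ltnW.
    by rewrite st.
  have /andP[y0 y1] := y01; rewrite tn andbT truncn_lt_nat ?mulr_ge0// ?(ltW y0)//.
  by rewrite gtr_pMr// ltr0n; lia.
Qed.

End grid_limits.

(** * Jumps and primitives of monotone functions *)

Section monotone.
Context {R : realType}.

(** A monotone function has one-sided limits everywhere, and they differ at countably many points
    only, counted on each bounded interval; elsewhere the oscillation around [z] becomes arbitrarily
    small. *)
Lemma nondecreasing_small_jumps (h : R -> R) : {homo h : x y / x <= y} ->
  exists2 D : set R, countable D & forall z, ~ D z ->
    forall e, 0 < e -> exists2 d, 0 < d & h (z + d) - h (z - d) <= e.
Proof.
move=> hnd.
exists (\bigcup_(n : nat) [set x | x \in (`](- n%:R), n%:R[) /\ discontinuity h x]).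
  apply: bigcup_countable => // n _; apply: discontinuity_countable.
  by move=> x y _ _; exact: hnd.
move=> z nz e e0.
have cl : cvg (h x @[x --> z^'-]).
  apply: nondecreasing_at_left_is_cvgr; near=> x; first by move=> a b _ _; exact: hnd.
  exists (h z) => _ [y + <-]; rewrite /= in_itv /= => /andP[_ /ltW]; exact: hnd.
have cr : cvg (h x @[x --> z^'+]).
  apply: nondecreasing_at_right_is_cvgr; near=> x; first by move=> a b _ _; exact: hnd.
  exists (h z) => _ [y + <-]; rewrite /= in_itv /= => /andP[/ltW + _]; exact: hnd.
have e20 : 0 < e / 2 by rewrite divr_gt0.
have lr : lim (h x @[x --> z^'-]) = lim (h x @[x --> z^'+]).
  apply: contra_notP nz => /eqP lr; exists (Num.truncn `|z|).+1 => //; split=> //=.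
  by rewrite in_itv /= -ltr_norml truncnS_gt.
have := cl => /cvgrPdist_lt/(_ _ e20) [d1 /= d10 h1].
have := cr => /cvgrPdist_lt/(_ _ e20) [d2 /= d20 h2].
pose d := Num.min d1 d2 / 2.
have d0 : 0 < d by rewrite divr_gt0// lt_min d10 d20.
have m1 : Num.min d1 d2 <= d1 by rewrite ge_min lexx.
have m2 : Num.min d1 d2 <= d2 by rewrite ge_min lexx orbT.
have dd1 : d < d1 by move: d0; rewrite /d; lra.
have dd2 : d < d2 by move: d0; rewrite /d; lra.
exists d => //.
have {}h1 := h1 (z - d); have {}h2 := h2 (z + d).
have : `|lim (h x @[x --> z^'-]) - h (z - d)| < e / 2.
  by apply: h1; [rewrite /ball/= opprB addrC subrK gtr0_norm|rewrite gtrBl].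
have : `|lim (h x @[x --> z^'+]) - h (z + d)| < e / 2.
  by apply: h2; [rewrite /ball/= opprD addrA subrr add0r normrN gtr0_norm|rewrite ltrDl].
rewrite lr !ltr_norml => /andP[a1 a2] /andP[b1 b2].
lra.
Unshelve. all: by end_near.
Qed.

(** The two-sided estimate satisfied by an integral of a nondecreasing [g]; it stands in for
    differentiability, which may fail at the jumps of [g]. *)
Definition primitive_of (g F : R -> R) := forall s t : R, 0 <= s -> s <= t ->
  g s * (t - s) <= F t - F s <= g t * (t - s).

(** Cut [[0, s]] into [N] equal pieces. On each piece both increments lie between the same lower and
    upper Riemann terms, and these gaps telescope to [(g s - g 0) * s / N], which vanishes as [N]
    grows. *)
Lemma primitive_of_unique (g F F' : R -> R) : primitive_of g F -> primitive_of g F' ->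
  forall s, 0 <= s -> F s - F 0 = F' s - F' 0.
Proof.
move=> pF pF' s s0.
have key (N : nat) : (0 < N)%N ->
    `|(F s - F 0) - (F' s - F' 0)| <= (g s - g 0) * s / N%:R.
  move=> N0; have N0' : 0 < N%:R :> R by rewrite ltr0n.
  pose x (i : nat) : R := s * i%:R / N%:R.
  have xS i : x i.+1 - x i = s / N%:R.
    by rewrite /x -natr1; field; exact: lt0r_neq0.
  have x0 i : 0 <= x i by rewrite /x divr_ge0// mulr_ge0.
  have xle i : x i <= x i.+1 by rewrite -subr_ge0 xS divr_ge0.
  suff H (i : nat) : `|(F (x i) - F 0) - (F' (x i) - F' 0)| <= (g (x i) - g 0) * (s / N%:R).
    have := H N; rewrite (_ : x N = s) ?mulrA//.
    by rewrite /x mulfK//; exact: lt0r_neq0.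
  elim: i => [|i IH].
    by rewrite /x mulr0 mul0r !subrr normr0 mul0r.
  have := pF _ _ (x0 i) (xle i); have := pF' _ _ (x0 i) (xle i); rewrite xS.
  move: IH; rewrite !ler_norml => /andP[a1 a2] /andP[b1 b2] /andP[c1 c2].
  by apply/andP; split; nra.
apply/eqP; rewrite -subr_eq0 -normr_eq0 -[_ == 0]negbK; apply/negP => n0.
have a0 : 0 < `|(F s - F 0) - (F' s - F' 0)| by rewrite lt_neqAle eq_sym n0 normr_ge0.
set a := `|_| in key a0.
set b := (g s - g 0) * s in key.
have := key (Num.truncn (b / a)).+1 isT; rewrite ler_pdivlMr ?ltr0n//.
by rewrite mulrC -ler_pdivlMr// leNgt truncnS_gt.
Qed.

End monotone.

(** * Elementary estimates on products and exponentials *)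

Section products.
Context {R : realType}.

Lemma prod_dist (T : eqType) (r : seq T) (a b : T -> R) :
  (forall i, i \in r -> 0 <= a i <= 1) -> (forall i, i \in r -> 0 <= b i <= 1) ->
  `|\prod_(i <- r) a i - \prod_(i <- r) b i| <= \sum_(i <- r) `|a i - b i|.
Proof.
elim: r => [|x r IH] a01 b01; first by rewrite !big_nil subrr normr0.
have [/andP[a0 a1] /andP[b0 b1]] := (a01 x (mem_head _ _), b01 x (mem_head _ _)).
have ar i : i \in r -> 0 <= a i <= 1 by move=> ir; rewrite a01// inE ir orbT.
have br i : i \in r -> 0 <= b i <= 1 by move=> ir; rewrite b01// inE ir orbT.
rewrite !big_cons.
set A := \prod_(i <- r) a i; set B := \prod_(i <- r) b i.
have B1 : `|B| <= 1.
  rewrite /B normr_prod big_seq; apply: prodr_ile1 => i ir.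
  by have /andP[b0' b1'] := br _ ir; rewrite ger0_norm// b0'.
have -> : a x * A - b x * B = a x * (A - B) + (a x - b x) * B by ring.
rewrite (le_trans (ler_normD _ _))// addrC lerD// normrM.
  by rewrite ler_piMr.
by rewrite ger0_norm// (le_trans _ (IH ar br))// ler_piMl.
Qed.

Lemma expR_quadratic (x : R) : 0 <= x -> `|1 - x - expR (- x)| <= x ^+ 2.
Proof.
move=> x0; have h1 := expR_ge1Dx (- x); have h2 := expR_ge1Dx x.
have e0 := expR_gt0 (- x); have ee : expR (- x) * expR x = 1 by rewrite -expRD addNr expR0.
rewrite ler_norml; apply/andP; split; last by nra.
have : expR (- x) * (1 + x) <= 1 by rewrite -[leRHS]ee ler_wpM2l// ltW.
by rewrite expr2; nra.
Qed.

End products.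

(** * From delays to the hazard rate *)

Section delay_hazard.
Context {R : realType}.
Variables (mu : probability R R) (alpha : R).
Hypothesis alpha0 : 0 <= alpha.
Hypothesis mu01 : mu [set x : R | (0 <= x)%R /\ (x <= 1)%R] = 1%E.

(** As a condition on the delay, [eta <= x] is a half-line. It contains all sufficiently negative
    delays, which are discarded in [hfun_delay_sum] as a null set. *)
Lemma hsetE (x : R) : hset x = `]-oo, 1 - expR (- x)]%classic.
Proof.
apply/seteqP; split=> t /=; rewrite in_itv /=.
  move=> [t1 tx]; rewrite lerBrDr -lerBrDl -ler_ln ?posrE ?subr_gt0 ?expR_gt0//.
  by rewrite expRK; lra.
rewrite lerBrDr -lerBrDl => tx; have t1 : t < 1 by have := expR_gt0 (- x); lra.
split=> //; move: tx; rewrite -ler_ln ?posrE ?subr_gt0 ?expR_gt0//.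
by rewrite expRK; lra.
Qed.

Lemma measurable_hset (x : R) : measurable (hset x).
Proof. by rewrite hsetE. Qed.

Let f (t : R) : \bar R := (expR (- ln (1 - t)))%:E.

Let fE t : t < 1 -> f t = ((1 - t)^-1)%:E.
Proof. by move=> t1; rewrite /f expRN lnK// posrE subr_gt0. Qed.

Let f_ge0 t : (0 <= f t)%E.
Proof. by rewrite lee_fin expR_ge0. Qed.

Let mf (D : set R) : measurable_fun D f.
Proof.
apply/measurable_EFinP; apply: measurableT_comp => //.
apply: measurableT_comp => //; apply: (measurableT_comp (@measurable_ln R)).
by apply: measurable_funB.
Qed.

Let int_fin (x : R) : (\int[mu]_(t in hset x) f t)%E \is a fin_num.
Proof.
rewrite ge0_fin_numE ?integral_ge0//.
have : (\int[mu]_(t in hset x) f t <= \int[mu]_(t in hset x) (expR x)%:E)%E.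
  apply: ge0_le_integral => //; first exact: measurable_hset.
  by move=> t [t1 tx]; rewrite lee_fin ler_expR.
move=> /le_lt_trans; apply; rewrite integral_cst; last exact: measurable_hset.
rewrite lte_mul_pinfty ?lee_fin ?expR_ge0//.
by rewrite (le_lt_trans (probability_le1 _ (measurable_hset x)))// ltry.
Qed.

Lemma hfun_ge0 x : 0 <= hfun mu alpha x.
Proof.
by rewrite mulr_ge0 ?invr_ge0 ?addr_ge0// fine_ge0// integral_ge0.
Qed.

Lemma hfun_nondecreasing : {homo hfun mu alpha : x y / x <= y}.
Proof.
move=> x y xy; rewrite ler_wpM2l ?invr_ge0 ?addr_ge0// fine_le ?int_fin//.
apply: ge0_subset_integral => //; try exact: measurable_hset.
by move=> t [t1 tx]; split=> //; exact: le_trans xy.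
Qed.

Let neg := [set t : R | t < 0].

Let mneg : measurable neg.
Proof.
by rewrite (_ : neg = `]-oo, 0%R[%classic)//.
Qed.

Let mu_neg : mu neg = 0%E.
Proof.
have m01 : measurable [set x : R | (0 <= x)%R /\ (x <= 1)%R].
  rewrite (_ : [set x : R | _] = `[0%R, 1%R]%classic); first exact: measurable_itv.
  by apply/seteqP; split=> x /=; rewrite in_itv /= => /andP.
have := probability_setC mu m01; rewrite mu01 subee// => mC.
apply/eqP; rewrite -measure_le0 -mC le_measure ?inE//; first exact: measurableC.
by move=> t /= t0 [t0' _]; move: t0; rewrite /neg/= ltNge t0'.
Qed.

(** The condition [eta <= ln (N / i.+1)] means [N (1 - t) >= i + 1]; so, up to the null set of
    negative delays, the domain of integration is the union of the delay sets with delayed size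
    [m > i]. *)
Lemma hfun_delay_sum (N i : nat) : (0 < N)%N ->
  (2 + alpha) * hfun mu alpha (ln (N%:R / i.+1%:R)) =
  \sum_(i.+1 <= m < N.+1) fine (\int[mu]_(t in delay_set N m) f t)%E.
Proof.
move=> N0; have N0' : 0 < N%:R :> R by rewrite ltr0n.
set z := ln _; have expz : expR (- z) = i.+1%:R / N%:R.
  by rewrite /z expRN lnK ?invf_div// posrE divr_gt0.
rewrite /hfun mulrA mulfV ?mul1r; last by apply: lt0r_neq0; rewrite ltr_pwDl.
pose U : set R := \big[setU/set0]_(m <- index_iota i.+1 N.+1) delay_set N m.
have mU : measurable U by apply: bigsetU_measurable => m _; exact: measurable_delay_set.
have UP t : U t <-> i.+1%:R <= N%:R - N%:R * t < N.+1%:R.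
  rewrite /U -bigcup_seq; split=> [[m /=]|/andP[ti tN]].
    rewrite mem_index_iota => /andP[im mN] /andP[mt tm]; apply/andP; split.
      by apply: le_trans mt; rewrite ler_nat.
    by apply: lt_le_trans tm _; rewrite ler_nat.
  have t0 : 0 <= N%:R - N%:R * t by apply: le_trans ti.
  exists (Num.truncn (N%:R - N%:R * t)); last exact: truncn_itv.
  by rewrite /= mem_index_iota truncn_ge_nat// ti truncn_lt_nat.
have hU : hset z `\` neg = U `\` neg.
  rewrite hsetE expz; apply/seteqP; split=> t /= []; rewrite in_itv /= => h tn;
    (split; last exact: tn); have t0 : 0 <= t by rewrite leNgt; apply/negP.
    apply/UP; apply/andP; split.
      by move: h; rewrite lerBrDr -lerBrDl ler_pdivrMr// mulrBl mul1r mulrC.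
    by rewrite -natr1; have := mulr_ge0 (ltW N0') t0; lra.
  move: h => /UP/andP[h _].
  by rewrite lerBrDr -lerBrDl ler_pdivrMr// mulrBl mul1r mulrC.
have -> : (\int[mu]_(t in hset z) f t = \int[mu]_(t in U) f t)%E.
  rewrite (@ge0_negligible_integral _ _ _ _ _ neg)//; last exact: measurable_hset.
  by rewrite hU -(@ge0_negligible_integral _ _ _ _ _ neg).
rewrite ge0_integral_bigsetU//=.
- rewrite big_seq [RHS]big_seq -EFin_sum_fine// => m; rewrite mem_index_iota => /andP[im mN].
  rewrite ge0_fin_numE ?integral_ge0//.
  have : (\int[mu]_(t in delay_set N m) f t <= \int[mu]_(t in U) f t)%E.
    apply: ge0_subset_integral => //; first exact: measurable_delay_set.
    move=> t /= /andP[mt tm]; apply/UP; apply/andP; split.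
      by apply: le_trans mt; rewrite ler_nat.
    by apply: lt_le_trans tm _; rewrite ler_nat.
  move=> /le_lt_trans; apply.
  rewrite (@ge0_negligible_integral _ _ _ _ _ neg)// -hU.
  rewrite -(@ge0_negligible_integral _ _ _ _ _ neg)//; last exact: measurable_hset.
  by have := int_fin z; rewrite ge0_fin_numE ?integral_ge0.
- by move=> m; exact: measurable_delay_set.
- exact: iota_uniq.
- exact: sub_trivIset (@trivIset_delay_set _ N).
Qed.

(** On [delay_set N m] one has [m <= N (1 - t) < m + 1], and the integrand is [1 / (1 - t)]. *)
Lemma delay_set_integral (N m : nat) : (0 < m)%N -> (0 < N)%N ->
  N%:R / m.+1%:R * delay_prob mu N m <= fine (\int[mu]_(t in delay_set N m) f t)%E
  <= N%:R / m%:R * delay_prob mu N m.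
Proof.
move=> m0 N0; have N0' : 0 < N%:R :> R by rewrite ltr0n.
have m0' : 0 < m%:R :> R by rewrite ltr0n.
have mD := measurable_delay_set (R := R) N m.
have t1 (t : R) : delay_set N m t -> t < 1.
  move=> /= /andP[mt _]; rewrite -subr_gt0 -(pmulr_rgt0 _ N0') mulrBr mulr1.
  exact: lt_le_trans mt.
have fmu : mu (delay_set N m) \is a fin_num by exact: fin_num_measure.
have up : (\int[mu]_(t in delay_set N m) f t <=
    (N%:R / m%:R * fine (mu (delay_set N m)))%:E)%E.
  rewrite EFinM fineK// -integral_cst//; apply: ge0_le_integral => //.
  move=> t Dt; have tt := t1 _ Dt; rewrite fE// lee_fin.
  have /andP[mt _] := Dt.
  have t0 : 0 < 1 - t by rewrite subr_gt0.
  rewrite ler_pdivlMr// mulrC ler_pdivrMr//.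
  by rewrite mulrBr mulr1.
have lo : ((N%:R / m.+1%:R * fine (mu (delay_set N m)))%:E <=
    \int[mu]_(t in delay_set N m) f t)%E.
  rewrite EFinM fineK// -integral_cst//; apply: ge0_le_integral => //.
    by move=> t _; rewrite lee_fin divr_ge0.
  move=> t Dt; have tt := t1 _ Dt; rewrite fE// lee_fin.
  have /andP[_ mt] := Dt.
  have t0 : 0 < 1 - t by rewrite subr_gt0.
  rewrite ler_pdivrMr// mulrC ler_pdivlMr//.
  by rewrite mulrBr mulr1 ltW.
have fi : (\int[mu]_(t in delay_set N m) f t)%E \is a fin_num.
  by rewrite ge0_fin_numE ?integral_ge0//; apply: le_lt_trans up _; rewrite ltry.
by rewrite delay_probE -!lee_fin fineK// up lo.
Qed.

Lemma unit_rateE (N i : nat) : (i <= N)%N -> unit_rate mu alpha N i =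
  \sum_(i.+1 <= m < N.+1) delay_prob mu N m * ((2 * m.-1)%:R + alpha * m%:R)^-1.
Proof.
move=> iN; rewrite /unit_rate (big_cat_nat (n := i.+1))//= big_nat big1 ?add0r.
  by apply: eq_big_nat => m /andP[im _]; rewrite im.
by move=> m /andP[_ mi]; rewrite ltnNge -ltnS mi mulr0.
Qed.

(** Termwise, from [2 (m - 1) + alpha m <= (2 + alpha) m] and the upper half of
    [delay_set_integral]. *)
Lemma unit_rate_lower (N i : nat) : (0 < i < N)%N ->
  hfun mu alpha (ln (N%:R / i.+1%:R)) <= N%:R * unit_rate mu alpha N i.
Proof.
move=> /andP[i0 iN]; have N0 : (0 < N)%N by lia.
have a2 : 0 < 2 + alpha by rewrite ltr_pwDl.
rewrite -(ler_pM2l a2) hfun_delay_sum// unit_rateE ?(ltnW iN)// !mulr_sumr.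
rewrite ler_sum_nat// => m /andP[im mN].
have m0 : (0 < m)%N by lia.
have /andP[_] := delay_set_integral m0 N0; move=> /le_trans; apply.
have d0 := delay_prob_ge0 mu N m; set D := delay_prob _ _ _ in d0 *.
have m1 : (1 < m)%N by lia.
have tE : (2 * m.-1)%:R = 2 * m%:R - 2 :> R.
  by rewrite natrM -subn1 natrB// mulrBr mulr1.
have m1' : 1 < m%:R :> R by rewrite ltr1n.
have am : 0 <= alpha * m%:R by rewrite mulr_ge0.
have T0 : 0 < 2 * m%:R - 2 + alpha * m%:R by lra.
rewrite tE.
rewrite [leRHS](_ : _ = N%:R * D * ((2 + alpha) / (2 * m%:R - 2 + alpha * m%:R))); last by ring.
rewrite [leLHS](_ : _ = N%:R * D * (m%:R^-1)); last by ring.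
rewrite ler_wpM2l ?mulr_ge0// -[leLHS]mul1r ler_pdivlMr// mulrAC ler_pdivrMr; last by lra.
by rewrite mul1r; lra.
Qed.

(** The factor absorbs [(2 + alpha) (m + 1) / (2 (m - 1) + alpha m)], which is at most
    [(m + 1) / (m - 1)]; the latter decreases in [m] and equals [i.+2 / i] at the first index
    [m = i + 1]. *)
Lemma unit_rate_upper (N i : nat) : (0 < i < N)%N ->
  N%:R * unit_rate mu alpha N i <=
  i.+2%:R / i%:R * hfun mu alpha (ln (N%:R / i.+1%:R)).
Proof.
move=> /andP[i0 iN]; have N0 : (0 < N)%N by lia.
have a2 : 0 < 2 + alpha by rewrite ltr_pwDl.
rewrite -(ler_pM2l a2) [leRHS]mulrCA hfun_delay_sum// unit_rateE ?(ltnW iN)// !mulr_sumr.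
rewrite ler_sum_nat// => m /andP[im mN].
have m0 : (0 < m)%N by lia.
have i0' : 0 < i%:R :> R by rewrite ltr0n.
have /andP[+ _] := delay_set_integral m0 N0.
have ii : 0 <= i.+2%:R / i%:R :> R by rewrite divr_ge0.
move=> /(ler_wpM2l ii) /(le_trans _); apply.
have d0 := delay_prob_ge0 mu N m; set D := delay_prob _ _ _ in d0 *.
have m1 : (1 < m)%N by lia.
have tE : (2 * m.-1)%:R = 2 * m%:R - 2 :> R.
  by rewrite natrM -subn1 natrB// mulrBr mulr1.
have m1' : 1 < m%:R :> R by rewrite ltr1n.
have im' : i%:R + 1 <= m%:R :> R by rewrite natr1 ler_nat.
have am : 0 <= alpha * m%:R by rewrite mulr_ge0.
have T0 : 0 < 2 * m%:R - 2 + alpha * m%:R by lra.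
rewrite tE -natr1 -[in i.+2]addn2 natrD.
rewrite [leLHS](_ : _ = N%:R * D * ((2 + alpha) / (2 * m%:R - 2 + alpha * m%:R))); last by ring.
rewrite [leRHS](_ : _ = N%:R * D * ((i%:R + 2) / (i%:R * (m%:R + 1)))); last first.
  by field; rewrite lt0r_neq0//= lt0r_neq0//; lra.
rewrite ler_wpM2l ?mulr_ge0// ler_pdivrMr// mulrAC ler_pdivlMr; last first.
  by rewrite mulr_gt0//; lra.
nra.
Qed.

Lemma primitive_ofS (g F : R -> R) (c : R) : 0 <= c -> primitive_of g F ->
  primitive_of (fun x => g (x + c)) (fun x => F (x + c)).
Proof.
move=> c0 pF s t s0 st; have := pF (s + c) (t + c).
by rewrite addr_ge0// lerD2r => /(_ isT st); rewrite opprD addrACA subrr addr0.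
Qed.

Lemma primitive_ofZ (g F : R -> R) (c : R) : 0 <= c -> primitive_of g F ->
  primitive_of (fun x => c * g x) (fun x => c * F x).
Proof.
move=> c0 pF s t s0 st; have /andP[h1 h2] := pF s t s0 st.
by rewrite -mulrBr -!mulrA !ler_wpM2l.
Qed.

Lemma primitive_of_sum (J : Type) (r : seq J) (g F : J -> R -> R) :
  (forall j, primitive_of (g j) (F j)) ->
  primitive_of (fun x => \sum_(j <- r) g j x) (fun x => \sum_(j <- r) F j x).
Proof.
move=> pF s t s0 st; rewrite -sumrB !mulr_suml.
by apply/andP; split; apply: ler_sum => j _; have /andP[] := pF j s t s0 st.
Qed.

Definition cumulative (g : R -> R) (s : R) : R :=
  fine (\int[lebesgue_measure]_(x in interval0 s) (g x)%:E)%E.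

Lemma interval0E (s : R) : interval0 s = `[0, s]%classic.
Proof. by apply/seteqP; split=> x /=; rewrite in_itv /= => /andP. Qed.

Lemma cumulative_primitive (g : R -> R) : {homo g : x y / x <= y} ->
  (forall x, 0 <= x -> 0 <= g x) -> primitive_of g (cumulative g).
Proof.
move=> gnd g0 s t s0 st.
have mg (D : set R) : measurable D -> measurable_fun D (EFin \o g).
  by move=> mD; apply/measurable_EFinP; exact: nondecreasing_measurable.
have leb_itv (a b : R) (ab : bool) : a <= b ->
    @lebesgue_measure R [set` Interval (BSide ab a) (BRight b)] = (b - a)%:E.
  move=> leab; rewrite lebesgue_measure_itv/= lte_fin; case: ltP => [ab'|ba].
    by rewrite -EFinB.
  by rewrite (_ : b = a) ?subrr//; apply/eqP; rewrite eq_le leab andbT.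
(* The flag selects closed or left-open intervals, so that [[0, t]] splits disjointly into [[0, s]]
   and []s, t]]. *)
pose J (ab : bool) (a b : R) : \bar R :=
  (\int[lebesgue_measure]_(x in [set` Interval (BSide ab a) (BRight b)]) (g x)%:E)%E.
have J_ge ab a b : 0 <= a -> a <= b -> ((g a * (b - a))%:E <= J ab a b)%E.
  move=> a0 leab; rewrite EFinM -(leb_itv a b ab leab) -integral_cst//.
  apply: ge0_le_integral => //.
  - by move=> x _; rewrite lee_fin g0.
  - exact: mg.
  - by case: ab => x; rewrite /= in_itv /= => /andP[ax _]; rewrite lee_fin gnd//; exact: ltW.
have J_le ab a b : 0 <= a -> a <= b -> (J ab a b <= (g b * (b - a))%:E)%E.
  move=> a0 leab; rewrite EFinM -(leb_itv a b ab leab) -integral_cst//.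
  apply: ge0_le_integral => //.
  - by case: ab => x; rewrite /= in_itv /= => /andP[ax _]; rewrite lee_fin g0//;
      apply: le_trans a0 _ => //; exact: ltW.
  - exact: mg.
  - by case: ab => x; rewrite /= in_itv /= => /andP[_ xb]; rewrite lee_fin gnd.
have J_fin ab a b : 0 <= a -> a <= b -> J ab a b \is a fin_num.
  move=> a0 leab; rewrite ge0_fin_numE; first exact: le_lt_trans (J_le ab _ _ a0 leab) (ltry _).
  apply: le_trans (J_ge ab _ _ a0 leab).
  by rewrite lee_fin mulr_ge0 ?g0// subr_ge0.
have JU : J true 0 t = (J true 0%R s + J false s t)%E.
  rewrite /J -ge0_integral_setU//.
  - congr (integral _ _ _); apply/seteqP; split=> x /=; rewrite !in_itv /=.
      by move=> /andP[x0 xt]; case: (leP x s) => xs; [left; rewrite x0|right].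
    by move=> [/andP[x0 xs]|/andP[xs xt]]; rewrite ?x0 ?xt ?andbT//=;
      [exact: le_trans st|exact: le_trans s0 (ltW xs)].
  - by apply: mg; exact: measurableU.
  - move=> x /= [|]; rewrite in_itv /= => /andP[x0 _]; rewrite lee_fin g0//.
    exact: le_trans s0 (ltW x0).
  - rewrite disj_set2E; apply/eqP/seteqP; split=> x //= [].
    by rewrite !in_itv /= => /andP[_ xs] /andP[+ _]; rewrite ltNge xs.
have cE u : cumulative g u = fine (J true 0 u) by rewrite /cumulative interval0E.
rewrite !cE JU fineD ?J_fin// addrAC subrr add0r.
by rewrite -!lee_fin fineK ?J_fin// J_ge// J_le.
Qed.

Lemma cumulative0 (g : R -> R) : cumulative g 0 = 0.
Proof.
by rewrite /cumulative interval0E set_itv1 integral_set1.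
Qed.

End delay_hazard.

(** * Integer positions proportional to n *)

Section scaling.
Context {R : realType}.

Lemma cvg_eqr (f : nat -> R) (a b : R) : a = b -> f n @[n --> \oo] --> a ->
  f n @[n --> \oo] --> b.
Proof. by move=> <-. Qed.

Lemma near_eq_cvgr (f g : nat -> R) (a : R) : (\forall n \near \oo, f n = g n) ->
  f n @[n --> \oo] --> a -> g n @[n --> \oo] --> a.
Proof. by move=> fg; apply: cvg_trans; exact: near_eq_cvg. Qed.

Lemma ln_le_sub1 (x : R) : 0 < x -> ln x <= x - 1.
Proof. by move=> x0; have := expR_ge1Dx (ln x); rewrite lnK ?posrE//; lra. Qed.

Lemma ln_ge_sub1V (x : R) : 0 < x -> 1 - x^-1 <= ln x.
Proof.
move=> x0; have := @ln_le_sub1 (x^-1); rewrite invr_gt0 => /(_ x0).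
by rewrite lnV ?posrE//; lra.
Qed.

Lemma ln_ratioD (a b c : R) : 0 < a -> 0 < b -> 0 < c ->
  ln (c / b) + ln (b / a) = ln (c / a).
Proof.
move=> a0 b0 c0; rewrite -lnM ?posrE ?divr_gt0//; congr ln.
by field; rewrite !lt0r_neq0.
Qed.

Lemma ln_ratio_ge0 (a b : nat) : (a <= b)%N -> 0 <= ln (b%:R / a%:R : R).
Proof.
case: a => [|a] ab; first by rewrite invr0 mulr0 ln0.
by rewrite ln_ge0// ler_pdivlMr ?ltr0n// mul1r ler_nat.
Qed.

Definition scales (p : nat -> nat) (x : R) := (p n)%:R / n%:R @[n --> \oo] --> x.

Lemma cvg_invn : (n%:R : R)^-1 @[n --> \oo] --> 0.
Proof.
rewrite -(cvg_shiftn 1%N) /=.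
by under eq_fun do rewrite addn1; exact: cvg_harmonic.
Qed.

Lemma scales_floor (x : R) : 0 <= x -> scales (fun n => Num.truncn (n%:R * x)) x.
Proof.
move=> x0; apply: (@squeeze_cvgr _ _ _ _ (fun n : nat => x - n%:R^-1) (cst x)).
- near=> n; have n0 : 0 < n%:R :> R by rewrite ltr0n; near: n; exists 1%N.
  have /andP[t1 t2] := truncn_itv (mulr_ge0 (ltW n0) x0).
  rewrite ler_pdivrMr// ler_pdivlMr// mulrBl mulVf ?lt0r_neq0// mulrC.
  by rewrite t1 andbT lerBlDr natr1 ltW.
- by apply: (cvg_eqr (subr0 _)); apply: cvgB; [exact: cvg_cst|exact: cvg_invn].
- exact: cvg_cst.
Unshelve. all: by end_near.
Qed.

Lemma scalesS p x : scales p x -> scales (fun n => (p n).+1) x.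
Proof.
move=> px; rewrite /scales; under eq_fun do rewrite -natr1 mulrDl mul1r.
by apply: (cvg_eqr (addr0 x)); apply: cvgD => //; exact: cvg_invn.
Qed.

Lemma scales_n : scales id 1.
Proof.
apply: (@near_eq_cvgr (fun=> 1)); last exact: cvg_cst.
near=> n; rewrite divff// pnatr_eq0 -lt0n; near: n; exists 1%N.
Unshelve. all: by end_near.
Qed.

Lemma scales_pred : scales predn 1.
Proof.
have h : 1 - n%:R^-1 @[n --> \oo] --> (1 : R).
  by apply: (cvg_eqr (subr0 _)); apply: cvgB; [exact: cvg_cst|exact: cvg_invn].
apply: near_eq_cvgr h; near=> n.
have n0 : (0 < n)%N by near: n; exists 1%N.
rewrite -subn1 natrB//= mulrBl divff ?mul1r//.
by rewrite pnatr_eq0 -lt0n.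
Unshelve. all: by end_near.
Qed.

Lemma scales_gt p x (c : R) : scales p x -> c < x ->
  \forall n \near \oo, c * n%:R < (p n)%:R.
Proof.
move=> px cx; near=> n.
have n0 : 0 < n%:R :> R by rewrite ltr0n; near: n; exists 1%N.
rewrite -ltr_pdivlMr//; near: n.
by apply: (cvgr_gt x).
Unshelve. all: by end_near.
Qed.

Lemma scales_lt p x (c : R) : scales p x -> x < c ->
  \forall n \near \oo, (p n)%:R < c * n%:R.
Proof.
move=> px cx; near=> n.
have n0 : 0 < n%:R :> R by rewrite ltr0n; near: n; exists 1%N.
rewrite -ltr_pdivrMr//; near: n.
by apply: (cvgr_lt x).
Unshelve. all: by end_near.
Qed.

Lemma scales_ge p x (m : nat) : scales p x -> 0 < x ->
  \forall n \near \oo, (m <= p n)%N.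
Proof.
move=> px x0; near=> n; rewrite -(ler_nat R); apply: ltW.
apply: (@le_lt_trans _ _ (x / 2 * n%:R)); last first.
  by near: n; apply: (scales_gt px); rewrite ltr_pdivrMr//; lra.
rewrite -ler_pdivrMl ?divr_gt0//; near: n.
exists (Num.truncn ((x / 2)^-1 * m%:R)).+1 => // n /= nm.
by apply: le_trans (ltW (truncnS_gt _)) _; rewrite ler_nat.
Unshelve. all: by end_near.
Qed.

Lemma scales_ltn p q x y : scales p x -> scales q y -> x < y ->
  \forall n \near \oo, (p n < q n)%N.
Proof.
move=> px qy xy; near=> n; rewrite -(ltr_nat R).
apply: (@lt_trans _ _ ((x + y) / 2 * n%:R)); near: n.
- by apply: (scales_lt px); lra.
- by apply: (scales_gt qy); lra.
Unshelve. all: by end_near.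
Qed.

Lemma scales_ratio p q x y : scales p x -> scales q y -> 0 < x ->
  (q n)%:R / (p n)%:R @[n --> \oo] --> y / x.
Proof.
move=> px qy x0.
have h : (q n)%:R / n%:R * ((p n)%:R / n%:R)^-1 @[n --> \oo] --> y / x.
  by apply: cvgM => //; apply: cvgV => //; exact: lt0r_neq0.
apply: near_eq_cvgr h; near=> n.
have n0 : n%:R != 0 :> R by rewrite pnatr_eq0 -lt0n; near: n; exists 1%N.
have p0 : (p n)%:R != 0 :> R.
  by rewrite pnatr_eq0 -lt0n; near: n; exact: (scales_ge 1 px).
by rewrite /=; field; apply/andP.
Unshelve. all: by end_near.
Qed.

Lemma scales_ln p q x y : scales p x -> scales q y -> 0 < x -> 0 < y ->
  ln ((q n)%:R / (p n)%:R) @[n --> \oo] --> ln (y / x).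
Proof.
move=> px qy x0 y0; apply: continuous_cvg; last exact: scales_ratio.
by apply: continuous_ln; rewrite divr_gt0.
Qed.

Lemma scales_inv p x : scales p x -> 0 < x -> n%:R / (p n)%:R @[n --> \oo] --> x^-1.
Proof.
by move=> px x0; rewrite -[X in _ --> X]mul1r; apply: scales_ratio px scales_n x0.
Qed.

(** The error [1 - w - expR (- w)] is at most [w ^+ 2] in absolute value, and
    [n * w ^+ 2 = (n * w) ^+ 2 / n] tends to zero because [n * w] converges. *)
Lemma cvg_scaled_expR (w : nat -> R) (l : R) : (forall n, 0 <= w n) ->
  n%:R * w n @[n --> \oo] --> l ->
  n%:R * (1 - expR (- w n)) @[n --> \oo] --> l.
Proof.
move=> w0 wl.
have w20 : n%:R * w n ^+ 2 @[n --> \oo] --> (0 : R).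
  have : (n%:R * w n) * (n%:R * w n) * n%:R^-1 @[n --> \oo] --> l * l * 0.
    by apply: cvgM; [exact: cvgM|exact: cvg_invn].
  rewrite mulr0; apply: near_eq_cvgr; near=> n.
  have n0 : n%:R != 0 :> R by rewrite pnatr_eq0 -lt0n; near: n; exists 1%N.
  by field.
apply: (@squeeze_cvgr _ _ _ _ (fun n => n%:R * w n - n%:R * w n ^+ 2)
   (fun n => n%:R * w n)) => //; last first.
  by apply: (cvg_eqr (subr0 _)); exact: cvgB.
apply: nearW => n; rewrite -mulrBr !ler_wpM2l//.
  by have := expR_ge1Dx (- w n); lra.
by have := expR_quadratic (w0 n); rewrite ler_norml => /andP[]; lra.
Unshelve. all: by end_near.
Qed.

End scaling.

(** * Rates approximated by increments of the primitive H *)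

Section hazard_limits.
Context {R : realType}.
Variables (h H : R -> R).
Hypothesis h_nd : {homo h : x y / x <= y}.
Hypothesis h_ge0 : forall x, 0 <= h x.
Hypothesis hH : primitive_of h H.
Hypothesis H0 : H 0 = 0.

Definition small_jump (z : R) :=
  forall e, 0 < e -> exists2 d, 0 < d & h (z + d) - h (z - d) <= e.

Lemma primitive_nd s t : 0 <= s -> s <= t -> H s <= H t.
Proof.
move=> s0 st; rewrite -subr_ge0; have /andP[+ _] := hH s0 st; apply: le_trans.
by rewrite mulr_ge0// subr_ge0.
Qed.

Lemma small_jump_cvg (z : R) (u : nat -> R) : small_jump z -> u n @[n --> \oo] --> z ->
  h (u n) @[n --> \oo] --> h z.
Proof.
move=> jz uz; apply/cvgrPdist_le => e e0; have [d d0 hd] := jz _ e0; near=> n.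
have : `|z - u n| <= d by near: n; move/cvgrPdist_le : uz; exact.
rewrite ler_distlC => /andP[u1 u2].
have := h_nd u1; have := h_nd u2.
have zd : z <= z + d by lra.
have dz : z - d <= z by lra.
have := h_nd zd; have := h_nd dz.
by rewrite ler_norml; move: hd => ? ? ? ? ?; apply/andP; split; lra.
Unshelve. all: by end_near.
Qed.

(** Within distance one of [z] the function [H] is Lipschitz with constant [h (z + 1)]; one is added
    to keep [C] positive. *)
Lemma primitive_cvg (z : R) (u : nat -> R) : 0 <= z -> (\forall n \near \oo, 0 <= u n) ->
  u n @[n --> \oo] --> z -> H (u n) @[n --> \oo] --> H z.
Proof.
move=> z0 u0 uz; apply/cvgrPdist_le => e e0.
pose C := h (z + 1) + 1; have C0 : 0 < C by rewrite ltr_wpDl.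
near=> n.
have un0 : 0 <= u n by near: n.
have un1 : `|z - u n| <= 1 by near: n; move/cvgrPdist_le : uz; exact.
have un2 : `|z - u n| <= e / C.
  by near: n; move/cvgrPdist_le : uz; apply; rewrite divr_gt0.
have hz : h z <= C.
  by rewrite /C; have : h z <= h (z + 1); [apply: h_nd; lra|lra].
have hu : h (u n) <= C.
  move: un1; rewrite ler_distlC => /andP[_ u1].
  by rewrite /C; have : h (u n) <= h (z + 1); [exact: h_nd|lra].
have : C * `|z - u n| <= e by rewrite mulrC -ler_pdivlMr.
apply: le_trans; have [zu|uz'] := leP z (u n).
  have /andP[_ k] := hH z0 zu; have Hle := primitive_nd z0 zu.
  rewrite distrC (distrC z) !ger0_norm ?subr_ge0//.
  by apply: le_trans k _; rewrite ler_wpM2r// subr_ge0.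
have /andP[_ k] := hH un0 (ltW uz'); have Hle := primitive_nd un0 (ltW uz').
rewrite !ger0_norm ?subr_ge0// ?(ltW uz')//.
by apply: le_trans k _; rewrite ler_wpM2r// subr_ge0 ltW.
Unshelve. all: by end_near.
Qed.

(* [rate N i] is squeezed between multiples of [h (ln (N / (i+1))) / N], which
   are the increments of [H (ln (N / (i+1)))] up to a factor tending to 1. *)
Variable rate : nat -> nat -> R.
Hypothesis rate0 : forall N i, (N <= i)%N -> rate N i = 0.
Hypothesis rate_lower : forall N i, (0 < i < N)%N ->
  h (ln (N%:R / i.+1%:R)) <= N%:R * rate N i.
Hypothesis rate_upper : forall N i, (0 < i < N)%N ->
  N%:R * rate N i <= i.+2%:R / i%:R * h (ln (N%:R / i.+1%:R)).

Lemma cvg_ratio2 p (x : R) : scales p x -> 0 < x ->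
  (p n).+2%:R / (p n)%:R @[n --> \oo] --> (1 : R).
Proof.
move=> px x0; apply: (cvg_eqr (divff (lt0r_neq0 x0))).
exact: scales_ratio px (scalesS (scalesS px)) x0.
Qed.

Lemma rate_cvg p q (x y : R) : scales p x -> scales q y -> 0 < x -> x < y ->
  small_jump (ln (y / x)) ->
  n%:R * rate (q n) (p n) @[n --> \oo] --> h (ln (y / x)) / y.
Proof.
move=> px qy x0 xy jxy; have y0 : 0 < y by exact: lt_trans xy.
have hc : h (ln ((q n)%:R / (p n).+1%:R)) @[n --> \oo] --> h (ln (y / x)).
  by apply: small_jump_cvg => //; exact: scales_ln (scalesS px) qy x0 y0.
have iq := scales_inv qy y0.
apply: (@squeeze_cvgr _ _ _ _
  (fun n => h (ln ((q n)%:R / (p n).+1%:R)) * (n%:R / (q n)%:R))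
  (fun n => (p n).+2%:R / (p n)%:R * h (ln ((q n)%:R / (p n).+1%:R)) * (n%:R / (q n)%:R))).
- near=> n.
  have pn : (0 < p n)%N by near: n; exact: (scales_ge 1 px).
  have pq : (p n < q n)%N by near: n; exact: scales_ltn px qy xy.
  have q0 : 0 < (q n)%:R :> R by rewrite ltr0n; lia.
  have -> : n%:R * rate (q n) (p n) = ((q n)%:R * rate (q n) (p n)) * (n%:R / (q n)%:R).
    by field; exact: lt0r_neq0.
  have nq : 0 <= n%:R / (q n)%:R :> R by rewrite divr_ge0.
  have pnq : (0 < p n < q n)%N by rewrite pn.
  by rewrite !ler_wpM2r// ?rate_lower// rate_upper.
- exact: cvgM.
- apply: cvgM => //; apply: (cvg_eqr (mul1r _)); apply: cvgM => //.
  exact: cvg_ratio2 px x0.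
Unshelve. all: by end_near.
Qed.

(** The maximum makes [G i N] vanish for [N <= i + 1], so its increments telescope over the whole
    range of [N]. *)
Let G (i N : nat) : R := H (ln ((maxn N i.+1)%:R / i.+1%:R)).

(** The logarithmic increment is at most [1 / N], so the increment of [G] is at most [(N + 1) / N]
    times the rate at [N + 1]; the prefactor [i / (i + 1)] compensates because [N > i]. *)
Let G_lower i N : (0 < i)%N -> i%:R / i.+1%:R * (G i N.+1 - G i N) <= rate N.+1 i.
Proof.
move=> i0; have [Ni|iN] := leqP N.+1 i.+1; rewrite /G.
  have Ni' : (N <= i.+1)%N by lia.
  rewrite (maxn_idPr Ni) (maxn_idPr Ni') subrr mulr0.
  move: Ni; rewrite leq_eqVlt ltnS => /predU1P[[->]|/rate0 ->//].
  have N0 : 0 < i.+1%:R :> R by rewrite ltr0n.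
  rewrite -(pmulr_rge0 _ N0); apply: le_trans (rate_lower _) => //.
  by rewrite i0 /=.
have iN' : (i.+1 <= N)%N by lia.
rewrite (maxn_idPl (ltnW iN)) (maxn_idPl iN').
have N0 : 0 < N%:R :> R by rewrite ltr0n; lia.
have N1 : 0 < N.+1%:R :> R by rewrite ltr0n.
have i1 : 0 < i.+1%:R :> R by rewrite ltr0n.
have z0 := @ln_ratio_ge0 R _ _ iN'.
have zS : ln (N%:R / i.+1%:R) <= ln (N.+1%:R / i.+1%:R) :> R.
  by rewrite ler_ln ?posrE ?divr_gt0// ler_pM2r ?invr_gt0// ler_nat.
have /andP[_ k] := hH z0 zS.
have zB : ln (N.+1%:R / i.+1%:R) - ln (N%:R / i.+1%:R) <= N%:R^-1 :> R.
  rewrite -(ln_ratioD i1 N0 N1) addrK; apply: le_trans (ln_le_sub1 _) _.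
    by rewrite divr_gt0.
  by rewrite -natr1 mulrDl divff ?lt0r_neq0//; lra.
have rl : h (ln (N.+1%:R / i.+1%:R)) <= N.+1%:R * rate N.+1 i.
  by apply: rate_lower; rewrite i0; lia.
have {}k : H (ln (N.+1%:R / i.+1%:R)) - H (ln (N%:R / i.+1%:R)) <=
    N.+1%:R / N%:R * rate N.+1 i.
  apply: le_trans k _; rewrite mulrAC -[leRHS]/(_ * N%:R^-1).
  apply: (@le_trans _ _ (h (ln (N.+1%:R / i.+1%:R)) * N%:R^-1)).
    by rewrite ler_wpM2l.
  by rewrite ler_wpM2r// invr_ge0.
have r0 : 0 <= rate N.+1 i.
  by rewrite -(pmulr_rge0 _ N1); exact: le_trans rl.
apply: le_trans (ler_wpM2l _ k) _; first by rewrite divr_ge0.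
rewrite mulrA -[leRHS]mul1r ler_wpM2r// mulf_div ler_pdivrMr ?mulr_gt0// mul1r.
rewrite -!natrM ler_nat; nia.
Qed.

(** Here the logarithmic increment is at least [1 / (N + 1)]. The first factor comes from
    [rate_upper], the second bounds [(N + 1) / N]. *)
Let G_upper i N : (0 < i)%N ->
  rate N i <= i.+2%:R / i%:R * (i.+1%:R / i%:R) * (G i N.+1 - G i N).
Proof.
move=> i0; have i0' : 0 < i%:R :> R by rewrite ltr0n.
have i1 : 0 < i.+1%:R :> R by rewrite ltr0n.
have c0 : 0 <= i.+2%:R / i%:R * (i.+1%:R / i%:R) :> R by rewrite mulr_ge0// divr_ge0.
rewrite /G; have [Ni|iN] := leqP N i.
  rewrite rate0// mulr_ge0// subr_ge0.
  rewrite (maxn_idPr (leqW Ni)).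
  have : (N.+1 <= i.+1)%N by []; move=> /maxn_idPr ->; exact: lexx.
rewrite (maxn_idPl iN) (maxn_idPl (leqW iN)).
have N0 : 0 < N%:R :> R by rewrite ltr0n; lia.
have N1 : 0 < N.+1%:R :> R by rewrite ltr0n.
have z0 := @ln_ratio_ge0 R _ _ iN.
have zS : ln (N%:R / i.+1%:R) <= ln (N.+1%:R / i.+1%:R) :> R.
  by rewrite ler_ln ?posrE ?divr_gt0// ler_pM2r ?invr_gt0// ler_nat.
have /andP[k _] := hH z0 zS.
have zB : N.+1%:R^-1 <= ln (N.+1%:R / i.+1%:R) - ln (N%:R / i.+1%:R) :> R.
  rewrite -(ln_ratioD i1 N0 N1) addrK; apply: le_trans _ (ln_ge_sub1V _).
    rewrite invf_div -[X in X - _](divff (lt0r_neq0 N1)) -mulrBl -natr1.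
    by rewrite addrAC subrr add0r mul1r.
  by rewrite divr_gt0.
have ru : N%:R * rate N i <= i.+2%:R / i%:R * h (ln (N%:R / i.+1%:R)).
  by apply: rate_upper; rewrite i0.
set z := ln (N%:R / i.+1%:R) in z0 zS k zB ru *.
set z' := ln (N.+1%:R / i.+1%:R) in zS k zB *.
have hk : h z <= N.+1%:R * (H z' - H z).
  rewrite mulrC -ler_pdivrMr//; apply: le_trans k; exact: ler_wpM2l.
have D0 : 0 <= H z' - H z by rewrite subr_ge0 primitive_nd.
rewrite -(ler_pM2l N0); apply: le_trans ru _.
apply: le_trans (ler_wpM2l _ hk) _; first by rewrite divr_ge0.
rewrite -mulrA [leRHS]mulrCA ler_wpM2l ?divr_ge0// mulrA ler_wpM2r//.
rewrite mulrA ler_pdivlMr// -!natrM ler_nat; nia.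
Qed.

Lemma rate_sum_cvg p (x : R) : scales p x -> 0 < x -> x < 1 ->
  \sum_(2 <= N < n) rate N (p n) @[n --> \oo] --> H (ln x^-1).
Proof.
move=> px x0 x1.
have lx : 0 <= ln x^-1 by rewrite ln_ge0// invf_ge1// ltW.
have Hn : H (ln (n%:R / (p n).+1%:R)) @[n --> \oo] --> H (ln x^-1).
  apply: primitive_cvg => //; last first.
    by rewrite -[x^-1]mul1r; exact: scales_ln (scalesS px) scales_n x0 ltr01.
  near=> n; apply: ln_ratio_ge0; near: n; exact: scales_ltn px scales_n x1.
have Hp : H (ln (n.-1%:R / (p n).+1%:R)) @[n --> \oo] --> H (ln x^-1).
  apply: primitive_cvg => //; last first.
    by rewrite -[x^-1]mul1r; exact: scales_ln (scalesS px) scales_pred x0 ltr01.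
  near=> n; apply: ln_ratio_ge0; near: n; exact: scales_ltn px scales_pred x1.
have c1 : (p n)%:R / (p n).+1%:R @[n --> \oo] --> (1 : R).
  by apply: (cvg_eqr (divff (lt0r_neq0 x0))); exact: scales_ratio (scalesS px) px x0.
have c2 : (p n).+1%:R / (p n)%:R @[n --> \oo] --> (1 : R).
  by apply: (cvg_eqr (divff (lt0r_neq0 x0))); exact: scales_ratio px (scalesS px) x0.
apply: (@squeeze_cvgr _ _ _ _
  (fun n => (p n)%:R / (p n).+1%:R * H (ln (n.-1%:R / (p n).+1%:R)))
  (fun n => (p n).+2%:R / (p n)%:R * ((p n).+1%:R / (p n)%:R) * H (ln (n%:R / (p n).+1%:R)))).
- near=> n.
  have pn : (0 < p n)%N by near: n; exact: (scales_ge 1 px).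
  have pn' : (p n < n.-1)%N by near: n; exact: scales_ltn px scales_pred x1.
  have n2 : (2 <= n)%N by lia.
  have Gsmall i N : (N <= i.+1)%N -> G i N = 0.
    by move=> Ni; rewrite /G (maxn_idPr Ni) divff ?pnatr_eq0// ln1 H0.
  apply/andP; split.
    (* The lower estimate pairs the rate at [N] with the increment from [N - 1] to [N], so the
       telescoped sum stops at [n - 1]; hence the limit along [predn]. *)
    have -> : H (ln (n.-1%:R / (p n).+1%:R)) = \sum_(2 <= N < n) (G (p n) N - G (p n) N.-1).
      rewrite big_add1 /= telescope_sumr; last by lia.
      by rewrite (Gsmall _ 1%N)// subr0 /G (maxn_idPl pn').
    rewrite mulr_sumr ler_sum_nat// => -[//|N] _; exact: G_lower.
  have -> : H (ln (n%:R / (p n).+1%:R)) = \sum_(2 <= N < n) (G (p n) N.+1 - G (p n) N).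
    rewrite telescope_sumr// (Gsmall _ 2)// subr0 /G (maxn_idPl _)//; lia.
  by rewrite mulr_sumr ler_sum_nat// => N _; exact: G_upper.
- by apply: (cvg_eqr (mul1r _)); exact: cvgM.
- apply: (cvg_eqr (mul1r _)); apply: cvgM => //.
  by apply: (cvg_eqr (mul1r _)); apply: cvgM => //; exact: cvg_ratio2 px x0.
Unshelve. all: by end_near.
Qed.

End hazard_limits.

Section cvg_big.
Context {R : realType} {T : Type} (s : seq T) (Q : pred T).
Variables (f : nat -> T -> R) (l : T -> R).
Hypothesis fl : forall i, Q i -> f n i @[n --> \oo] --> l i.

Lemma cvg_sum_seq : \sum_(i <- s | Q i) f n i @[n --> \oo] --> \sum_(i <- s | Q i) l i.
Proof.
elim: s => [|a r IH].
  by rewrite big_nil; apply: (@near_eq_cvgr _ (fun=> 0)); [near=> n; rewrite big_nil|exact: cvg_cst].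
rewrite big_cons; case: ifPn => Qa.
  apply: (@near_eq_cvgr _ (fun n => f n a + \sum_(i <- r | Q i) f n i)).
    by near=> n; rewrite big_cons Qa.
  by apply: cvgD => //; exact: fl.
apply: near_eq_cvgr IH; near=> n; by rewrite big_cons (negPf Qa).
Unshelve. all: by end_near.
Qed.

Lemma cvg_prod_seq : \prod_(i <- s | Q i) f n i @[n --> \oo] --> \prod_(i <- s | Q i) l i.
Proof.
elim: s => [|a r IH].
  by rewrite big_nil; apply: (@near_eq_cvgr _ (fun=> 1)); [near=> n; rewrite big_nil|exact: cvg_cst].
rewrite big_cons; case: ifPn => Qa.
  apply: (@near_eq_cvgr _ (fun n => f n a * \prod_(i <- r | Q i) f n i)).
    by near=> n; rewrite big_cons Qa.
  by apply: cvgM => //; exact: fl.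
apply: near_eq_cvgr IH; near=> n; by rewrite big_cons (negPf Qa).
Unshelve. all: by end_near.
Qed.

End cvg_big.

(** * Limit of the pattern probability at a fixed point *)

Section discrete_limit.
Context {R : realType}.
Variables (mu : probability R R) (alpha : R).
Hypothesis alpha0 : 0 <= alpha.
Hypothesis mu01 : mu [set x : R | (0 <= x)%R /\ (x <= 1)%R] = 1%E.
Variables (L obs : seq (seq nat)).
Hypothesis tL : ptree L.
Hypothesis oL : observes L obs.

Let h := hfun mu alpha.
Let H := cumulative h.
Let ur := unit_rate mu alpha.

Definition coef (j : nat) : R := if j is 0%N then 1 + alpha else 1.

(** Index [0] is the individual itself and [j.+1] is its kid [j]. Together with [coef] this merges
    the self term, the kids and [alpha] into one sum of the same form as the hazard rate, whose term
    [j = 0] carries [1 + alpha]. *)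
Definition self_or_kid {T : Type} (f : seq nat -> T) (w : seq nat) (j : nat) : T :=
  if j is j'.+1 then f (rcons w j') else f w.

Lemma coef_ge0 j : 0 <= coef j.
Proof. by case: j => //=; rewrite addr_ge0. Qed.

Lemma kid_rateE I N w : kid_rate mu alpha L I N w =
  \sum_(j < (kids L w).+1) coef j * ur N (self_or_kid I w j).
Proof.
rewrite big_ord_recl /= /kid_rate; congr (_ + _).
rewrite /kid_values big_map -[iota _ _]/(iota 0 (kids L w)).
have -> : iota 0 (kids L w) = index_iota 0 (kids L w) by rewrite /index_iota subn0.
rewrite big_mkord.
by apply: eq_bigr => j _; rewrite /= mul1r.
Qed.

Definition coef_bound : R := 1 + alpha + (size L)%:R.

Lemma kids_le_size w : (kids L w <= size L)%N.
Proof. exact: count_size. Qed.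

Lemma sum_coef w : \sum_(j < (kids L w).+1) coef j <= coef_bound.
Proof.
rewrite big_ord_recl /= lerD2l sumr_const card_ord.
by rewrite ler_nat kids_le_size.
Qed.

Lemma kid_rate_le I N w : good_values L I -> (0 < I [::])%N -> w \in L ->
  kid_rate mu alpha L I N w <= coef_bound / (2 * (I [::])%:R).
Proof.
move=> gI I0 wL; rewrite kid_rateE.
have I0' : 0 < (I [::])%:R :> R by rewrite ltr0n.
apply: (@le_trans _ _ (\sum_(j < (kids L w).+1) coef j / (2 * (I [::])%:R))); last first.
  by rewrite -mulr_suml ler_wpM2r ?sum_coef// invr_ge0 mulr_ge0.
apply: ler_sum => j _; rewrite ler_wpM2l ?coef_ge0//.
have jL : (I [::] <= self_or_kid I w j)%N.
  case: j => -[|j] jk /=; first exact: (good_ge_root tL gI).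
  by apply: (good_ge_root tL gI); rewrite (ptree_mem_rcons _ _ tL) wL.
apply: le_trans (unit_rate_le alpha0 mu01 _ _) _; first exact: leq_trans jL.
have J0 : 0 < (self_or_kid I w j)%:R :> R by rewrite ltr0n (leq_trans I0).
by rewrite natrM lef_pV2 ?posrE ?mulr_gt0// ler_pM2l// ler_nat.
Qed.

Definition rate_bound : R := (size obs)%:R * coef_bound.

Lemma coef_bound_ge0 : 0 <= coef_bound.
Proof. by rewrite !addr_ge0. Qed.

Lemma total_rate_le I N : good_values L I -> (0 < I [::])%N ->
  0 <= total_rate mu alpha L obs I N <= rate_bound / (2 * (I [::])%:R).
Proof.
move=> gI I0; have [_ oL' _] := oL; rewrite /total_rate; apply/andP; split.
  by apply: sumr_ge0 => w _; exact: kid_rate_ge0.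
rewrite /rate_bound -mulrA -[X in X%:R * _]count_predT -sum1_count natr_sum mulr_suml.
rewrite big_seq [leRHS]big_seq; apply: ler_sum => w wo; rewrite mul1r.
by apply: kid_rate_le => //; exact: oL'.
Qed.

Let vals (I : seq nat -> nat) := [seq I w | w <- L & w != [::]].

(** Separates the finitely many arrival times that are prescribed positions from all others; since
    positions are distinct, the former give exactly one attachment factor per non-root word. *)
Lemma prod_step_prob I n : good_values L I -> (0 < I [::])%N ->
  (forall w, w \in L -> (I w < n)%N) ->
  \prod_(2 <= N < n) step_prob mu alpha L obs I N =
  (\prod_(w <- L | w != [::]) kid_rate mu alpha L I (I w) (parent_word w)) *
  \prod_(2 <= N < n) (if N \in vals I then 1 else 1 - total_rate mu alpha L obs I N).
Proof.
move=> gI I0 In; have [g1 g2 inj] := gI.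
rewrite (bigID (mem (vals I))) /=; congr (_ * _).
  rewrite -big_filter -[RHS]big_filter.
  have -> : \prod_(w <- [seq w <- L | w != [::]]) kid_rate mu alpha L I (I w) (parent_word w)
     = \prod_(N <- vals I) step_prob mu alpha L obs I N.
    rewrite /vals big_map big_seq [RHS]big_seq; apply: eq_bigr => w.
    rewrite mem_filter => /andP[w0 wL]; case/lastP: w w0 wL => // w c _ wL.
    by rewrite step_prob_kid// parent_word_rcons.
  apply: perm_big; apply: uniq_perm.
  - exact/filter_uniq/iota_uniq.
  - rewrite /vals map_inj_in_uniq; first exact/filter_uniq/ptree_uniq.
    move=> w w'; rewrite !mem_filter => /andP[_ wL] /andP[_ w'L]; exact: inj.
  - move=> N; rewrite mem_filter mem_index_iota.
    apply: andb_idr => /mapP[w]; rewrite mem_filter => /andP[w0 wL] ->.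
    rewrite In// andbT; case/lastP: w w0 wL => // w c _ wL.
    have wL' : w \in L by move: wL; rewrite (ptree_mem_rcons _ _ tL) => /andP[].
    have := g1 _ _ wL; have := good_ge_root tL gI wL'; lia.
rewrite big_mkcond; apply: eq_big_nat => N _; case: ifPn => //=; rewrite ?negbK.
  move=> Nv; rewrite (negPf Nv) step_prob_other// => w wL w0 wN.
  by move/negP : Nv; apply; apply/mapP; exists w => //; rewrite mem_filter w0.
by move=> ->.
Qed.

(** The assumption [rate_bound <= 2 * I [::]] keeps every avoidance factor [1 - total_rate] in
    [[0, 1]]; only the attachment factors, one per non-root word, enter the bound. *)
Lemma prod_step_prob_bound I n : good_values L I -> (0 < I [::])%N ->
  (forall w, w \in L -> (I w < n)%N) -> rate_bound <= 2 * (I [::])%:R ->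
  0 <= \prod_(2 <= N < n) step_prob mu alpha L obs I N <=
  (coef_bound / (2 * (I [::])%:R)) ^+ (size L).-1.
Proof.
move=> gI I0 In Ib; have I0' : 0 < (I [::])%:R :> R by rewrite ltr0n.
have c0 : 0 <= coef_bound / (2 * (I [::])%:R).
  by rewrite divr_ge0 ?coef_bound_ge0// mulr_ge0.
have t01 N : 0 <= 1 - total_rate mu alpha L obs I N <= 1.
  have /andP[t0 t1] := total_rate_le N gI I0.
  have : rate_bound / (2 * (I [::])%:R) <= 1.
    by rewrite ler_pdivrMr ?mulr_gt0// mul1r.
  by move=> t2; apply/andP; split; lra.
have sL : count (fun w : seq nat => w != [::]) L = (size L).-1.
  have [M LM] := ptree_head tL; have := ptree_uniq tL; rewrite LM /= => /andP[n0 _].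
  rewrite add0n (eq_in_count (a2 := predT)) ?count_predT// => w wM.
  by apply/eqP => w0; rewrite w0 in wM; rewrite wM in n0.
rewrite prod_step_prob//.
have P1 : 0 <= \prod_(2 <= N < n) (if N \in vals I then 1 else
    1 - total_rate mu alpha L obs I N) <= 1.
  apply/andP; split; first by apply: prodr_ge0 => N _; case: ifP => // _; have /andP[] := t01 N.
  by apply: prodr_ile1 => N _; case: ifP => // _; rewrite ler01 lexx.
have P2 : 0 <= \prod_(w <- L | w != [::]) kid_rate mu alpha L I (I w) (parent_word w) <=
    (coef_bound / (2 * (I [::])%:R)) ^+ (size L).-1.
  apply/andP; split; first by apply: prodr_ge0 => w _; exact: kid_rate_ge0.
  rewrite -sL -iter_mulr_1 -big_const_seq big_seq_cond [leRHS]big_seq_cond.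
  apply: ler_prod => w /andP[wL w0]; rewrite kid_rate_ge0//=.
  case/lastP: w w0 wL => // w c _ wL; rewrite parent_word_rcons kid_rate_le//.
  by move: wL; rewrite (ptree_mem_rcons _ _ tL) => /andP[].
have /andP[a1 a2] := P1; have /andP[b1 b2] := P2.
by rewrite mulr_ge0//= (le_trans _ b2)// ler_piMr.
Qed.

Section limit.
Variables (I : nat -> seq nat -> nat) (x : seq nat -> R).
Hypothesis Ix : forall w, w \in L -> scales (I ^~ w) (x w).
Hypothesis x01 : forall w, w \in L -> 0 < x w < 1.
Hypothesis x_kid : forall w c, rcons w c \in L -> x w < x (rcons w c).
Hypothesis x_sib : forall w c, rcons w c.+1 \in L -> x (rcons w c) < x (rcons w c.+1).
Hypothesis x_inj : {in L &, injective x}.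
Hypothesis x_jump : forall w w', w \in L -> w' \in L -> x w < x w' ->
  small_jump h (ln (x w' / x w)).

Lemma eventually_all (T : eqType) (s : seq T) (Q : nat -> T -> Prop) :
  (forall w, w \in s -> \forall n \near \oo, Q n w) ->
  \forall n \near \oo, forall w, w \in s -> Q n w.
Proof.
elim: s => [|a s IH] hs; first by near=> n.
have hs' w : w \in s -> \forall n \near \oo, Q n w by move=> ws; apply: hs; rewrite inE ws orbT.
near=> n => w; rewrite inE => /predU1P[->|]; move: w; last by near: n; exact: IH.
by move=> _; near: n; apply: hs; rewrite mem_head.
Unshelve. all: by end_near.
Qed.

Lemma eventually_good : \forall n \near \oo, good_values L (I n) /\
  (forall w, w \in L -> (0 < I n w < n)%N).
Proof.
have bnd : \forall n \near \oo, forall w, w \in L -> (0 < I n w < n)%N.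
  apply: eventually_all => w wL; have /andP[x0 x1] := x01 wL.
  near=> n; apply/andP; split; near: n; first exact: (scales_ge 1 (Ix wL)).
  exact: scales_ltn (Ix wL) scales_n x1.
have ord : \forall n \near \oo, forall w, w \in L -> forall w', w' \in L ->
    x w < x w' -> (I n w < I n w')%N.
  apply: eventually_all => w wL; apply: eventually_all => w' w'L.
  have [xx|xx] := ltP (x w) (x w'); last by near=> n.
  by near=> n => _; near: n; exact: scales_ltn (Ix wL) (Ix w'L) xx.
near=> n; have bnd' : forall w, w \in L -> (0 < I n w < n)%N by near: n.
have ord' : forall w, w \in L -> forall w', w' \in L -> x w < x w' -> (I n w < I n w')%N.
  by near: n.
split=> //; have pL w c : rcons w c \in L -> w \in L.
  by rewrite (ptree_mem_rcons _ _ tL) => /andP[].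
split=> [w c wc|w c wc|w w' wL w'L e].
- by apply: ord' => //; [exact: pL wc|exact: x_kid].
- apply: ord' => //; last exact: x_sib.
  by move: wc; rewrite !(ptree_mem_rcons _ _ tL) => /andP[-> /ltnW].
- apply: x_inj => //; have [xx|xx|//] := ltgtP (x w) (x w').
    by have := ord' _ wL _ w'L xx; rewrite e ltnn.
  by have := ord' _ w'L _ wL xx; rewrite e ltnn.
Unshelve. all: by end_near.
Qed.

Let h_nd := hfun_nondecreasing mu alpha0.
Let h_ge0 := hfun_ge0 mu alpha0.

Lemma hfun_primitive : primitive_of h H.
Proof. by apply: cumulative_primitive => // y _; exact: h_ge0. Qed.

(** Limiting density, in the rescaled position of [rcons w c], for the attachment of kid [c] to [w];
    the division by that position is the Jacobian of logarithmic time. *)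
Definition kid_intensity (w : seq nat) (c : nat) : R :=
  (\sum_(j < c.+1) coef j * h (ln (x (rcons w c) / self_or_kid x w j))) / x (rcons w c).

(** Rate accumulated by [w] until the end: a half-edge created at position [x] contributes
    [H (ln (1 / x))]. *)
Definition total_hazard (w : seq nat) : R :=
  \sum_(j < (kids L w).+1) coef j * H (ln (self_or_kid x w j)^-1).

Lemma self_or_kid_mem w (j : nat) : w \in L -> (j < (kids L w).+1)%N ->
  self_or_kid id w j \in L.
Proof. by move=> wL; case: j => // j jk /=; rewrite (ptree_mem_rcons _ _ tL) wL. Qed.

Lemma self_or_kidE {T} (f : seq nat -> T) w j : self_or_kid f w j = f (self_or_kid id w j).
Proof. by case: j. Qed.

Lemma kid_lt w c c' : rcons w c \in L -> (c' < c)%N -> x (rcons w c') < x (rcons w c).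
Proof.
elim: c => // c IH wc; rewrite ltnS leq_eqVlt => /predU1P[->|]; first exact: x_sib.
move=> cc; apply: lt_trans (x_sib wc); apply: IH => //.
by move: wc; rewrite !(ptree_mem_rcons _ _ tL) => /andP[-> /ltnW].
Qed.

Lemma kid_rate_cvg w c : rcons w c \in L ->
  n%:R * kid_rate mu alpha L (I n) (I n (rcons w c)) w @[n --> \oo] --> kid_intensity w c.
Proof.
move=> wc; have wck := wc; rewrite (ptree_mem_rcons _ _ tL) in wck; have [wL ck] := andP wck.
pose t (n j : nat) : R := n%:R * (coef j * ur (I n (rcons w c)) (self_or_kid (I n) w j)).
have tc (j : nat) : (j < c.+1)%N -> t n j @[n --> \oo] -->
    coef j * h (ln (x (rcons w c) / self_or_kid x w j)) / x (rcons w c).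
  move=> jc; have jL : self_or_kid id w j \in L.
    by apply: self_or_kid_mem => //; apply: leq_trans jc _; exact: ltnW.
  rewrite /t -mulrA; under eq_fun do rewrite mulrCA.
  apply: cvgM; first exact: cvg_cst.
  have xx : x (self_or_kid id w j) < x (rcons w c).
    by case: j jc jL => [|j] jc jL /=; [exact: x_kid|exact: kid_lt].
  rewrite self_or_kidE; under eq_fun do rewrite self_or_kidE.
  apply: (rate_cvg h_nd _ _ (Ix jL) (Ix wc)) => //.
  - by move=> N i /andP[i0 iN]; apply: unit_rate_lower => //; rewrite i0.
  - by move=> N i /andP[i0 iN]; apply: unit_rate_upper => //; rewrite i0.
  - by have /andP[] := x01 jL.
  - exact: x_jump.
have -> : kid_intensity w c = \sum_(j < c.+1)
    coef j * h (ln (x (rcons w c) / self_or_kid x w j)) / x (rcons w c).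
  by rewrite /kid_intensity mulr_suml.
apply: (@near_eq_cvgr _ (fun n => \sum_(j < c.+1) t n j)); last first.
  apply: cvg_sum_seq => j _; exact: tc.
near=> n; have [gI _] : good_values L (I n) /\ (forall w, w \in L -> (0 < I n w < n)%N).
  by near: n; exact: eventually_good.
rewrite kid_rateE mulr_sumr -(big_mkord xpredT (fun j => t n j)).
rewrite -(big_mkord xpredT (fun j => n%:R * (coef j * ur (I n (rcons w c)) (self_or_kid (I n) w j)))).
(* Kid [c] and its younger siblings are not placed before the current arrival time, so their rates
   vanish and the sum stops at index [c]. *)
rewrite (big_cat_nat (n := c.+1) (p := (kids L w).+1))//=; last exact: ltnW.
rewrite [X in _ + X](_ : _ = 0) ?addr0//.
rewrite big_nat big1// => -[//|j] /andP[cj jk] /=.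
rewrite /ur unit_rate_eq0 ?mulr0//; have [g1 g2 inj] := gI.
have [->//|jc] := eqVneq j c; apply: ltnW.
have cj' : (c < j)%N by rewrite ltn_neqAle eq_sym jc.
have jk' : (j < kids L w)%N by [].
elim: j cj' jk' {cj jk jc} => // j IH; rewrite ltnS leq_eqVlt => cj jk.
have jL : rcons w j.+1 \in L by rewrite (ptree_mem_rcons _ _ tL) wL.
case/predU1P: cj => [->|cj]; first exact: g2.
by apply: ltn_trans (g2 _ _ jL); apply: IH => //; exact: ltnW.
Unshelve. all: by end_near.
Qed.

Lemma total_rate_sum_cvg :
  \sum_(2 <= N < n) total_rate mu alpha L obs (I n) N @[n --> \oo] -->
  \sum_(w <- obs) total_hazard w.
Proof.
have [_ oL' _] := oL.
have -> : (fun n => \sum_(2 <= N < n) total_rate mu alpha L obs (I n) N) =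
  (fun n => \sum_(w <- obs) \sum_(j < (kids L w).+1) coef j *
     \sum_(2 <= N < n) ur N (self_or_kid (I n) w j)).
  apply/funext => n; rewrite /total_rate exchange_big; apply: eq_bigr => w _ /=.
  under eq_bigr do rewrite kid_rateE.
  by rewrite exchange_big; apply: eq_bigr => j _ /=; rewrite mulr_sumr.
rewrite big_seq; under eq_fun do rewrite big_seq.
apply: cvg_sum_seq => w wo; apply: cvg_sum_seq => j _; apply: cvgM; first exact: cvg_cst.
have jL : self_or_kid id w j \in L by apply: self_or_kid_mem => //; exact: oL'.
rewrite self_or_kidE; under eq_fun do under eq_bigr do rewrite self_or_kidE.
have /andP[x0 x1] := x01 jL.
apply: (rate_sum_cvg h_nd h_ge0 hfun_primitive (cumulative0 _) _ _ _ (Ix jL)) => //.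
- by move=> N i; exact: unit_rate_eq0.
- by move=> N i /andP[i0 iN]; apply: unit_rate_lower => //; rewrite i0.
- by move=> N i /andP[i0 iN]; apply: unit_rate_upper => //; rewrite i0.
Qed.

(** Every factor [1 - S] is replaced by [expR (- S)]. With [S <= C / n] this costs at most
    [(C / n) ^+ 2] per factor, and the prescribed arrival times, at most [size L] of them, cost
    [C / n] each. *)
Lemma no_attach_cvg :
  \prod_(2 <= N < n) (if N \in vals (I n) then 1 else
     1 - total_rate mu alpha L obs (I n) N) @[n --> \oo] -->
  expR (- \sum_(w <- obs) total_hazard w).
Proof.
pose S n N := total_rate mu alpha L obs (I n) N.
pose A n := \prod_(2 <= N < n) (if N \in vals (I n) then 1 else 1 - S n N).
pose B n := \prod_(2 <= N < n) expR (- S n N).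
have Bc : B n @[n --> \oo] --> expR (- \sum_(w <- obs) total_hazard w).
  have -> : B = (fun n => expR (- \sum_(2 <= N < n) S n N)).
    by apply/funext => n; rewrite /B -expR_sum sumrN.
  by apply: continuous_cvg; [exact: continuous_expR|apply: cvgN; exact: total_rate_sum_cvg].
have x0 : 0 < x [::] by have /andP[] := x01 (ptree_nil tL).
(* Eventually [I n [::]] exceeds [x [::] / 2 * n], which turns the bound [rate_bound / (2 * I n
   [::])] into [C / n]. *)
pose C : R := rate_bound / x [::].
have C0 : 0 <= C by rewrite divr_ge0 ?(ltW x0)// /rate_bound mulr_ge0 ?coef_bound_ge0.
have ABc : A n - B n @[n --> \oo] --> 0.
  apply/norm_cvg0P.
  apply: (@squeeze_cvgr _ _ _ _ (cst 0)
     (fun n => (C ^+ 2 + (size L)%:R * C) * n%:R^-1)); last 2 first.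
  - exact: cvg_cst.
  - by apply: (cvg_eqr (mulr0 _)); apply: cvgM; [exact: cvg_cst|exact: cvg_invn].
  near=> n; rewrite normr_ge0 /=.
  have n0 : 0 < n%:R :> R by rewrite ltr0n; near: n; exists 1%N.
  have [gI In] : good_values L (I n) /\ (forall w, w \in L -> (0 < I n w < n)%N).
    by near: n; exact: eventually_good.
  have I0 : (0 < I n [::])%N by have /andP[] := In _ (ptree_nil tL).
  have I0' : 0 < (I n [::])%:R :> R by rewrite ltr0n.
  have Sb N : 0 <= S n N <= C / n%:R.
    have /andP[-> /=] := total_rate_le N gI I0; move=> /le_trans; apply.
    rewrite /C -mulrA ler_wpM2l ?mulr_ge0 ?coef_bound_ge0//.
    rewrite -invfM lef_pV2 ?posrE ?mulr_gt0// mulrC.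
    have : x [::] / 2 * n%:R < (I n [::])%:R.
      by near: n; apply: (scales_gt (Ix (ptree_nil tL))); lra.
    by rewrite mulrAC; lra.
  have Sb1 : C / n%:R <= 1.
    rewrite ler_pdivrMr// mul1r; near: n.
    by exists (Num.truncn C).+1 => // m /= Cm; apply: le_trans (ltW (truncnS_gt C)) _; rewrite ler_nat.
  apply: le_trans (prod_dist _ _) _.
  - move=> N _; case: ifP => // _; first by rewrite ler01 lexx.
    by have /andP[? ?] := Sb N; apply/andP; split; lra.
  - move=> N _; rewrite expR_ge0 -[leRHS]expR0 ler_expR /=.
    by have /andP[? _] := Sb N; lra.
  apply: (@le_trans _ _ (\sum_(2 <= N < n) ((C / n%:R) ^+ 2 +
      (if N \in vals (I n) then C / n%:R else 0)))).
    apply: ler_sum => N _; have /andP[S0 S1] := Sb N; case: ifP => _.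
      rewrite ger0_norm; last by rewrite subr_ge0 -[leRHS]expR0 ler_expR; lra.
      by have := expR_ge1Dx (- S n N); have := sqr_ge0 (C / n%:R); lra.
    rewrite addr0; apply: le_trans (expR_quadratic S0) _.
    by rewrite lerXn2r ?nnegrE// (le_trans S0).
  rewrite big_split /= mulrDl lerD//.
    rewrite sumr_const_nat -[leLHS]mulr_natl expr_div_n mulrA.
    rewrite [leRHS](_ : _ = n%:R * C ^+ 2 / n%:R ^+ 2); last by field; exact: lt0r_neq0.
    by rewrite ler_wpM2r ?invr_ge0 ?exprn_ge0// ler_wpM2r ?exprn_ge0// ler_nat leq_subr.
  rewrite -big_mkcond /= big_const_seq iter_addr addr0 -mulrA -[leLHS]mulr_natl.
  apply: ler_wpM2r; first by rewrite divr_ge0 ?(ltW n0).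
  rewrite ler_nat.
  rewrite -size_filter; apply: (@leq_trans (size (vals (I n)))).
    apply: uniq_leq_size; first exact/filter_uniq/iota_uniq.
    by move=> N; rewrite mem_filter => /andP[].
  by rewrite size_map size_filter count_size.
rewrite (_ : (fun n => _) = (fun n => (A n - B n) + B n)); last first.
  by apply/funext => n; rewrite subrK.
by apply: (cvg_eqr (add0r _)); exact: cvgD.
Unshelve. all: by end_near.
Qed.

Definition word_kid (w : seq nat) := last 0%N w.

Lemma size_nonroot : size [seq w <- L | w != [::]] = (size L).-1.
Proof.
have [M LM] := ptree_head tL; have := ptree_uniq tL; rewrite LM /= => /andP[n0 _].
rewrite (_ : [seq w <- M | w != [::]] = M)//; apply/all_filterP/allP => w wM.
by apply/eqP => w0; rewrite w0 in wM; rewrite wM in n0.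
Qed.

Lemma discrete_cvg :
  n%:R ^+ (size L).-1 * \prod_(2 <= N < n) step_prob mu alpha L obs (I n) N
    @[n --> \oo] -->
  (\prod_(w <- L | w != [::]) kid_intensity (parent_word w) (word_kid w)) *
  expR (- \sum_(w <- obs) total_hazard w).
Proof.
apply: (@near_eq_cvgr _ (fun n =>
  (\prod_(w <- L | w != [::]) (n%:R * kid_rate mu alpha L (I n) (I n w) (parent_word w))) *
  \prod_(2 <= N < n) (if N \in vals (I n) then 1 else
     1 - total_rate mu alpha L obs (I n) N))).
  near=> n.
  have [gI In] : good_values L (I n) /\ (forall w, w \in L -> (0 < I n w < n)%N).
    by near: n; exact: eventually_good.
  rewrite prod_step_prob//; last 2 first.
  - by have /andP[] := In _ (ptree_nil tL).
  - by move=> w /In/andP[].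
  rewrite mulrA big_split /=; congr (_ * _ * _).
  by rewrite big_const_seq -size_filter size_nonroot iter_mulr_1.
apply: cvgM; last exact: no_attach_cvg.
rewrite big_seq_cond; under eq_fun do rewrite big_seq_cond.
apply: cvg_prod_seq => w /andP[wL w0].
case/lastP: w w0 wL => // w c _ wL; rewrite parent_word_rcons /word_kid last_rcons.
exact: kid_rate_cvg.
Unshelve. all: by end_near.
Qed.

End limit.
End discrete_limit.

(** * Inter-birth times of one individual *)

Section convex_primitive.
Context {R : realType}.
Variables (h H : R -> R) (alpha : R).
Hypothesis h_nd : {homo h : x y / x <= y}.
Hypothesis h_ge0 : forall x, 0 <= h x.
Hypothesis hH : primitive_of h H.
Hypothesis H0 : H 0 = 0.
Hypothesis alpha0 : 0 <= alpha.

(** If the two intervals overlap, their common part cancels and the comparison is between [[u, u']]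
    and [[u + t, u' + t]], which [h u' <= h (u + t)] separates. *)
Lemma primitive_convex u u' t : 0 <= u -> u <= u' -> 0 <= t ->
  H (u + t) - H u <= H (u' + t) - H u'.
Proof.
move=> u0 uu t0; have u'0 := le_trans u0 uu.
have a1 : u <= u + t by lra.
have a2 : u' <= u' + t by lra.
have [tu|ut] := leP (u + t) u'.
  have /andP[_ k1] := hH u0 a1; have /andP[k2 _] := hH u'0 a2.
  apply: le_trans k1 _; apply: le_trans k2.
  by rewrite !(addrAC _ t) !subrr !add0r ler_wpM2r//; exact: h_nd.
have a3 : u + t <= u' + t by lra.
have b0 : 0 <= u + t by lra.
have /andP[_ k1] := hH u0 uu; have /andP[k2 _] := hH b0 a3.
have k3 : h u' * (u' - u) <= h (u + t) * (u' - u).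
  by rewrite ler_wpM2r ?subr_ge0//; exact/h_nd/ltW.
have e : u' + t - (u + t) = u' - u by ring.
by rewrite e in k2; lra.
Qed.

Let coef := coef alpha.
Let c0 := coef_ge0 alpha0.

(** With [theta j = sig e l - sig e j] this is the integral over [[0, s]] of the hazard of the next
    waiting time. Convexity of [H] makes it monotone in nonnegative [theta], so the exact past can
    be replaced by bounds on it. *)
Definition cumulative_hazard (l : nat) (theta : nat -> R) (s : R) : R :=
  \sum_(j < l.+1) coef j * (H (s + theta j) - H (theta j)).

Lemma cumulative_hazard_le l theta theta' s : 0 <= s ->
  (forall j, (j <= l)%N -> 0 <= theta j <= theta' j) ->
  cumulative_hazard l theta s <= cumulative_hazard l theta' s.
Proof.
move=> s0 th; apply: ler_sum => j _; have /andP[t0 t1] := th j (ltn_ord j).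
by rewrite ler_wpM2l ?c0// (addrC s) (addrC s (theta' j)) primitive_convex.
Qed.

Lemma cumulative_hazard_ge0 l theta s : 0 <= s ->
  (forall j, (j <= l)%N -> 0 <= theta j) -> 0 <= cumulative_hazard l theta s.
Proof.
move=> s0 th; apply: sumr_ge0 => j _; rewrite mulr_ge0 ?c0// subr_ge0.
by apply: (primitive_nd h_ge0 hH) => //; [exact: th (ltn_ord j)|lra].
Qed.

Lemma cumulative_hazardB l theta a b :
  cumulative_hazard l theta b - cumulative_hazard l theta a =
  \sum_(j < l.+1) coef j * (H (b + theta j) - H (a + theta j)).
Proof. by rewrite -sumrB; apply: eq_bigr => j _; ring. Qed.

Lemma cumulative_hazardB_le l theta theta' a b : 0 <= a -> a <= b ->
  (forall j, (j <= l)%N -> 0 <= theta j <= theta' j) ->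
  cumulative_hazard l theta b - cumulative_hazard l theta a <=
  cumulative_hazard l theta' b - cumulative_hazard l theta' a.
Proof.
move=> a0 ab th; rewrite !cumulative_hazardB; apply: ler_sum => j _.
have /andP[t0 t1] := th j (ltn_ord j); rewrite ler_wpM2l ?c0//.
have e t : b + t = (a + t) + (b - a) by ring.
by rewrite (e (theta j)) (e (theta' j)) primitive_convex//; lra.
Qed.

Lemma cumulative_hazardB_bound l theta a b : 0 <= a -> a <= b ->
  (forall j, (j <= l)%N -> 0 <= theta j) ->
  \sum_(j < l.+1) coef j * h (a + theta j) * (b - a) <=
  cumulative_hazard l theta b - cumulative_hazard l theta a <=
  \sum_(j < l.+1) coef j * h (b + theta j) * (b - a).
Proof.
move=> a0 ab th; rewrite cumulative_hazardB.
have k (j : 'I_l.+1) : h (a + theta j) * (b - a) <= H (b + theta j) - H (a + theta j)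
    <= h (b + theta j) * (b - a).
  have t0 := th j (ltn_ord j).
  have s0 : 0 <= a + theta j by lra.
  have st : a + theta j <= b + theta j by lra.
  by have := hH s0 st; rewrite (_ : b + theta j - (a + theta j) = b - a); last by ring.
by apply/andP; split; apply: ler_sum => j _; rewrite -mulrA ler_wpM2l ?c0//; have /andP[] := k j.
Qed.

Lemma cumulative_hazardB_ge0 l theta a b : 0 <= a -> a <= b ->
  (forall j, (j <= l)%N -> 0 <= theta j) ->
  0 <= cumulative_hazard l theta b - cumulative_hazard l theta a.
Proof.
move=> a0 ab th; have /andP[+ _] := cumulative_hazardB_bound a0 ab th.
apply: le_trans; apply: sumr_ge0 => j _.
by rewrite mulr_ge0 ?subr_ge0// mulr_ge0// c0.
Qed.

Lemma one_sub_expR_ge0 (z : R) : 0 <= z -> 0 <= 1 - expR (- z).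
Proof. by move=> z0; rewrite subr_ge0 -[leRHS]expR0 ler_expR oppr_le0. Qed.

(** A larger past lowers the survival factor and raises the increment factor, so each bound takes
    one extreme in the first factor and the opposite one in the second. *)
Lemma expR_increment_bounds (A B A0 B0 A1 B1 : R) :
  0 <= B0 - A0 -> B0 - A0 <= B - A -> B - A <= B1 - A1 ->
  expR (- A1) <= expR (- A) -> expR (- A) <= expR (- A0) ->
  expR (- A1) * (1 - expR (- (B0 - A0))) <= expR (- A) * (1 - expR (- (B - A))) <=
  expR (- A0) * (1 - expR (- (B1 - A1))).
Proof.
move=> w0 w1 w2 s1 s2.
have f2 (z z' : R) : z <= z' -> 1 - expR (- z) <= 1 - expR (- z').
  by move=> zz; rewrite lerD2l lerN2 ler_expR lerN2.
apply/andP; split; apply: ler_pM; rewrite ?expR_ge0//; try exact: f2.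
  exact: one_sub_expR_ge0.
by apply: one_sub_expR_ge0; exact: le_trans w1.
Qed.

End convex_primitive.

(** * The survival function as a sum of shifted primitives *)

Section survival.
Context {R : realType}.
Variables (mu : probability R R) (alpha : R).
Hypothesis alpha0 : 0 <= alpha.

Let h := hfun mu alpha.
Let H := cumulative h.
Let h_nd : {homo h : x y / x <= y} := hfun_nondecreasing mu alpha0.
Let h_ge0 : forall x, 0 <= h x := hfun_ge0 mu alpha0.
Let hH : primitive_of h H := hfun_primitive mu alpha0.
Let H0 : H 0 = 0 := cumulative0 h.

Lemma sig_nd (e : nat -> R) (i j : nat) : (forall q, (q < i)%N -> 0 <= e q) ->
  (j <= i)%N -> sig e j <= sig e i.
Proof.
move=> e0 ji; rewrite /sig -!(big_mkord xpredT) (big_cat_nat (n := j) (p := i))//=.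
rewrite lerDl big_nat sumr_ge0// => q /andP[_ qi]; exact: e0.
Qed.

(** The integral of the hazard and the sum of shifted copies of [H] are primitives of the same
    nondecreasing function, so [primitive_of_unique] identifies them. *)
Lemma survivalE e i s : (forall q, (q < i)%N -> 0 <= e q) -> 0 <= s ->
  survival mu alpha e i s = expR (- cumulative_hazard H alpha i (fun j => sig e i - sig e j) s).
Proof.
move=> e0 s0; rewrite /survival -/(cumulative (hazard mu alpha e i) s).
congr (expR (- _)).
have d0 (j : nat) : (j <= i)%N -> 0 <= sig e i - sig e j by move=> ji; rewrite subr_ge0 sig_nd.
pose g x := \sum_(j < i.+1) coef alpha j * h (x + (sig e i - sig e j)).
have gE : hazard mu alpha e i = g.
  apply/funext => x; rewrite /hazard /g !big_ord_recl /=.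
  rewrite /sig big_ord0 subr0 addrAC mulrDl mul1r addrA subr0 -/h; congr (_ + _).
  by apply: eq_bigr => j _; rewrite mul1r addrA.
have pg : primitive_of g (fun x => \sum_(j < i.+1) coef alpha j * H (x + (sig e i - sig e j))).
  apply: primitive_of_sum => j; apply: primitive_ofZ; first exact: coef_ge0.
  by apply: primitive_ofS => //; apply: d0; rewrite -ltnS.
have pc : primitive_of g (cumulative g).
  apply: cumulative_primitive => [x y xy|x _].
    by apply: ler_sum => j _; rewrite ler_wpM2l ?coef_ge0//; apply: h_nd; rewrite lerD2r.
  by apply: sumr_ge0 => j _; rewrite mulr_ge0 ?coef_ge0.
have := primitive_of_unique pc pg s0; rewrite cumulative0 subr0 gE => ->.
rewrite /cumulative_hazard -sumrB; apply: eq_bigr => j _.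
by rewrite add0r mulrBr.
Qed.

(** At negative arguments the domain of integration is empty and [H] is zero. Monotonicity on the
    whole line later gives measurability of [H]. *)
Lemma cumulative_nd : {homo H : x y / x <= y}.
Proof.
move=> s t st; have [s0|s0] := leP 0 s; first exact: (primitive_nd h_ge0 hH).
rewrite /H /cumulative (_ : interval0 s = set0); last first.
  by apply/seteqP; split=> x //= [x0 xs]; have := le_lt_trans (le_trans x0 xs) s0; rewrite ltxx.
by rewrite integral_set0 fine_ge0// integral_ge0// => x _; rewrite lee_fin; exact: h_ge0.
Qed.

End survival.

(** For positive [a] and [b], the waiting times [e] with [b < a exp e <= b + 1], which move the
    current position from [a] to [b]. *)
Definition index_cell {R : realType} (a b : nat) : set R :=
  `]ln (b%:R / a%:R), ln (b.+1%:R / a%:R)]%classic.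

(** * Bracketing the cell probabilities of one individual *)

Section individual.
Context {R : realType}.
Variables (h H : R -> R) (alpha : R).
Hypothesis h_nd : {homo h : x y / x <= y}.
Hypothesis h_ge0 : forall x, 0 <= h x.
Hypothesis hH : primitive_of h H.
Hypothesis H0 : H 0 = 0.
Hypothesis H_nd : {homo H : x y / x <= y}.
Hypothesis alpha0 : 0 <= alpha.
Variable srv : (nat -> R) -> nat -> R -> R.
Hypothesis srvE : forall e i s, (forall q, (q < i)%N -> 0 <= e q) -> 0 <= s ->
  srv e i s = expR (- cumulative_hazard H alpha i (fun j => sig e i - sig e j) s).

Notation CH := (cumulative_hazard H alpha).

Context (d : measure_display) (Omega : measurableType d) (P : probability Omega R).
Variable E : nat -> Omega -> \bar R.
Hypothesis mE : forall j, measurable_fun setT (E j).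
Hypothesis E0 : forall j om, (0 < E j om)%E.
Hypothesis condE : forall i (B : nat -> set R) (s : R),
  (forall j, measurable (B j)) -> 0 <= s ->
  P ([set om | forall j, (j < i)%N -> E j om \in EFin @` B j]
       `&` [set om | (s%:E < E i om)%E])
  = (\int[P]_(om in [set om | forall j, (j < i)%N -> E j om \in EFin @` B j])
       (srv (fun j => fine (E j om)) i s)%:E)%E.

(** A rectangle in the first [l] waiting times, the form of event on which [condE] gives the
    conditional law. *)
Definition past (y : nat -> nat) (l : nat) : set Omega :=
  [set om | forall j, (j < l)%N -> E j om \in EFin @` index_cell (y j) (y j.+1)].

Definition tail (y : nat -> nat) (l : nat) (s : R) : set Omega :=
  past y l `&` [set om | (s%:E < E l om)%E].

Variables (y : nat -> nat) (D : nat).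
Hypothesis y0 : (0 < y 0)%N.
Hypothesis y_nd : forall j, (j < D)%N -> (y j <= y j.+1)%N.

Lemma measurable_past z l : measurable (past z l).
Proof.
elim: l => [|l IH].
  by rewrite (_ : past z 0 = setT)//; apply/seteqP; split=> om.
rewrite (_ : past z l.+1 = past z l `&` (E l @^-1` (EFin @` index_cell (z l) (z l.+1)))).
  apply: measurableI => //; rewrite -[X in measurable X]setTI; apply: mE => //.
  by apply: measurable_image_EFin; exact: measurable_itv.
apply/seteqP; split=> om /=.
  move=> ho; split=> [j jl|]; first by apply: ho; exact: ltnW.
  by have := ho l (ltnSn _); rewrite inE.
by move=> [ho hl] j; rewrite ltnS leq_eqVlt => /predU1P[->|/ho//]; rewrite inE.
Qed.

Lemma measurable_tail z l s : measurable (tail z l s).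
Proof.
apply: (@emeasurable_fun_o_infty _ _ _ _ (E l)); first exact: measurable_past.
by apply: measurable_funTS; exact: mE.
Qed.

Lemma y_mono i j : (i <= j)%N -> (j <= D)%N -> (y i <= y j)%N.
Proof.
elim: j => [|j IH]; first by rewrite leqn0 => /eqP ->.
rewrite leq_eqVlt => /predU1P[->//|]; rewrite ltnS => ij jD.
by apply: leq_trans (IH ij (ltnW jD)) (y_nd jD).
Qed.

Lemma y_gt0 j : (j <= D)%N -> (0 < y j)%N.
Proof. by move=> jD; apply: leq_trans (y_mono (leq0n j) jD). Qed.

Let yR0 j : (j <= D)%N -> 0 < (y j)%:R :> R.
Proof. by move=> jD; rewrite ltr0n y_gt0. Qed.

Let eps : R := D%:R / (y 0)%:R.

Let tau (l j : nat) : R := ln ((y l)%:R / (y j)%:R).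

Let eps0 : 0 <= eps. Proof. by rewrite divr_ge0. Qed.

Let tau0 l j : (j <= l)%N -> (l <= D)%N -> 0 <= tau l j.
Proof. by move=> jl lD; exact/ln_ratio_ge0/y_mono. Qed.

Lemma past_ge0 l om q : past y l om -> (q < l)%N -> 0 <= fine (E q om).
Proof. by move=> _ _; rewrite fine_ge0// ltW. Qed.

(** A waiting time exceeds the left end of its cell by at most the cell width, itself at most
    [1 / y 0]; at most [D] such errors accumulate, whence [eps = D / y 0]. *)
Lemma past_sig l om j : (l <= D)%N -> past y l om -> (j <= l)%N ->
  tau l j <= sig (fun q => fine (E q om)) l - sig (fun q => fine (E q om)) j <= tau l j + eps.
Proof.
move=> lD po; set e := fun q => fine (E q om) => jl.
have key : tau l j <= sig e l - sig e j <= tau l j + (l - j)%:R / (y 0)%:R.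
  elim: l lD po jl => [|l IH] lD po.
    rewrite leqn0 => /eqP ->; rewrite /tau subrr subnn mul0r addr0.
    by rewrite divff ?ln1 ?lexx// lt0r_neq0// yR0.
  rewrite leq_eqVlt => /predU1P[->|].
    by rewrite /tau subrr subnn mul0r addr0 divff ?ln1 ?lexx// lt0r_neq0// yR0.
  rewrite ltnS => jl.
  have {}IH := IH (ltnW lD) (fun q ql => po q (ltnW ql)) jl.
  have sS : sig e l.+1 = sig e l + e l by rewrite /sig big_ord_recr.
  have /set_mem[r /= + rE] := po l (ltnSn _).
  rewrite /index_cell /= in_itv /= => /andP[r1 r2].
  have er : e l = r by rewrite /e -rE.
  have tS : tau l.+1 j = ln ((y l.+1)%:R / (y l)%:R) + tau l j.
    have yj := yR0 (leq_trans jl (ltnW lD)).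
    by rewrite /tau ln_ratioD// yR0// ltnW.
  have y1 := yR0 lD; have yl := yR0 (ltnW lD).
  have up : ln ((y l.+1).+1%:R / (y l)%:R) <= ln ((y l.+1)%:R / (y l)%:R) + (y 0)%:R^-1 :> R.
    rewrite -(ln_ratioD yl y1) ?ltr0n// addrC lerD2l.
    apply: le_trans (ln_le_sub1 _) _; first by rewrite divr_gt0.
    rewrite -natr1 mulrDl divff ?lt0r_neq0// addrAC subrr add0r mul1r.
    by rewrite lef_pV2 ?posrE ?yR0// ler_nat y_mono.
  rewrite subSn// -natr1 mulrDl mul1r sS er tS.
  move: IH => /andP[i1 i2]; apply/andP; split; first lra.
  have e0 : 0 <= (y 0)%:R^-1 :> R by rewrite invr_ge0.
  by lra.
have /andP[-> /= k2] := key; apply: le_trans k2 _.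
rewrite lerD2l ler_wpM2r ?invr_ge0// ler_nat; lia.
Qed.

Let theta l (dl : R) (j : nat) := tau l j + dl.

Lemma survival_bounds l om s : (l <= D)%N -> past y l om -> 0 <= s ->
  expR (- CH l (theta l eps) s) <=
  srv (fun q => fine (E q om)) l s <= expR (- CH l (theta l 0) s).
Proof.
move=> lD po s0; rewrite srvE//; last by move=> q ql; exact: past_ge0 po ql.
rewrite !ler_expR !lerN2; apply/andP; split; apply: (cumulative_hazard_le h_nd hH) => // j jl.
  have /andP[k1 ->] := past_sig lD po jl; rewrite andbT.
  exact: le_trans (tau0 jl lD) k1.
by rewrite /theta addr0 tau0//=; have /andP[] := past_sig lD po jl.
Qed.

Lemma survivalB_bounds l om a b : (l <= D)%N -> past y l om -> 0 <= a -> a <= b ->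
  expR (- CH l (theta l eps) a) * (1 - expR (- (CH l (theta l 0) b - CH l (theta l 0) a))) <=
  srv (fun q => fine (E q om)) l a -
  srv (fun q => fine (E q om)) l b <=
  expR (- CH l (theta l 0) a) * (1 - expR (- (CH l (theta l eps) b - CH l (theta l eps) a))).
Proof.
move=> lD po a0 ab; have b0 := le_trans a0 ab.
have /andP[s1 s2] := survival_bounds lD po a0; move: s1 s2.
have e0 q : (q < l)%N -> 0 <= fine (E q om) by move=> ql; exact: past_ge0 po ql.
rewrite !srvE//; set e := fun q => fine (E q om).
set th := fun j => sig e l - sig e j => s1 s2.
have th0 j : (j <= l)%N -> 0 <= theta l 0 j <= th j.
  by move=> jl; rewrite /theta addr0 tau0//=; have /andP[] := past_sig lD po jl.
have th1 j : (j <= l)%N -> 0 <= th j <= theta l eps j.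
  move=> jl; have /andP[k1 ->] := past_sig lD po jl; rewrite andbT.
  exact: le_trans (tau0 jl lD) k1.
have w1 := cumulative_hazardB_le h_nd hH alpha0 a0 ab th0.
have w2 := cumulative_hazardB_le h_nd hH alpha0 a0 ab th1.
have w0 : 0 <= CH l (theta l 0) b - CH l (theta l 0) a.
  by apply: cumulative_hazardB_ge0 => // j jl; have /andP[] := th0 j jl.
have -> : expR (- CH l th a) - expR (- CH l th b) =
    expR (- CH l th a) * (1 - expR (- (CH l th b - CH l th a))).
  by rewrite mulrBr mulr1 -expRD; congr (_ - expR _); ring.
move: (CH l th a) (CH l th b) (CH l (theta l 0) a) (CH l (theta l 0) b)
  (CH l (theta l eps) a) (CH l (theta l eps) b) w0 w1 w2 s1 s2.
by move=> A B A0 B0 A1 B1 w0 w1 w2 s1 s2; exact: expR_increment_bounds.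
Qed.

Let surv l s om : R := srv (fun q => fine (E q om)) l s.

Lemma measurable_survival l s : (l <= D)%N -> 0 <= s ->
  measurable_fun (past y l) (fun om => (surv l s om)%:E).
Proof.
move=> lD s0; apply/measurable_EFinP.
apply: (@eq_measurable_fun _ _ _ _ _ (fun om => expR (- CH l
    (fun j => sig (fun q => fine (E q om)) l - sig (fun q => fine (E q om)) j) s))).
  move=> om /set_mem po; rewrite /surv srvE// => q ql; exact: past_ge0 po ql.
apply: measurable_funTS; apply: measurableT_comp => //; apply: measurableT_comp => //.
have mH : measurable_fun setT H by exact: nondecreasing_measurable.
have msig i : measurable_fun setT (fun om => sig (fun q => fine (E q om)) i).
  apply: measurable_sum => q; apply: (measurableT_comp _ (mE q)).
  exact: fine_measurable.
apply: measurable_sum => j; apply: measurable_funM => //.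
apply: measurable_funB; apply: (measurableT_comp mH).
  by apply: measurable_funD => //; exact: measurable_funB.
exact: measurable_funB.
Qed.

Let Pr (A : set Omega) : R := fine (P A).

Let PrE A : measurable A -> P A = (Pr A)%:E.
Proof. by move=> mA; rewrite fineK// fin_num_measure. Qed.

Lemma tail_int l s : 0 <= s ->
  P (tail y l s) = (\int[P]_(om in past y l) (surv l s om)%:E)%E.
Proof.
move=> s0; apply: (@condE l (fun j => index_cell (y j) (y j.+1)) s) => // j.
exact: measurable_itv.
Qed.

Lemma surv_ge0 l s om : 0 <= s -> past y l om -> (0 <= (surv l s om)%:E)%E.
Proof.
move=> s0 po; rewrite lee_fin /surv srvE ?expR_ge0// => q ql; exact: past_ge0 po ql.
Qed.

Lemma tail_between l s clo chi : (l <= D)%N -> 0 <= s -> 0 <= clo -> 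
  (forall om, past y l om -> clo <= surv l s om <= chi) ->
  clo * Pr (past y l) <= Pr (tail y l s) <= chi * Pr (past y l).
Proof.
move=> lD s0 clo0 cc; have mp := measurable_past y l; have mt := measurable_tail y l s.
rewrite -!lee_fin !EFinM -!PrE// tail_int// -!integral_cst//.
have ms := measurable_survival lD s0.
apply/andP; split; apply: ge0_le_integral => //.
- by move=> om po; rewrite lee_fin; have /andP[] := cc _ po.
- by move=> om po; exact: surv_ge0.
- by move=> om po; rewrite lee_fin; have /andP[] := cc _ po.
Qed.

Lemma tail_bounds l s : (l <= D)%N -> 0 <= s ->
  expR (- CH l (theta l eps) s) * Pr (past y l) <= Pr (tail y l s) <=
  expR (- CH l (theta l 0) s) * Pr (past y l).
Proof.
move=> lD s0; have c0 := expR_ge0 (- CH l (theta l eps) s).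
by apply: tail_between => // om po; exact: survival_bounds.
Qed.

Let ca l : R := ln ((y l.+1)%:R / (y l)%:R).
Let cb l : R := ln ((y l.+1).+1%:R / (y l)%:R).

Lemma ca_ge0 l : (l < D)%N -> 0 <= ca l.
Proof. by move=> lD; apply: ln_ratio_ge0; exact: y_nd. Qed.

Lemma ca_le_cb l : (l < D)%N -> ca l <= cb l.
Proof.
move=> lD; have yl := yR0 (ltnW lD); have yl1 := yR0 lD.
by rewrite ler_ln ?posrE ?divr_gt0// ler_pM2r ?invr_gt0// ler_nat.
Qed.

Lemma past_tail l : (l < D)%N ->
  Pr (past y l.+1) = Pr (tail y l (ca l)) - Pr (tail y l (cb l)).
Proof.
move=> lD.
have sub : tail y l (cb l) `<=` tail y l (ca l).
  move=> om [po /= lt]; split=> //=; apply: le_lt_trans lt.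
  by rewrite lee_fin ca_le_cb.
have -> : past y l.+1 = tail y l (ca l) `\` tail y l (cb l).
  apply/seteqP; split=> om.
    move=> po; have /set_mem[r /= + rE] := po l (ltnSn _).
    rewrite /index_cell /= in_itv /= => /andP[r1 r2].
    split; first by split=> [j jl|/=]; [apply: po; exact: ltnW|rewrite -rE lte_fin].
    by move=> [_ /=]; rewrite -rE lte_fin ltNge r2.
  move=> [[po /= lo] nhi] j; rewrite ltnS leq_eqVlt => /predU1P[->|]; last exact: po.
  have {}nhi : (E l om <= (cb l)%:E)%E by rewrite leNgt; apply/negP => k; apply: nhi.
  have fE : E l om \is a fin_num.
    by rewrite fin_numE gt_eqF ?lt_eqF ?(le_lt_trans nhi) ?ltry// (lt_trans _ lo) ?ltNyr.
  rewrite inE; exists (fine (E l om)); last by rewrite fineK.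
  by rewrite /index_cell /= in_itv /= -lte_fin -lee_fin fineK// lo.
have m1 := measurable_tail y l (ca l); have m2 := measurable_tail y l (cb l).
apply: EFin_inj; rewrite -PrE; last exact: measurableD.
rewrite measureD//; last by rewrite -ge0_fin_numE// fin_num_measure.
by rewrite (setIidr sub) EFinB -!PrE.
Qed.

(** The next cell is a difference of two tails. The subtracted tail is moved across each inequality,
    so that only nonnegative integrands are added and compared. *)
Lemma past_between l clo chi : (l < D)%N -> 0 <= clo -> 0 <= chi ->
  (forall om, past y l om -> clo <= surv l (ca l) om - surv l (cb l) om <= chi) ->
  clo * Pr (past y l) <= Pr (past y l.+1) <= chi * Pr (past y l).
Proof.
move=> lD clo0 chi0 cc; rewrite past_tail// lerBrDr lerBlDr.
have mp := measurable_past y l; have lD' := ltnW lD.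
have a0 := ca_ge0 lD; have ab := ca_le_cb lD; have b0 := le_trans a0 ab.
have ma := measurable_tail y l (ca l); have mb := measurable_tail y l (cb l).
have msa := measurable_survival lD' a0; have msb := measurable_survival lD' b0.
have sa := surv_ge0 a0; have sb := surv_ge0 b0.
move: (ca l) (cb l) cc a0 ab b0 ma mb msa msb sa sb => a b cc a0 ab b0 ma mb msa msb sa sb.
rewrite -!lee_fin !EFinD !EFinM -!PrE// !tail_int// -!integral_cst//.
rewrite -!ge0_integralD//; try by move=> om po; exact: sb.
apply/andP; split; apply: ge0_le_integral => //.
- by move=> om po; apply: adde_ge0; [rewrite lee_fin|exact: sb].
- exact: emeasurable_funD.
- move=> om po; rewrite -EFinD lee_fin -lerBrDr.
  by have /andP[] := cc _ po.
- by move=> om po; exact: sa.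
- exact: emeasurable_funD.
- move=> om po; rewrite -EFinD lee_fin -lerBlDr.
  by have /andP[] := cc _ po.
Qed.

Lemma past_step l : (l < D)%N ->
  expR (- CH l (theta l eps) (ca l)) *
    (1 - expR (- (CH l (theta l 0) (cb l) - CH l (theta l 0) (ca l)))) * Pr (past y l) <=
  Pr (past y l.+1) <=
  expR (- CH l (theta l 0) (ca l)) *
    (1 - expR (- (CH l (theta l eps) (cb l) - CH l (theta l eps) (ca l)))) * Pr (past y l).
Proof.
move=> lD; have a0 := ca_ge0 lD; have ab := ca_le_cb lD; have lD' := ltnW lD.
have w0 (th : nat -> R) : (forall j, (j <= l)%N -> 0 <= th j) ->
    0 <= 1 - expR (- (CH l th (cb l) - CH l th (ca l))).
  by move=> th0; rewrite one_sub_expR_ge0// (cumulative_hazardB_ge0 h_ge0 hH).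
apply: past_between => //.
- by apply: mulr_ge0; [exact: expR_ge0|apply: w0 => j jl; rewrite /theta addr0 tau0].
- by apply: mulr_ge0; [exact: expR_ge0|apply: w0 => j jl; rewrite /theta addr_ge0// tau0].
- by move=> om po; exact: survivalB_bounds.
Qed.

End individual.

(** * Limit law of the birth positions of one individual *)

Section individual_limit.
Context {R : realType}.
Variables (h H : R -> R) (alpha : R).
Hypothesis h_nd : {homo h : x y / x <= y}.
Hypothesis h_ge0 : forall x, 0 <= h x.
Hypothesis hH : primitive_of h H.
Hypothesis H0 : H 0 = 0.
Hypothesis H_nd : {homo H : x y / x <= y}.
Hypothesis alpha0 : 0 <= alpha.

Notation CH := (cumulative_hazard H alpha).

Definition log_gap (y : nat -> nat) (l : nat) (dl : R) (j : nat) : R :=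
  ln ((y l)%:R / (y j)%:R) + dl.

Definition cell_start (y : nat -> nat) l : R := ln ((y l.+1)%:R / (y l)%:R).
Definition cell_end (y : nat -> nat) l : R := ln ((y l.+1).+1%:R / (y l)%:R).

(** Conditional probability of one cell when the past gaps are shifted by [dl] in the survival
    factor and by [dl'] in the increment: [(eps, 0)] yields the lower bound and [(0, eps)] the upper
    one. *)
Definition step_factor (y : nat -> nat) (l : nat) (dl dl' : R) : R :=
  expR (- CH l (log_gap y l dl) (cell_start y l)) *
  (1 - expR (- (CH l (log_gap y l dl') (cell_end y l) -
                CH l (log_gap y l dl') (cell_start y l)))).

Section bounds.
Variables (y : nat -> nat) (D : nat).
Hypothesis y0 : (0 < y 0)%N.
Hypothesis y_nd : forall j, (j < D)%N -> (y j <= y j.+1)%N.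

Lemma cell_start_ge0 l : (l < D)%N -> 0 <= cell_start y l.
Proof. by move=> lD; apply: ln_ratio_ge0; exact: y_nd. Qed.

Lemma cell_start_le_end l : (l < D)%N -> cell_start y l <= cell_end y l.
Proof.
move=> lD; have yl := y_gt0 y0 y_nd (ltnW lD); have yl1 := y_gt0 y0 y_nd lD.
by rewrite ler_ln ?posrE ?divr_gt0 ?ltr0n// ler_pM2r ?invr_gt0 ?ltr0n// ler_nat.
Qed.

Lemma log_gap_ge0 l dl j : (j <= l)%N -> (l <= D)%N -> 0 <= dl -> 0 <= log_gap y l dl j.
Proof. by move=> jl lD dl0; rewrite addr_ge0// ln_ratio_ge0// (y_mono y_nd). Qed.

Lemma step_factor_ge0 l dl dl' : (l < D)%N -> 0 <= dl' -> 0 <= step_factor y l dl dl'.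
Proof.
move=> lD dl0; rewrite mulr_ge0 ?expR_ge0// one_sub_expR_ge0//.
apply: (cumulative_hazardB_ge0 h_ge0 hH) => //.
- exact: cell_start_ge0.
- exact: cell_start_le_end.
- by move=> j jl; apply: log_gap_ge0 => //; exact: ltnW.
Qed.

(** The survival factor is at most one and [1 - exp (- W) <= W]. Here [W] is at most the cell width,
    bounded by [1 / y 0], times hazards at logarithmic gaps not exceeding [ln (n / y 0) + D]. *)
Lemma step_factor_le l dl (n : nat) : (l < D)%N -> 0 <= dl -> dl <= D%:R ->
  (forall j, (j <= D)%N -> (y j < n)%N) ->
  step_factor y l 0 dl <=
  (1 + alpha + D%:R) * h (ln (n%:R / (y 0)%:R) + D%:R) / (y 0)%:R.
Proof.
move=> lD dl0 dlD yn; have a0 := cell_start_ge0 lD; have ab := cell_start_le_end lD.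
have yp j : (j <= D)%N -> 0 < (y j)%:R :> R by move=> jD; rewrite ltr0n (y_gt0 y0 y_nd).
have th0 j : (j <= l)%N -> 0 <= log_gap y l dl j.
  by move=> jl; apply: log_gap_ge0 => //; exact: ltnW.
have th00 j : (j <= l)%N -> 0 <= log_gap y l 0 j.
  by move=> jl; apply: log_gap_ge0 => //; exact: ltnW.
have w0 := cumulative_hazardB_ge0 h_ge0 hH alpha0 a0 ab th0.
have /andP[_ wb] := cumulative_hazardB_bound hH alpha0 a0 ab th0.
have c0 := cumulative_hazard_ge0 h_ge0 hH alpha0 a0 th00.
rewrite /step_factor.
set W := CH l _ (cell_end _ _) - _ in w0 wb *.
apply: (@le_trans _ _ (1 * W)).
  apply: ler_pM; rewrite ?expR_ge0 ?one_sub_expR_ge0//.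
    by rewrite -[leRHS]expR0 ler_expR oppr_le0.
  by have := expR_ge1Dx (- W); lra.
rewrite mul1r; apply: le_trans wb _.
have b1 : cell_end y l - cell_start y l <= (y 0)%:R^-1.
  have yl := yp _ (ltnW lD); have yl1 := yp _ lD.
  rewrite /cell_end /cell_start -(ln_ratioD yl yl1) ?ltr0n// addrK.
  apply: le_trans (ln_le_sub1 _) _; first by rewrite divr_gt0.
  rewrite -natr1 mulrDl divff ?lt0r_neq0// addrAC subrr add0r mul1r.
  by rewrite lef_pV2 ?posrE ?yp// ler_nat (y_mono y_nd).
have b0 : 0 <= cell_end y l - cell_start y l by rewrite subr_ge0.
apply: (@le_trans _ _ (\sum_(j < l.+1) coef alpha j *
    (h (ln (n%:R / (y 0)%:R) + D%:R) / (y 0)%:R))).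
  apply: ler_sum => j _; rewrite -mulrA ler_wpM2l ?coef_ge0//.
  apply: ler_pM => //; apply: h_nd.
  have jl : (j <= l)%N by rewrite -ltnS.
  have jD := leq_trans jl (ltnW lD).
  have yj := yp _ jD; have yl := yp _ (ltnW lD); have yl1 := yp _ lD.
  rewrite /log_gap addrA lerD// /cell_end ln_ratioD// ?ltr0n//.
  rewrite ler_ln ?posrE ?divr_gt0 ?yp// ?ltr0n//; last exact: leq_ltn_trans (yn 0%N _).
  have y00 := yp 0%N isT.
  apply: ler_pM; rewrite ?invr_ge0//; first by rewrite ler_nat yn.
  by rewrite lef_pV2 ?posrE// ler_nat (y_mono y_nd).
rewrite -mulr_suml -!mulrA ler_wpM2r//; first by rewrite divr_ge0.
rewrite big_ord_recl /= lerD2l sumr_const card_ord ler_nat; exact: ltnW.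
Qed.

Context (d : measure_display) (Omega : measurableType d) (P : probability Omega R).
Variable srv : (nat -> R) -> nat -> R -> R.
Hypothesis srvE : forall e i s, (forall q, (q < i)%N -> 0 <= e q) -> 0 <= s ->
  srv e i s = expR (- CH i (fun j => sig e i - sig e j) s).
Variable E : nat -> Omega -> \bar R.
Hypothesis mE : forall j, measurable_fun setT (E j).
Hypothesis E0 : forall j om, (0 < E j om)%E.
Hypothesis condE : forall i (B : nat -> set R) (s : R),
  (forall j, measurable (B j)) -> 0 <= s ->
  P ([set om | forall j, (j < i)%N -> E j om \in EFin @` B j]
       `&` [set om | (s%:E < E i om)%E])
  = (\int[P]_(om in [set om | forall j, (j < i)%N -> E j om \in EFin @` B j])
       (srv (fun j => fine (E j om)) i s)%:E)%E.

Lemma tail_product_bounds s : 0 <= s ->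
  (\prod_(l < D) step_factor y l (D%:R / (y 0)%:R) 0) *
    expR (- CH D (log_gap y D (D%:R / (y 0)%:R)) s) <=
  fine (P (tail E y D s)) <=
  (\prod_(l < D) step_factor y l 0 (D%:R / (y 0)%:R)) * expR (- CH D (log_gap y D 0) s).
Proof.
move=> s0; have e0 : 0 <= D%:R / (y 0)%:R :> R by rewrite divr_ge0.
have key l : (l <= D)%N ->
    (\prod_(i < l) step_factor y i (D%:R / (y 0)%:R) 0) <= fine (P (past E y l)) <=
    (\prod_(i < l) step_factor y i 0 (D%:R / (y 0)%:R)).
  elim: l => [_|l IH lD].
    rewrite !big_ord0 (_ : past E y 0 = setT) ?probability_setT ?lexx//.
    by apply/seteqP; split.
  have /andP[i1 i2] := IH (ltnW lD).
  have := past_step h_nd h_ge0 hH H_nd alpha0 srvE mE E0 condE y0 y_nd lD.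
  rewrite !big_ord_recr /= => /andP[s1 s2]; apply/andP; split.
    by apply: le_trans s1; rewrite mulrC ler_wpM2l// step_factor_ge0.
  by apply: le_trans s2 _; rewrite [leRHS]mulrC ler_wpM2l// step_factor_ge0.
have /andP[k1 k2] := key _ (leqnn D).
have /andP[t1 t2] := tail_bounds h_nd hH H_nd alpha0 srvE mE E0 condE y0 y_nd (leqnn D) s0.
apply/andP; split.
  by apply: le_trans t1; rewrite mulrC ler_wpM2l ?expR_ge0.
by apply: le_trans t2 _; rewrite [leRHS]mulrC ler_wpM2l ?expR_ge0.
Qed.

(** Serves as the domination for the non-root coordinates: of order [n ^- D] when [y 0] is of order
    [n]. *)
Lemma tail_le (n : nat) : (forall j, (j <= D)%N -> (y j < n)%N) ->
  fine (P (tail E y D (ln (n%:R / (y D)%:R)))) <=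
  ((1 + alpha + D%:R) * h (ln (n%:R / (y 0)%:R) + D%:R) / (y 0)%:R) ^+ D.
Proof.
move=> yn; have s0 : 0 <= ln (n%:R / (y D)%:R) :> R.
  by apply: ln_ratio_ge0; apply: ltnW; exact: yn.
have e0 : 0 <= D%:R / (y 0)%:R :> R by rewrite divr_ge0.
have e1 : D%:R / (y 0)%:R <= D%:R :> R.
  by rewrite ler_pdivrMr ?ltr0n// ler_peMr// ler1n.
have /andP[_ b] := tail_product_bounds s0; apply: le_trans b _.
have c0 : 0 <= CH D (log_gap y D 0) (ln (n%:R / (y D)%:R)).
  by apply: (cumulative_hazard_ge0 h_ge0 hH) => // j jD; exact: log_gap_ge0.
have p0 : 0 <= \prod_(l < D) step_factor y l 0 (D%:R / (y 0)%:R).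
  by apply: prodr_ge0 => l _; exact: step_factor_ge0.
apply: (@le_trans _ _ (\prod_(l < D) step_factor y l 0 (D%:R / (y 0)%:R))).
  by rewrite ler_piMr// -[leRHS]expR0 ler_expR oppr_le0.
rewrite -[X in _ ^+ X]card_ord -prodr_const; apply: ler_prod => l _.
by rewrite step_factor_ge0//= step_factor_le.
Qed.

End bounds.

Section limits.
Variables (y : nat -> nat -> nat) (x : nat -> R) (D : nat).
Hypothesis yx : forall j, (j <= D)%N -> scales (y ^~ j) (x j).
Hypothesis x0 : 0 < x 0.
Hypothesis x_lt : forall j, (j < D)%N -> x j < x j.+1.
Hypothesis x1 : x D < 1.
Hypothesis x_jump : forall j l, (j < l)%N -> (l <= D)%N -> small_jump h (ln (x l / x j)).

Lemma x_mono i j : (i < j)%N -> (j <= D)%N -> x i < x j.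
Proof.
elim: j => // j IH; rewrite ltnS leq_eqVlt => /predU1P[->|ij] jD; first exact: x_lt.
by apply: lt_trans (x_lt jD); apply: IH => //; exact: ltnW.
Qed.

Lemma x_gt0 j : (j <= D)%N -> 0 < x j.
Proof. by case: j => // j jD; apply: lt_trans x0 (x_mono _ jD). Qed.

Lemma log_ratio_limit_ge0 i j : (i <= j)%N -> (j <= D)%N -> 0 <= ln (x j / x i).
Proof.
move=> ij jD; have xi := x_gt0 (leq_trans ij jD).
rewrite ln_ge0// ler_pdivlMr// mul1r.
by move: ij; rewrite leq_eqVlt => /predU1P[->//|ij]; exact/ltW/x_mono.
Qed.

Lemma eventually_ordered : \forall n \near \oo,
  (0 < y n 0)%N /\ (forall j, (j < D)%N -> (y n j <= y n j.+1)%N) /\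
  (forall j, (j <= D)%N -> (y n j < n)%N).
Proof.
have h1 : \forall n \near \oo, forall j, j \in iota 0 D -> (y n j <= y n j.+1)%N.
  apply: eventually_all => j; rewrite mem_iota add0n => jD; near=> n; apply: ltnW; near: n.
  exact: scales_ltn (yx (ltnW jD)) (yx jD) (x_lt jD).
have h2 : \forall n \near \oo, forall j, j \in iota 0 D.+1 -> (y n j < n)%N.
  apply: eventually_all => j; rewrite mem_iota add0n ltnS => jD.
  apply: scales_ltn (yx jD) scales_n _.
  have [jD'|jD'|->] := ltngtP j D; [exact: lt_trans (x_mono jD' _) x1|lia|exact: x1].
near=> n; split; first by near: n; exact: (scales_ge 1 (yx (leq0n D))).
split=> j jD.
  have /(_ j) : forall j, j \in iota 0 D -> (y n j <= y n j.+1)%N by near: n.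
  by rewrite mem_iota; exact.
have /(_ j) : forall j, j \in iota 0 D.+1 -> (y n j < n)%N by near: n.
by rewrite mem_iota ltnS; exact.
Unshelve. all: by end_near.
Qed.

Variables (dl dl' : nat -> R).
Hypothesis dl_ge0 : forall n, 0 <= dl n.
Hypothesis dl_cvg : dl n @[n --> \oo] --> 0.
Hypothesis dl'_ge0 : forall n, 0 <= dl' n.
Hypothesis dl'_cvg : dl' n @[n --> \oo] --> 0.

Lemma log_gap_cvg l j : (j <= l)%N -> (l <= D)%N ->
  log_gap (y n) l (dl n) j @[n --> \oo] --> ln (x l / x j).
Proof.
move=> jl lD; apply: (cvg_eqr (addr0 _)); apply: cvgD => //.
by apply: scales_ln; [exact: yx (leq_trans jl lD)|exact: yx|exact: x_gt0 (leq_trans jl lD)|exact: x_gt0].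
Qed.

Lemma log_gap_eventually_ge0 l j : (j <= l)%N -> (l <= D)%N ->
  \forall n \near \oo, 0 <= log_gap (y n) l (dl n) j.
Proof.
move=> jl lD; near=> n.
have [q1 [q2 q3]] : (0 < y n 0)%N /\ (forall j, (j < D)%N -> (y n j <= y n j.+1)%N) /\
  (forall j, (j <= D)%N -> (y n j < n)%N) by near: n; exact: eventually_ordered.
by rewrite /log_gap addr_ge0// ln_ratio_ge0// (y_mono q2).
Unshelve. all: by end_near.
Qed.

Lemma CH_cvg l (s : nat -> R) (z : R) : (l <= D)%N ->
  (\forall n \near \oo, 0 <= s n) -> 0 <= z -> s n @[n --> \oo] --> z ->
  CH l (log_gap (y n) l (dl n)) (s n) @[n --> \oo] -->
  \sum_(j < l.+1) coef alpha j * (H (z + ln (x l / x j)) - H (ln (x l / x j))).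
Proof.
move=> lD s0 z0 sz; apply: cvg_sum_seq => j _; apply: cvgM; first exact: cvg_cst.
have jl : (j <= l)%N by rewrite -ltnS.
have t0 := log_ratio_limit_ge0 jl lD; have tc := log_gap_cvg jl lD.
have te := log_gap_eventually_ge0 jl lD.
apply: cvgB; last exact: (primitive_cvg h_nd h_ge0 hH).
apply: (primitive_cvg h_nd h_ge0 hH); first by rewrite addr_ge0.
  by near=> n; rewrite addr_ge0//; near: n.
exact: cvgD.
Unshelve. all: by end_near.
Qed.

(** From [1 - 1 / r <= ln r <= r - 1] at the ratio [r = (y + 1) / y] of the two ends of the cell. *)
Lemma cell_width_cvg l : (l < D)%N ->
  n%:R * (cell_end (y n) l - cell_start (y n) l) @[n --> \oo] --> (x l.+1)^-1.
Proof.
move=> lD; have xl := x_gt0 lD; have sy := yx lD.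
apply: (@squeeze_cvgr _ _ _ _ (fun n => n%:R / (y n l.+1).+1%:R) (fun n => n%:R / (y n l.+1)%:R)).
- near=> n.
  have yl1 : 0 < (y n l.+1)%:R :> R.
    by rewrite ltr0n; near: n; exact: (scales_ge 1 sy).
  have yl : 0 < (y n l)%:R :> R.
    by rewrite ltr0n; near: n; exact: (scales_ge 1 (yx (ltnW lD)) (x_gt0 (ltnW lD))).
  have r0 : 0 < (y n l.+1).+1%:R / (y n l.+1)%:R :> R by rewrite divr_gt0.
  rewrite /cell_end /cell_start -(ln_ratioD yl yl1) ?ltr0n// addrK.
  apply/andP; split; apply: ler_wpM2l => //.
    apply: le_trans (ln_ge_sub1V r0); rewrite invf_div.
    rewrite -[X in X - _](@divff _ (y n l.+1).+1%:R) ?pnatr_eq0// -mulrBl -natr1.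
    by rewrite addrAC subrr add0r mul1r.
  apply: le_trans (ln_le_sub1 r0) _.
  by rewrite -natr1 mulrDl divff ?lt0r_neq0// addrAC subrr add0r mul1r.
- exact: scales_inv (scalesS sy) xl.
- exact: scales_inv sy xl.
Unshelve. all: by end_near.
Qed.

End limits.

Section step_limits.
Variables (y : nat -> nat -> nat) (x : nat -> R) (D : nat).
Hypothesis yx : forall j, (j <= D)%N -> scales (y ^~ j) (x j).
Hypothesis x0 : 0 < x 0.
Hypothesis x_lt : forall j, (j < D)%N -> x j < x j.+1.
Hypothesis x1 : x D < 1.
Hypothesis x_jump : forall j l, (j < l)%N -> (l <= D)%N -> small_jump h (ln (x l / x j)).

Lemma CH_increment_cvg (dl : nat -> R) l : (forall n, 0 <= dl n) -> dl n @[n --> \oo] --> 0 -> (l < D)%N ->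
  n%:R * (CH l (log_gap (y n) l (dl n)) (cell_end (y n) l) -
    CH l (log_gap (y n) l (dl n)) (cell_start (y n) l)) @[n --> \oo] -->
  (\sum_(j < l.+1) coef alpha j * h (ln (x l.+1 / x j))) / x l.+1.
Proof.
move=> dl0 dlc lD; have lD' := ltnW lD.
have wc := cell_width_cvg yx x0 x_lt lD.
have xl := x_gt0 x0 x_lt lD'; have xl1 := x_gt0 x0 x_lt lD.
have hc (u : nat -> R) (j : nat) : (j < l.+1)%N ->
    u n @[n --> \oo] --> ln (x l.+1 / x l) ->
    h (u n + log_gap (y n) l (dl n) j) @[n --> \oo] --> h (ln (x l.+1 / x j)).
  move=> jl uc; have jl' : (j <= l)%N by [].
  have xj := x_gt0 x0 x_lt (leq_trans jl' lD').
  apply: (small_jump_cvg h_nd); first exact: x_jump.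
  rewrite -(ln_ratioD xj xl xl1); apply: cvgD => //.
  exact: (log_gap_cvg yx x0 x_lt dlc jl' lD').
have sc : cell_start (y n) l @[n --> \oo] --> ln (x l.+1 / x l).
  exact: scales_ln (yx lD') (yx lD) xl xl1.
have ec : cell_end (y n) l @[n --> \oo] --> ln (x l.+1 / x l).
  exact: scales_ln (yx lD') (scalesS (yx lD)) xl xl1.
have sumc (u : nat -> R) : u n @[n --> \oo] --> ln (x l.+1 / x l) ->
    \sum_(j < l.+1) coef alpha j * h (u n + log_gap (y n) l (dl n) j) *
      (n%:R * (cell_end (y n) l - cell_start (y n) l)) @[n --> \oo] -->
    (\sum_(j < l.+1) coef alpha j * h (ln (x l.+1 / x j))) / x l.+1.
  move=> uc; rewrite mulr_suml; apply: cvg_sum_seq => j _; apply: cvgM => //.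
  by apply: cvgM; [exact: cvg_cst|exact: hc].
apply: squeeze_cvgr (sumc _ sc) (sumc _ ec); near=> n.
have [q1 [q2 q3]] : (0 < y n 0)%N /\ (forall j, (j < D)%N -> (y n j <= y n j.+1)%N) /\
  (forall j, (j <= D)%N -> (y n j < n)%N) by near: n; exact: (eventually_ordered yx x0 x_lt x1).
have a0 := cell_start_ge0 q2 lD; have ab := cell_start_le_end q1 q2 lD.
have th0 j : (j <= l)%N -> 0 <= log_gap (y n) l (dl n) j.
  by move=> jl; apply: (log_gap_ge0 q2).
have /andP[b1 b2] := cumulative_hazardB_bound hH alpha0 a0 ab th0.
apply/andP; split.
  apply: le_trans (ler_wpM2l (ler0n _ n) b1); rewrite mulr_sumr ler_sum// => j _.
  by rewrite [leRHS]mulrCA.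
apply: le_trans (ler_wpM2l (ler0n _ n) b2) _; rewrite mulr_sumr ler_sum// => j _.
by rewrite [leLHS]mulrCA.
Unshelve. all: by end_near.
Qed.

Lemma step_factor_cvg (dl dl' : nat -> R) l : (forall n, 0 <= dl n) -> dl n @[n --> \oo] --> 0 ->
  (forall n, 0 <= dl' n) -> dl' n @[n --> \oo] --> 0 -> (l < D)%N ->
  n%:R * step_factor (y n) l (dl n) (dl' n) @[n --> \oo] -->
  expR (- \sum_(j < l.+1) coef alpha j * (H (ln (x l.+1 / x j)) - H (ln (x l / x j)))) *
  ((\sum_(j < l.+1) coef alpha j * h (ln (x l.+1 / x j))) / x l.+1).
Proof.
move=> dl0 dlc dl'0 dl'c lD; have lD' := ltnW lD.
have xl := x_gt0 x0 x_lt lD'; have xl1 := x_gt0 x0 x_lt lD.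
have sc : cell_start (y n) l @[n --> \oo] --> ln (x l.+1 / x l).
  exact: scales_ln (yx lD') (yx lD) xl xl1.
rewrite /step_factor; under eq_fun do rewrite mulrCA; apply: cvgM.
  apply: continuous_cvg; first exact: continuous_expR.
  apply: cvgN; have -> : \sum_(j < l.+1) coef alpha j * (H (ln (x l.+1 / x j)) - H (ln (x l / x j)))
    = \sum_(j < l.+1) coef alpha j * (H (ln (x l.+1 / x l) + ln (x l / x j)) - H (ln (x l / x j))).
    apply: eq_bigr => j _; rewrite ln_ratioD//.
    by apply: (x_gt0 x0 x_lt); apply: leq_trans lD'; rewrite -ltnS.
  apply: (CH_cvg yx x0 x_lt x1 dl0 dlc lD') => //.
    near=> n; have [q1 [q2 q3]] : (0 < y n 0)%N /\ (forall j, (j < D)%N -> (y n j <= y n j.+1)%N) /\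
      (forall j, (j <= D)%N -> (y n j < n)%N) by near: n; exact: (eventually_ordered yx x0 x_lt x1).
    exact: (cell_start_ge0 q2).
  exact: (log_ratio_limit_ge0 x0 x_lt).
pose W n := CH l (log_gap (y n) l (dl' n)) (cell_end (y n) l) -
   CH l (log_gap (y n) l (dl' n)) (cell_start (y n) l).
(* [W] is known to be nonnegative only for large [n]; the truncation agrees with it there and is
   nonnegative for every [n]. *)
pose W' n := Num.max (W n) 0.
have WW' : \forall n \near \oo, W n = W' n.
  near=> n.
  have [q1 [q2 q3]] : (0 < y n 0)%N /\ (forall j, (j < D)%N -> (y n j <= y n j.+1)%N) /\
    (forall j, (j <= D)%N -> (y n j < n)%N) by near: n; exact: (eventually_ordered yx x0 x_lt x1).
  have a0 := cell_start_ge0 q2 lD; have ab := cell_start_le_end q1 q2 lD.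
  have th0 j : (j <= l)%N -> 0 <= log_gap (y n) l (dl' n) j.
    by move=> jl; apply: (log_gap_ge0 q2).
  rewrite /W' max_l//; exact: (cumulative_hazardB_ge0 h_ge0 hH alpha0 a0 ab th0).
apply: (@near_eq_cvgr _ (fun n => n%:R * (1 - expR (- W' n)))).
  by near=> n; rewrite -(_ : W n = W' n)//; near: n.
apply: cvg_scaled_expR => [n|]; first by rewrite le_max lexx orbT.
apply: (@near_eq_cvgr _ (fun n => n%:R * W n)).
  by near=> n; rewrite -(_ : W n = W' n)//; near: n.
exact: CH_increment_cvg.
Unshelve. all: by end_near.
Qed.

Context (d : measure_display) (Omega : measurableType d) (P : probability Omega R).
Variable srv : (nat -> R) -> nat -> R -> R.
Hypothesis srvE : forall e i s, (forall q, (q < i)%N -> 0 <= e q) -> 0 <= s ->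
  srv e i s = expR (- CH i (fun j => sig e i - sig e j) s).
Variable E : nat -> Omega -> \bar R.
Hypothesis mE : forall j, measurable_fun setT (E j).
Hypothesis E0 : forall j om, (0 < E j om)%E.
Hypothesis condE : forall i (B : nat -> set R) (s : R),
  (forall j, measurable (B j)) -> 0 <= s ->
  P ([set om | forall j, (j < i)%N -> E j om \in EFin @` B j]
       `&` [set om | (s%:E < E i om)%E])
  = (\int[P]_(om in [set om | forall j, (j < i)%N -> E j om \in EFin @` B j])
       (srv (fun j => fine (E j om)) i s)%:E)%E.

Lemma tail_cvg :
  n%:R ^+ D * fine (P (tail E (y n) D (ln (n%:R / (y n D)%:R)))) @[n --> \oo] -->
  (\prod_(l < D) ((\sum_(j < l.+1) coef alpha j * h (ln (x l.+1 / x j))) / x l.+1)) *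
  expR (- \sum_(j < D.+1) coef alpha j * H (ln (x j)^-1)).
Proof.
pose eps n : R := D%:R / (y n 0)%:R.
have eps0 n : 0 <= eps n by rewrite divr_ge0.
have epsc : eps n @[n --> \oo] --> 0.
  apply: (@near_eq_cvgr _ (fun n => D%:R * (n%:R / (y n 0)%:R) * n%:R^-1)).
    near=> n; have n0 : n%:R != 0 :> R by rewrite pnatr_eq0 -lt0n; near: n; exists 1%N.
    have y0 : (y n 0)%:R != 0 :> R.
      by rewrite pnatr_eq0 -lt0n; near: n; exact: (scales_ge 1 (yx (leq0n D))).
    by rewrite /eps; field; rewrite n0 y0.
  apply: (cvg_eqr (mulr0 (D%:R * (x 0)^-1))); apply: cvgM; last exact: cvg_invn.
  by apply: cvgM; [exact: cvg_cst|exact: scales_inv (yx (leq0n D)) x0].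
have c0 : (fun=> 0 : R) n @[n --> \oo] --> 0 by exact: cvg_cst.
have c00 (n : nat) : 0 <= (fun=> 0 : R) n by [].
have xD := x_gt0 x0 x_lt (leqnn D).
have sc : ln (n%:R / (y n D)%:R) @[n --> \oo] --> ln (1 / x D).
  exact: scales_ln (yx (leqnn D)) scales_n xD ltr01.
have s_ge0 : \forall n \near \oo, 0 <= ln (n%:R / (y n D)%:R) :> R.
  near=> n; have [q1 [q2 q3]] : (0 < y n 0)%N /\ (forall j, (j < D)%N -> (y n j <= y n j.+1)%N) /\
    (forall j, (j <= D)%N -> (y n j < n)%N) by near: n; exact: (eventually_ordered yx x0 x_lt x1).
  by apply: ln_ratio_ge0; apply: ltnW; exact: q3.
have l1 : 0 <= ln (1 / x D) by rewrite ln_ge0// ler_pdivlMr// mul1r ltW.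
(* The exponents telescope: the increments seen from position [j] add up to [H (ln (x D / x j))],
   and the final survival factor completes this to [H (ln (1 / x j))]. *)
have limE : (\prod_(l < D) ((\sum_(j < l.+1) coef alpha j * h (ln (x l.+1 / x j))) / x l.+1)) *
    expR (- \sum_(j < D.+1) coef alpha j * H (ln (x j)^-1)) =
  (\prod_(l < D) (expR (- \sum_(j < l.+1) coef alpha j * (H (ln (x l.+1 / x j)) - H (ln (x l / x j)))) *
  ((\sum_(j < l.+1) coef alpha j * h (ln (x l.+1 / x j))) / x l.+1))) *
  expR (- \sum_(j < D.+1) coef alpha j * (H (ln (1 / x D) + ln (x D / x j)) - H (ln (x D / x j)))).
  rewrite [in RHS]big_split /= -expR_sum [RHS]mulrAC [LHS]mulrC; congr (_ * _).
  rewrite -expRD; congr expR; rewrite sumrN -opprD; congr (- _).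
  have tele l : (l <= D)%N ->
      \sum_(i < l) \sum_(j < i.+1) coef alpha j * (H (ln (x i.+1 / x j)) - H (ln (x i / x j))) =
      \sum_(j < l.+1) coef alpha j * H (ln (x l / x j)).
    elim: l => [_|l IH lD].
      by rewrite big_ord0 big_ord1 divff ?lt0r_neq0// ln1 H0 mulr0.
    rewrite big_ord_recr /= IH; last exact: ltnW.
    rewrite -big_split /= [RHS]big_ord_recr /= divff ?ln1 ?H0 ?mulr0 ?addr0; last first.
      by rewrite lt0r_neq0// (x_gt0 x0 x_lt).
    by apply: eq_bigr => j _; ring.
  rewrite tele// -big_split /=; apply: eq_bigr => j _.
  rewrite ln_ratioD// ?div1r; last by apply: (x_gt0 x0 x_lt); rewrite -ltnS.
  by ring.
rewrite limE.
have side (dl dl' : nat -> R) : (forall n, 0 <= dl n) -> dl n @[n --> \oo] --> 0 ->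
    (forall n, 0 <= dl' n) -> dl' n @[n --> \oo] --> 0 ->
    n%:R ^+ D * ((\prod_(l < D) step_factor (y n) l (dl n) (dl' n)) *
      expR (- CH D (log_gap (y n) D (dl n)) (ln (n%:R / (y n D)%:R)))) @[n --> \oo] -->
  (\prod_(l < D) (expR (- \sum_(j < l.+1) coef alpha j * (H (ln (x l.+1 / x j)) - H (ln (x l / x j)))) *
  ((\sum_(j < l.+1) coef alpha j * h (ln (x l.+1 / x j))) / x l.+1))) *
  expR (- \sum_(j < D.+1) coef alpha j * (H (ln (1 / x D) + ln (x D / x j)) - H (ln (x D / x j)))).
  move=> k1 k2 k3 k4.
  apply: (@near_eq_cvgr _ (fun n => (\prod_(l < D) (n%:R * step_factor (y n) l (dl n) (dl' n))) *
      expR (- CH D (log_gap (y n) D (dl n)) (ln (n%:R / (y n D)%:R))))).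
    by near=> n; rewrite big_split /= prodr_const card_ord mulrA.
  apply: cvgM.
    by apply: cvg_prod_seq => l _; exact: step_factor_cvg.
  apply: continuous_cvg; first exact: continuous_expR.
  by apply: cvgN; exact: (CH_cvg yx x0 x_lt x1 k1 k2 (leqnn D)).
apply: squeeze_cvgr (side eps (fun=> 0) eps0 epsc c00 c0) (side (fun=> 0) eps c00 c0 eps0 epsc).
near=> n.
have [q1 [q2 q3]] : (0 < y n 0)%N /\ (forall j, (j < D)%N -> (y n j <= y n j.+1)%N) /\
  (forall j, (j <= D)%N -> (y n j < n)%N) by near: n; exact: (eventually_ordered yx x0 x_lt x1).
have sn : 0 <= ln (n%:R / (y n D)%:R) :> R by near: n.
have /andP[b1 b2] := tail_product_bounds q1 q2 srvE mE E0 condE sn.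
by rewrite !ler_wpM2l ?exprn_ge0.
Unshelve. all: by end_near.
Qed.

End step_limits.

End individual_limit.

(** * Placing the branching process on the grid *)

Section indices.
Context {R : realType}.
Implicit Types (n a b : nat) (e : \bar R).

(* The least index [b] with [a * exp e <= b + 1]; an infinite waiting time
   leads to index [n], standing for a vertex that does not arrive in time. *)
Definition next_index n a e : nat :=
  if e is r%:E then (`|Num.ceil (a%:R * expR r)|%N).-1 else n.

Lemma ceil_index (y : R) b : 0 < y -> (`|Num.ceil y|%N.-1 <= b)%N = (y <= b.+1%:R).
Proof.
move=> y0; have c0 : 0 < Num.ceil y by rewrite ceil_gt0.
have cE : Num.ceil y = (`|Num.ceil y|%N)%:Z by rewrite gtz0_abs.
rewrite (_ : (_ <= b)%N = (Num.ceil y <= b.+1%:Z)); last by rewrite {2}cE lez_nat; lia.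
by rewrite ceil_le_int.
Qed.

Lemma next_index_le n a r b : (0 < a)%N ->
  (next_index n a r%:E <= b)%N = (a%:R * expR r <= b.+1%:R).
Proof. by move=> a0; rewrite /next_index ceil_index// mulr_gt0 ?expR_gt0// ltr0n. Qed.

Lemma next_index_ge n a r b : (0 < a)%N -> (0 < b)%N ->
  (b <= next_index n a r%:E)%N = (b%:R < a%:R * expR r).
Proof.
move=> a0; case: b => // b _.
by rewrite ltnNge next_index_le// -ltNge.
Qed.

Lemma next_index_grow n a e m : (0 < e)%E -> (m <= a)%N -> (m <= n)%N ->
  (m <= next_index n a e)%N.
Proof.
case: e => [r| |]//=; case: m => // m r0 ma _.
have a0 : (0 < a)%N by exact: leq_trans ma.
rewrite -[X in (_ <= X)%N]/(next_index n a r%:E) next_index_ge//.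
apply: (@le_lt_trans _ _ a%:R); first by rewrite ler_nat.
by rewrite ltr_pMr ?ltr0n// expR_gt1 -lte_fin.
Qed.

Lemma next_indexE n a e b : (0 < e)%E -> (0 < a)%N -> (b < n)%N ->
  next_index n a e = b <-> (EFin @` index_cell a b) e.
Proof.
move=> e0 a0 bn; have a0' : 0 < a%:R :> R by rewrite ltr0n.
case: e e0 => [r r0| |//]; last first.
  by move=> _; split=> [/= nb|[]//]; rewrite nb ltnn in bn.
have ineq (c : nat) : (0 < c)%N -> (a%:R * expR r <= c%:R) = (r <= ln (c%:R / a%:R)).
  move=> c0; rewrite -[in RHS](expRK r) ler_ln ?posrE ?expR_gt0 ?divr_gt0 ?ltr0n//.
  by rewrite ler_pdivlMr// mulrC.
have cell : (EFin @` index_cell a b) r%:E <-> (ln (b%:R / a%:R) < r) && (r <= ln (b.+1%:R / a%:R)).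
  split=> [[s + [<-]]|h]; first by rewrite /index_cell /= in_itv.
  by exists r => //; rewrite /index_cell /= in_itv.
rewrite cell; have -> : (next_index n a r%:E = b) <->
    ((b <= next_index n a r%:E) && (next_index n a r%:E <= b))%N.
  by rewrite -eqn_leq; split=> [->|/eqP]; rewrite ?eqxx.
rewrite next_index_le// ineq//; case: b {bn cell} => [|b].
  (* For [b = 0] the left end of the cell is [ln 0], equal to [0] by convention, and it is the
     positivity of the waiting time that matches it. *)
  have r0' : 0 < r by rewrite -lte_fin.
  by rewrite mul0r (ln0 (lexx 0)) r0'.
by rewrite next_index_ge// ltNge ineq// -ltNge.
Qed.

Lemma next_index_late n a e : (0 < e)%E -> (0 < a)%N -> (0 < n)%N ->
  (n <= next_index n a e)%N <-> ((ln (n%:R / a%:R))%:E < e)%E.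
Proof.
move=> e0 a0 n0; have a0' : 0 < a%:R :> R by rewrite ltr0n.
case: e e0 => [r _| _|//]; last by rewrite ltry leqnn.
rewrite next_index_ge// lte_fin -[in X in _ <-> X](expRK r).
by rewrite ltr_ln ?posrE ?expR_gt0 ?divr_gt0 ?ltr0n// ltr_pdivrMr// mulrC.
Qed.

Lemma next_index_bounds n a r : (0 : R) <= r ->
  a%:R * expR r - 1 <= (next_index n a r%:E)%:R <= a%:R * expR r.
Proof.
move=> r0; have [a0|] := ltnP 0 a; last first.
  rewrite leqn0 => /eqP ->; rewrite /next_index mul0r ceil0 /=.
  by rewrite lexx andbT; lra.
rewrite lerBlDr natr1 -(next_index_le n) // leqnn andTb.
case E : (next_index n a r%:E) => [|b]; first by apply: mulr_ge0 => //; exact: expR_ge0.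
by apply: ltW; rewrite -(next_index_ge n)// E.
Qed.

Lemma next_index_lt n a r : (0 < a)%N ->
  (0 < next_index n a r%:E)%N -> (next_index n a r%:E)%:R < a%:R * expR r.
Proof. by move=> a0 b0; rewrite -(next_index_ge n)// leqnn. Qed.

Variable E : seq nat -> nat -> \bar R.
Hypothesis E_gt0 : forall w j, (0 < E w j)%E.

(** Rounding is redone after every waiting time instead of once for the exact birth time: a position
    then depends on the previous one and on a single waiting time, so prescribing positions gives a
    rectangle. *)
Fixpoint kid_index n a (e : nat -> \bar R) (c : nat) : nat :=
  next_index n (if c is c'.+1 then kid_index n a e c' else a) (e c).

Fixpoint index_aux n (pre : seq nat) a (u : seq nat) : nat :=
  if u is c :: u' then index_aux n (rcons pre c) (kid_index n a (E pre) c) u' else a.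

Definition index_at n a u := index_aux n [::] a u.

Lemma index_at_rcons n a w c :
  index_at n a (rcons w c) = kid_index n (index_at n a w) (E w) c.
Proof.
rewrite /index_at -[w in E w]cat0s; elim: w [::] a => [|x w IH] pre a /=.
  by rewrite cats0.
by rewrite IH cat_rcons.
Qed.

Lemma index_at_kid0 n a w :
  index_at n a (rcons w 0%N) = next_index n (index_at n a w) (E w 0%N).
Proof. by rewrite index_at_rcons. Qed.

Lemma index_at_kidS n a w c :
  index_at n a (rcons w c.+1) = next_index n (index_at n a (rcons w c)) (E w c.+1).
Proof. by rewrite !index_at_rcons. Qed.

(** Follows the order in which birth times and positions are built: from a parent to its first kid,
    then from sibling to sibling. *)
Lemma word_ind (Q : seq nat -> Prop) : Q [::] -> (forall w, Q w -> Q (rcons w 0%N)) ->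
  (forall w c, Q (rcons w c) -> Q (rcons w c.+1)) -> forall w, Q w.
Proof.
move=> Q0 Qk QS; elim/last_ind => // w c Qw.
by elim: c => [|c IH]; [exact: Qk|exact: QS].
Qed.

Definition birth_time (u : seq nat) : \bar R :=
  @birth R unit (fun w j _ => E w j) u tt.

Lemma birth_aux_rcons T (E' : seq nat -> nat -> T -> \bar R) pre u c om :
  birth_aux E' pre (rcons u c) om =
  (birth_aux E' pre u om + \sum_(j < c.+1) E' (pre ++ u) j om)%E.
Proof.
elim: u pre => [|x u IH] pre; first by rewrite /= cats0 adde0 add0e.
by rewrite [LHS]/= IH cat_rcons addeA.
Qed.

Lemma birth_time_kid0 w : birth_time (rcons w 0%N) = (birth_time w + E w 0%N)%E.
Proof. by rewrite /birth_time /birth birth_aux_rcons big_ord1. Qed.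

Lemma birth_time_kidS w c :
  birth_time (rcons w c.+1) = (birth_time (rcons w c) + E w c.+1)%E.
Proof. by rewrite /birth_time /birth !birth_aux_rcons [in LHS]big_ord_recr /= addeA. Qed.

Lemma alive_left_closed (t : R) : left_closed (fun w => (birth_time w <= t%:E)%E).
Proof.
split=> [w|w c]; rewrite ?birth_time_kid0 ?birth_time_kidS; apply: le_trans;
  by rewrite leeDl// ltW.
Qed.

Variable t : R.
Hypothesis t_gt0 : 0 < t.

Definition root_index n : nat := Num.truncn (n%:R * expR (- t)).

Lemma root_indexE n i : (0 < n)%N -> (0 < i)%N ->
  root_index n = i <-> (ln (n%:R / i.+1%:R) < t <= ln (n%:R / i%:R)).
Proof.
move=> n0 i0; have n0' : 0 < n%:R :> R by rewrite ltr0n.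
have i0' : 0 < i%:R :> R by rewrite ltr0n.
have y0 : 0 <= n%:R * expR (- t) by rewrite mulr_ge0 ?expR_ge0.
have ineq (c : R) : 0 < c -> (c <= n%:R * expR (- t)) = (t <= ln (n%:R / c)).
  move=> c0; rewrite -[in RHS](expRK t) ler_ln ?posrE ?expR_gt0 ?divr_gt0//.
  by rewrite expRN ler_pdivlMr ?expR_gt0// ler_pdivlMr// mulrC.
have -> : (root_index n = i) <-> (i%:R <= n%:R * expR (- t) < i.+1%:R).
  split=> [<-|]; first exact: truncn_itv.
  exact: truncn_def.
by rewrite ineq// ltNge ineq ?ltr0n// -ltNge andbC.
Qed.

Lemma root_index_bounds n :
  n%:R * expR (- t) - 1 <= (root_index n)%:R <= n%:R * expR (- t).
Proof.
have y0 : 0 <= n%:R * expR (- t) by rewrite mulr_ge0 ?expR_ge0.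
by have /andP[-> t2] := truncn_itv y0; rewrite andbT lerBlDr natr1 ltW.
Qed.

Let idx n w := index_at n (root_index n) w.

(** Each rounding loses at most one unit and later waiting times magnify the loss by a factor free
    of [n], so the error for a given word stays bounded and one-sided. After an infinite waiting
    time the index is [n], and later indices never drop below it. *)
Lemma index_limit w :
  (birth_time w = +oo%E /\ forall n, (n <= idx n w)%N) \/
  (exists b : R, exists C : R, birth_time w = b%:E /\ forall n,
    n%:R * expR (b - t) - C <= (idx n w)%:R <= n%:R * expR (b - t)).
Proof.
have step u u' e : (0 < e)%E -> birth_time u' = (birth_time u + e)%E ->
    (forall n, idx n u' = next_index n (idx n u) e) ->
    ((birth_time u = +oo%E /\ forall n, (n <= idx n u)%N) \/
    (exists b : R, exists C : R, birth_time u = b%:E /\ forall n,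
      n%:R * expR (b - t) - C <= (idx n u)%:R <= n%:R * expR (b - t))) ->
    ((birth_time u' = +oo%E /\ forall n, (n <= idx n u')%N) \/
    (exists b : R, exists C : R, birth_time u' = b%:E /\ forall n,
      n%:R * expR (b - t) - C <= (idx n u')%:R <= n%:R * expR (b - t))).
  move=> e0 bE iE [[bw iw]|[b [C [bw iw]]]].
    left; split; first by rewrite bE bw addye// gt_eqF// (lt_trans _ e0).
    by move=> n; rewrite iE next_index_grow.
  case: e e0 bE iE => [r r0 bE iE|_ bE iE|//]; last first.
    by left; split=> [|n]; [rewrite bE bw|rewrite iE].
  right; exists (b + r), (C * expR r + 1); split; first by rewrite bE bw.
  have r0' : 0 <= r by rewrite -lee_fin ltW.
  move=> n; rewrite iE; have /andP[k1 k2] := next_index_bounds n (idx n u) r0'.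
  have /andP[i1 i2] := iw n.
  have eE : expR (b + r - t) = expR (b - t) * expR r by rewrite -expRD; congr expR; ring.
  have er := expR_gt0 r; rewrite eE mulrA; apply/andP; split.
    apply: le_trans k1; rewrite opprD addrA lerD2r -mulrBl.
    by rewrite ler_wpM2r// ltW.
  by apply: le_trans k2 _; rewrite ler_wpM2r// ltW.
elim/word_ind: w => [|w|w c].
- right; exists 0, 1; split=> // n; rewrite sub0r; exact: root_index_bounds.
- by apply: (step w _ (E w 0%N)); [exact: E_gt0|exact: birth_time_kid0|move=> n; exact: index_at_kid0].
- by apply: (step (rcons w c) _ (E w c.+1)); [exact: E_gt0|exact: birth_time_kidS|move=> n; exact: index_at_kidS].
Qed.

(** Rounding down gives only index at most [n]. Equality would need a last step from an index [a]
    with [n < a exp r], while the bound on the predecessor gives [a exp r <= n exp (b - t) <= n];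
    for the root, [t > 0] excludes it. This settles births exactly at time [t]. *)
Lemma alive_index_lt w n : (0 < n)%N -> (birth_time w <= t%:E)%E -> (idx n w < n)%N.
Proof.
move=> n0 bt; have n0' : 0 < n%:R :> R by rewrite ltr0n.
have [[bw _]|[b [C [bw iw]]]] := index_limit w; first by rewrite bw in bt.
have b_le : b <= t by rewrite -lee_fin -bw.
have /andP[_ k] := iw n.
have k2 : (idx n w)%:R <= n%:R :> R.
  by apply: le_trans k _; rewrite ler_piMr// -[leRHS]expR0 ler_expR; lra.
have {k2} : (idx n w <= n)%N by rewrite -(ler_nat R).
rewrite leq_eqVlt => /predU1P[e|//]; exfalso.
have prev w' r : (0 < r%:E :> \bar R)%E -> birth_time w = (birth_time w' + r%:E)%E ->
    idx n w = next_index n (idx n w') r%:E -> False.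
  move=> r0 bE iE.
  have [[bw' _]|[b' [C' [bw' iw']]]] := index_limit w'; first by rewrite bE bw' in bw.
  have bb : b = b' + r by apply: EFin_inj; rewrite -bw bE bw'.
  have a0 : (0 < idx n w')%N.
    rewrite lt0n; apply/eqP => a0; move: iE; rewrite a0 e /next_index mul0r ceil0 /=.
    by move=> nn; rewrite nn in n0.
  have lt : n%:R < (idx n w')%:R * expR r.
    by rewrite -{1}e iE next_index_lt// -iE e.
  have /andP[_ k'] := iw' n.
  have : (idx n w')%:R * expR r <= n%:R * expR (b' - t) * expR r.
    by rewrite ler_wpM2r// ltW// expR_gt0.
  rewrite -mulrA -expRD => k3.
  have : n%:R * expR (b' - t + r) <= n%:R.
    by rewrite ler_piMr// -[leRHS]expR0 ler_expR; lra.
  by move=> k4; have := lt_le_trans lt (le_trans k3 k4); rewrite ltxx.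
have fin w' e' : (birth_time w' + e' = b%:E)%E -> (0 < e')%E -> (0 <= birth_time w')%E ->
    exists r, e' = r%:E.
  by case: e' => [r| |]//; [exists r|case: (birth_time w')].
have b_ge0 w' : (0 <= birth_time w')%E.
  elim/word_ind: w' => // [w' IH|w' c IH].
    by rewrite birth_time_kid0 adde_ge0// ltW.
  by rewrite birth_time_kidS adde_ge0// ltW.
case/lastP: w bt bw iw k e prev => [|w c] bt bw iw k e prev.
  have et : expR (- t) < 1 by rewrite -[ltRHS]expR0 ltr_expR oppr_lt0.
  have : n%:R * expR (- t) < n%:R by rewrite gtr_pMr.
  have /andP[_ k'] := root_index_bounds n.
  by move=> /(le_lt_trans k'); rewrite -[root_index n]/(idx n [::]) e ltxx.
case: c bt bw iw k e prev => [|c] bt bw iw k e prev.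
  have [r er] := fin w _ (etrans (esym (birth_time_kid0 w)) bw) (E_gt0 _ _) (b_ge0 _).
  apply: (prev w r); first by rewrite -er.
    by rewrite birth_time_kid0 er.
  by rewrite /idx index_at_kid0 er.
have [r er] := fin _ _ (etrans (esym (birth_time_kidS w c)) bw) (E_gt0 _ _) (b_ge0 _).
apply: (prev (rcons w c) r); first by rewrite -er.
  by rewrite birth_time_kidS er.
by rewrite /idx index_at_kidS er.
Qed.

Lemma alive_index w :
  \forall n \near \oo, (birth_time w <= t%:E)%E <-> (idx n w < n)%N.
Proof.
have [bt|tb] := leP (birth_time w) t%:E.
  near=> n; split=> // _; apply: alive_index_lt => //; near: n; by exists 1%N.
have [[_ k]|[b [C [bw iw]]]] := index_limit w.
  by near=> n; split=> // lt; move: lt; rewrite ltnNge k.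
have tb' : t < b by rewrite -lte_fin -bw.
near=> n; split=> // lt; exfalso.
have /andP[k _] := iw n.
have g : 0 < expR (b - t) - 1 by rewrite subr_gt0 expR_gt1 subr_gt0.
have : C / (expR (b - t) - 1) < n%:R.
  near: n; exists (Num.truncn (C / (expR (b - t) - 1))).+1 => // n /= nm.
  by apply: lt_le_trans (truncnS_gt _) _; rewrite ler_nat.
rewrite ltr_pdivrMr// => k2.
have : (n%:R : R) < (idx n w)%:R by apply: lt_le_trans k; lra.
by rewrite ltr_nat ltnNge (ltnW lt).
Unshelve. all: by end_near.
Qed.

End indices.

(** * Position vectors as lists *)

Section boxes.
Context {R : realType}.

Fixpoint boxes (n r : nat) : seq (seq nat) :=
  if r is r'.+1 then [seq i :: t | i <- iota 0 n, t <- boxes n r'] else [:: [::]].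

Lemma mem_boxes n r t : (t \in boxes n r) = (size t == r) && all (fun i => (i < n)%N) t.
Proof.
elim: r t => [|r IH] t; first by rewrite /= inE; case: t.
apply/allpairsPdep/idP => [[i [s [+ + ->]]]|].
  by rewrite mem_iota IH /= eqSS add0n => i_n /andP[-> ->]; rewrite i_n.
case: t => [//|i s] /=; rewrite eqSS => /and3P[ss ni sn].
by exists i, s; rewrite mem_iota IH ss sn.
Qed.

Lemma uniq_boxes n r : uniq (boxes n r).
Proof.
elim: r => // r IH; apply: allpairs_uniq => //; first exact: iota_uniq.
by move=> [i s] [i' s'] _ _ /= [-> ->].
Qed.

Lemma box_sumE n r (f : seq nat -> R) pre :
  box_sum n r f pre = \sum_(t <- boxes n r) f (pre ++ t).
Proof.
elim: r pre => [|r IH] pre /=; first by rewrite big_seq1 cats0.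
rewrite big_allpairs_dep /= -[iota 0 n]/(iota 0 n).
have -> : iota 0 n = index_iota 0 n by rewrite /index_iota subn0.
rewrite big_mkord; apply: eq_bigr => i _; rewrite IH; apply: eq_bigr => t _.
by rewrite cat_rcons.
Qed.

(** Reads a list of positions as a function on words, in the order of [L]; the root comes first, so
    its position is the outermost coordinate of a box sum. *)
Definition label (L : seq (seq nat)) (t : seq nat) (w : seq nat) : nat :=
  nth 0%N t (index w L).

Lemma map_label L t : uniq L -> size t = size L -> [seq label L t w | w <- L] = t.
Proof.
move=> uL st; apply: (@eq_from_nth _ 0%N); first by rewrite size_map.
move=> i; rewrite size_map => iL; rewrite (nth_map [::])// /label index_uniq//.
Qed.

Lemma label_map L (f : seq nat -> nat) w : w \in L -> label L [seq f u | u <- L] w = f w.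
Proof.
by move=> wL; rewrite /label (nth_map [::]) ?index_mem// nth_index.
Qed.

Lemma label_lt n L t w : t \in boxes n (size L) -> w \in L -> (label L t w < n)%N.
Proof.
rewrite mem_boxes => /andP[/eqP st /allP tn] wL; apply: tn.
by rewrite mem_nth// st index_mem.
Qed.

Lemma sum_label_delta n L (f : seq nat -> nat) (c : R) : uniq L ->
  \sum_(t <- boxes n (size L)) (if [seq f w | w <- L] == t then c else 0) =
  if all (fun w => (f w < n)%N) L then c else 0.
Proof.
move=> uL; case: ifPn => fn.
  rewrite (bigD1_seq [seq f w | w <- L]) ?uniq_boxes//=; last first.
    by rewrite mem_boxes size_map eqxx all_map.
  by rewrite eqxx big1 ?addr0// => t; rewrite eq_sym => /negPf ->.
rewrite big_seq big1// => t tn; case: eqP => // e; move: tn fn.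
by rewrite mem_boxes -e all_map => /andP[_ ->].
Qed.

End boxes.

(** * Probabilities of convergent and of disjoint events *)

Section events_limit.
Context {R : realType} (d : measure_display) (Omega : measurableType d).
Variable P : probability Omega R.

Lemma cvg_probability (A : nat -> set Omega) (B N : set Omega) :
  (forall n, measurable (A n)) -> measurable B -> measurable N -> P N = 0%E ->
  (forall om, ~ N om -> \forall n \near \oo, A n om <-> B om) ->
  fine (P (A n)) @[n --> \oo] --> fine (P B).
Proof.
move=> mA mB mN PN AB.
have mA1 n : measurable_fun setT (fun om => (\1_(A n) om)%:E : \bar R).
  by apply/measurable_EFinP; exact: measurable_indic.
have mB1 : measurable_fun setT (fun om => (\1_B om)%:E : \bar R).
  by apply/measurable_EFinP; exact: measurable_indic.
have ae1 : {ae P, forall om, setT om ->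
    (\1_(A n) om)%:E @[n --> \oo] --> ((\1_B om)%:E : \bar R)}.
  exists N; split => // om; apply: contra_notP => /AB h _.
  apply: cvg_near_cst; apply: filterS h => n h; congr (_%:E); rewrite !indicE.
  by congr (nat_of_bool _)%:R; apply/idP/idP => /set_mem/h/mem_set.
have int1 : P.-integrable setT (cst 1%E : Omega -> \bar R).
  exact: finite_measure_integrable_cst.
have bd1 : {ae P, forall om n, setT om -> (`|(\1_(A n) om)%:E| <= (cst 1 om : \bar R))%E}.
  apply: aeW => om n _; rewrite abse_EFin indicE ger0_norm// lee_fin.
  by case: (_ \in _).
have [_ _ c] := dominated_convergence measurableT mA1 mB1 ae1 int1 bd1.
have Ec X : measurable X -> (\int[P]_(om in setT) (\1_X om)%:E)%E = P X.
  by move=> mX; rewrite integral_indic// setIT.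
rewrite Ec// in c; apply: fine_cvg; rewrite fineK ?fin_num_measure//.
by apply: cvg_trans c; apply: near_eq_cvg; apply: nearW => n /=; rewrite (Ec _ (mA n)).
Qed.

Lemma sum_probability (J : choiceType) (s : seq J) (X : J -> set Omega) : uniq s ->
  (forall i, i \in s -> measurable (X i)) -> trivIset [set` s] X ->
  \sum_(i <- s) fine (P (X i)) = fine (P (\bigcup_(i in [set` s]) X i)).
Proof.
move=> us mX tX; have -> : P (\bigcup_(i in [set` s]) X i) = (\sum_(i \in [set` s]) P (X i))%E.
  by apply: measure_fin_bigcup => //; exact: finite_seq.
rewrite -fsbig_seq// big_seq [in RHS]big_seq -sum_fine// => i si.
by apply: fin_num_measure; exact: mX.
Qed.

End events_limit.

(** * The discretised branching process and its product law *)

Section discretized_process.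
Context {R : realType} (d : measure_display) (Omega : measurableType d).
Variables (P : probability Omega R).
Variables (E : seq nat -> nat -> Omega -> \bar R) (T1 : Omega -> R).
Hypothesis mE : forall u j, measurable_fun setT (E u j).
Hypothesis E_gt0 : forall u j om, (0 < E u j om)%E.
Hypothesis mT1 : measurable_fun setT T1.
Hypothesis T1_exp : forall s : R, 0 <= s -> P [set om | s < T1 om] = (expR (- s))%:E.
Hypothesis indep : forall (us : seq (seq nat)) (k : nat)
  (B : seq nat -> nat -> set (\bar R)) (C : set R),
  uniq us -> measurable C -> (forall u j, measurable (B u j)) ->
  P ([set om | T1 om \in C]
       `&` [set om | forall u, u \in us -> forall j, (j < k)%N -> E u j om \in B u j])
  = (P [set om | T1 om \in C] *
     \prod_(u <- us) P [set om | forall j, (j < k)%N -> E u j om \in B u j])%E.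

Definition alive (om : Omega) (w : seq nat) := (birth E w om <= (T1 om)%:E)%E.

Lemma birthE w om : birth E w om = birth_time (fun u j => E u j om) w.
Proof.
elim/word_ind: w => // [w IH|w c IH].
  by rewrite birth_time_kid0 -IH /birth birth_aux_rcons big_ord1.
by rewrite birth_time_kidS -IH /birth !birth_aux_rcons [in LHS]big_ord_recr /= addeA.
Qed.

Lemma alive_closed om : left_closed (alive om).
Proof.
have := alive_left_closed (fun u j => E_gt0 u j om) (T1 om).
by rewrite /left_closed /alive => -[h1 h2]; split=> [w|w c]; rewrite !birthE; [exact: h1|exact: h2].
Qed.

Lemma measurable_birth w : measurable_fun setT (birth E w).
Proof.
elim/word_ind: w => [|w IH|w c IH]; first exact: measurable_cst.
  rewrite (_ : birth E _ = (fun om => birth E w om + E w 0%N om)%E); last first.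
    by apply/funext => om; rewrite /birth birth_aux_rcons big_ord1.
  exact: emeasurable_funD.
rewrite (_ : birth E _ = (fun om => birth E (rcons w c) om + E w c.+1 om)%E); last first.
  by apply/funext => om; rewrite /birth !birth_aux_rcons [in LHS]big_ord_recr /= addeA.
exact: emeasurable_funD.
Qed.

Lemma measurable_alive w : measurable [set om | alive om w].
Proof.
rewrite -[X in measurable X]setTI; apply: measurable_lee => //.
  exact: measurable_birth.
by apply/measurable_EFinP.
Qed.

Variables (L obs : seq (seq nat)).
Hypothesis tL : ptree L.
Hypothesis oL : observes L obs.

Lemma measurable_forall_in (Q : Omega -> seq nat -> Prop) (s : seq (seq nat)) :
  (forall w, measurable [set om | Q om w]) ->
  measurable [set om | forall w, w \in s -> Q om w].
Proof.
move=> mQ; elim: s => [|w s IH].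
  by rewrite (_ : [set _ | _] = setT)//; apply/seteqP; split.
rewrite (_ : [set _ | _] = [set om | Q om w] `&` [set om | forall w, w \in s -> Q om w]).
  exact: measurableI.
apply/seteqP; split=> om /= h.
  by split=> [|u us]; apply: h; rewrite inE ?eqxx// us orbT.
by move=> u; rewrite inE => /predU1P[->|]; [exact: h.1|exact: h.2].
Qed.

Lemma measurable_exactly : measurable [set om | exactly (alive om) L obs].
Proof.
rewrite (_ : [set _ | _] = [set om | forall w, w \in L -> alive om w] `&`
  [set om | forall w, w \in obs -> ~ alive om (rcons w (kids L w))])//.
apply: measurableI; first by apply: measurable_forall_in; exact: measurable_alive.
apply: (measurable_forall_in (Q := fun om w => ~ alive om (rcons w (kids L w)))) => w.
by apply: (measurableC (measurable_alive (rcons w (kids L w)))).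
Qed.

Definition om_index (n : nat) (om : Omega) (w : seq nat) : nat :=
  index_at (fun u j => E u j om) n (root_index (T1 om) n) w.

(** Grid counterpart of [exactly]: an index of at least [n] stands for a birth after [T1]. A zero
    root position is excluded, as finite waiting times never lead away from [0]. *)
Definition index_event (n : nat) (I : seq nat -> nat) : set Omega :=
  [set om | [/\ (0 < I [::])%N, forall w, w \in L -> om_index n om w = I w &
     forall w, w \in obs -> (n <= om_index n om (rcons w (kids L w)))%N]].

(** Rounded positions may coincide, so only the weak form of [good_values] holds here; ties do not
    survive in the limit because generic coordinates are distinct. *)
Definition nondecreasing_values (I : seq nat -> nat) :=
  (forall w, rcons w 0%N \in L -> (I w <= I (rcons w 0%N))%N) /\
  (forall w c, rcons w c.+1 \in L -> (I (rcons w c) <= I (rcons w c.+1))%N).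

Lemma mem_parent w c : rcons w c \in L -> w \in L.
Proof. by rewrite (ptree_mem_rcons _ _ tL) => /andP[]. Qed.

Lemma mem_sibling w c : rcons w c.+1 \in L -> rcons w c \in L.
Proof. by rewrite !(ptree_mem_rcons _ _ tL) => /andP[-> /ltnW]. Qed.

Lemma index_event_nondecreasing n I om : (forall w, w \in L -> (I w < n)%N) ->
  index_event n I om -> nondecreasing_values I.
Proof.
move=> In [I0 Iw _]; split=> [w wL|w c wL].
  have wL' := mem_parent wL; rewrite -!Iw// /om_index index_at_kid0.
  apply: next_index_grow => //; apply: ltnW.
  by rewrite -/(om_index n om w) Iw// In.
have wL' := mem_sibling wL; rewrite -!Iw// /om_index index_at_kidS.
apply: next_index_grow => //; apply: ltnW.
by rewrite -/(om_index n om (rcons w c)) Iw// In.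
Qed.

Lemma nondecreasing_ge_root I w : nondecreasing_values I -> w \in L -> (I [::] <= I w)%N.
Proof.
move=> [m0 mS]; elim/word_ind: w => // [w IH|w c IH] wL.
  exact: leq_trans (IH (mem_parent wL)) (m0 _ wL).
exact: leq_trans (IH (mem_sibling wL)) (mS _ _ wL).
Qed.

Definition last_value I w : nat := self_or_kid I w (kids L w).

(** Cells for the kids in [L], a tail for the first missing kid, nothing afterwards; padding with
    [setT] gives all individuals the common number of waiting times that [indep] asks for. *)
Definition waiting_set n I (u : seq nat) (j : nat) : set (\bar R) :=
  if (j < kids L u)%N then EFin @` index_cell (self_or_kid I u j) (self_or_kid I u j.+1)
  else if j == kids L u then [set e | ((ln (n%:R / (last_value I u)%:R))%:E < e)%E]
  else setT.

Lemma measurable_waiting_set n I u j : measurable (waiting_set n I u j).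
Proof.
rewrite /waiting_set; case: ifP => _.
  by apply: measurable_image_EFin; exact: measurable_itv.
case: ifP => _ //.
rewrite (_ : [set _ | _] = [set` `](ln (n%:R / (last_value I u)%:R))%:E, +oo%E]]).
  exact: emeasurable_itv.
by apply/seteqP; split=> e /=; rewrite in_itv /= leey andbT.
Qed.

Definition root_cell n (I : seq nat -> nat) : set R :=
  `]ln (n%:R / (I [::]).+1%:R), ln (n%:R / (I [::])%:R)]%classic.

Lemma index_eventE n I : (0 < n)%N -> (0 < I [::])%N ->
  (forall w, w \in L -> (I w < n)%N) -> nondecreasing_values I ->
  index_event n I = [set om | T1 om \in root_cell n I] `&`
    [set om | forall u, u \in obs -> forall j, (j < (size L).+1)%N ->
       E u j om \in waiting_set n I u j].
Proof.
move=> n0 I0 In mI; have [uo oL' Lo] := oL.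
have Ipos w : w \in L -> (0 < I w)%N.
  by move=> wL; apply: leq_trans I0 (nondecreasing_ge_root mI wL).
have sokL w j : w \in L -> (j <= kids L w)%N -> self_or_kid id w j \in L.
  by move=> wL jw; apply: self_or_kid_mem.
have idx0 om : om_index n om [::] = I [::] <-> T1 om \in root_cell n I.
  rewrite (root_indexE (T1 om) n0 I0); split=> [h|].
    by rewrite inE /root_cell /= in_itv.
  by rewrite inE /root_cell /= in_itv.
have idxS om w j : w \in L -> om_index n om (rcons w j) =
    next_index n (om_index n om (self_or_kid id w j)) (E w j om).
  by move=> wL; case: j => [|j]; rewrite /om_index /= ?index_at_kid0 ?index_at_kidS.
apply/seteqP; split=> om.
  move=> [_ Iw Io]; split; first by apply/idx0/Iw; exact: ptree_nil.
  move=> u uo' j jL; have uL := oL' _ uo'; rewrite inE /waiting_set; case: ifPn => ju.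
    have jL' := sokL u j uL (ltnW ju); have jSL := sokL u j.+1 uL ju.
    rewrite !(self_or_kidE I); apply/(next_indexE (n := n)) => //.
    - exact: Ipos.
    - exact: In.
    by rewrite -(Iw _ jL') -idxS// Iw.
  case: eqP => // jE; have jL' := sokL u j uL; rewrite jE leqnn in jL'; have {}jL' := jL' isT.
  apply/(next_index_late (n := n)) => //.
    by rewrite /last_value self_or_kidE; exact: Ipos.
  by have := Io _ uo'; rewrite jE idxS// Iw// -self_or_kidE.

move=> [T1C EB].
have EB' u j : u \in obs -> (j <= kids L u)%N -> waiting_set n I u j (E u j om).
  move=> uo' ju; apply/set_mem; apply: EB => //; rewrite ltnS.
  exact: leq_trans ju (kids_le_size _ _).
have Iw w : w \in L -> om_index n om w = I w.
  have key u j : rcons u j \in L -> om_index n om (self_or_kid id u j) = I (self_or_kid id u j) ->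
      om_index n om (rcons u j) = I (rcons u j).
    move=> ujL ih; have uL := mem_parent ujL; have uo' := Lo _ _ ujL.
    have ju : (j < kids L u)%N by move: ujL; rewrite (ptree_mem_rcons _ _ tL) uL.
    have := EB' u j uo' (ltnW ju); rewrite /waiting_set ju idxS// ih.
    rewrite !(self_or_kidE I) => h; apply/next_indexE => //.
    - by apply: Ipos; apply: sokL => //; exact: ltnW.
    - exact: In.
  elim/word_ind: w => [_|w IH wL|w c IH wL]; first exact/idx0.
    by apply: key => //; exact: IH (mem_parent wL).
  by apply: key => //; exact: IH (mem_sibling wL).
split=> // w wo; have wL := oL' _ wo.
have jL' := sokL w _ wL (leqnn _).
rewrite idxS// Iw//; apply/next_index_late => //; first exact: Ipos.
have := EB' w _ wo (leqnn _); rewrite /waiting_set ltnn eqxx /last_value.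
by rewrite -self_or_kidE.
Qed.

Lemma waiting_tail n I u : [set om | forall j, (j < (size L).+1)%N ->
    E u j om \in waiting_set n I u j] =
  tail (E u) (self_or_kid I u) (kids L u) (ln (n%:R / (last_value I u)%:R)).
Proof.
have kL := kids_le_size L u; apply/seteqP; split=> om.
  move=> h; split=> [j jk|].
    by have := h j (ltn_trans jk (kL : (_ < _.+1)%N)); rewrite /waiting_set jk; apply; lia.
  by have := h (kids L u); rewrite ltnS kL inE /waiting_set ltnn eqxx => /(_ isT).
move=> [po /= lt] j jL; rewrite inE /waiting_set; case: ifPn => [jk|_].
  by have := po j jk; rewrite inE.
by case: eqP => // ->.
Qed.

(** With [i = I [::]], the two exponential tails are [(i + 1) / n] and [i / n]. *)
Lemma root_cell_probability n I : (0 < I [::] < n)%N ->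
  P [set om | T1 om \in root_cell n I] = (n%:R^-1)%:E.
Proof.
move=> /andP[I0 In]; have n0 : 0 < n%:R :> R by rewrite ltr0n; lia.
set a := ln (n%:R / (I [::]).+1%:R) : R; set b := ln (n%:R / (I [::])%:R) : R.
have a0 : 0 <= a by exact: ln_ratio_ge0.
have ab : a <= b.
  rewrite ler_ln ?posrE; last 2 first.
  - by rewrite divr_gt0// ltr0n.
  - by rewrite divr_gt0// ltr0n.
  by rewrite ler_wpM2l ?(ltW n0)// lef_pV2 ?posrE ?ltr0n// ler_nat.
have mT s : measurable [set om | s < T1 om].
  rewrite (_ : [set _ | _] = T1 @^-1` `]s, +oo[%classic); last first.
    by apply/seteqP; split=> om /=; rewrite in_itv /= andbT.
  by rewrite -[X in measurable X]setTI; apply: mT1.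
have -> : [set om | T1 om \in root_cell n I] = [set om | a < T1 om] `\` [set om | b < T1 om].
  apply/seteqP; split=> om /=.
    rewrite inE /root_cell /= in_itv /= => /andP[-> tb]; split=> //.
    by apply/negP; rewrite -leNgt.
  by move=> [ta /negP]; rewrite -leNgt inE /root_cell /= in_itv /= ta.
rewrite measureD//; last by rewrite -ge0_fin_numE// fin_num_measure.
rewrite setIidr; last by move=> om /=; exact: le_lt_trans.

transitivity ((expR (- a))%:E - (expR (- b))%:E)%E.
  by congr (_ - _)%E; apply: T1_exp => //; exact: le_trans ab.
rewrite -EFinB !expRN !lnK ?posrE ?divr_gt0 ?ltr0n ?(leq_trans _ In)//.
rewrite !invf_div -mulrBl -natr1 addrAC subrr add0r.
by rewrite mul1r.
Qed.

Lemma index_event_probability n I : (0 < I [::])%N ->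
  (forall w, w \in L -> (I w < n)%N) -> nondecreasing_values I ->
  P (index_event n I) = (n%:R^-1 * \prod_(u <- obs)
    fine (P (tail (E u) (self_or_kid I u) (kids L u) (ln (n%:R / (last_value I u)%:R)))))%:E.
Proof.
move=> I0 In mI; have [uo _ _] := oL.
have n0 : (0 < n)%N by apply: leq_ltn_trans (In _ (ptree_nil tL)).
rewrite index_eventE// indep//; last 2 first.
- exact: measurable_itv.
- by move=> u j; exact: measurable_waiting_set.
rewrite root_cell_probability; last by rewrite I0 In// ptree_nil.
rewrite EFinM -prodEFin; congr (_ * _)%E; apply: eq_bigr => u _.
rewrite waiting_tail fineK// fin_num_measure//.
by apply: measurable_tail => j.
Qed.

Lemma measurable_index_event n I : (forall w, w \in L -> (I w < n)%N) ->
  measurable (index_event n I).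
Proof.
move=> In; have [e0|/set0P[om Iom]] := eqVneq (index_event n I) set0; first by rewrite e0.
have mI := index_event_nondecreasing In Iom; have [I0 _ _] := Iom.
have n0 : (0 < n)%N by apply: leq_ltn_trans (In _ (ptree_nil tL)).
rewrite index_eventE//; apply: measurableI.
  rewrite (_ : [set _ | _] = T1 @^-1` root_cell n I); last first.
    by apply/seteqP; split=> om' /=; rewrite inE.
  by rewrite -[X in measurable X]setTI; apply: mT1 => //; exact: measurable_itv.
apply: (measurable_forall_in (Q := fun om u => forall j, (j < (size L).+1)%N ->
       E u j om \in waiting_set n I u j)) => u.
by rewrite waiting_tail; apply: measurable_tail => j.
Qed.

Let Ev n : set Omega := \bigcup_(t in [set` boxes n (size L)]) index_event n (label L t).

Lemma trivIset_index_event n (A : set (seq nat)) : A `<=` [set` boxes n (size L)] ->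
  trivIset A (fun t => index_event n (label L t)).
Proof.
move=> As; apply/trivIsetP => t t' /As At /As At'; apply: contraNeq => /set0P[om [[_ h _] [_ h' _]]].
move: At At'; rewrite /= !mem_boxes => /andP[/eqP st _] /andP[/eqP st' _].
rewrite -(map_label (ptree_uniq tL) st) -(map_label (ptree_uniq tL) st').
by apply/eqP/eq_in_map => w wL; rewrite -h// -h'.
Qed.

Lemma sum_index_event n s : uniq s -> {subset s <= boxes n (size L)} ->
  \sum_(t <- s) fine (P (index_event n (label L t))) =
  fine (P (\bigcup_(t in [set` s]) index_event n (label L t))).
Proof.
move=> us sb; rewrite sum_probability//; last exact: (@trivIset_index_event n).
by move=> t ts; apply: measurable_index_event => w; apply: label_lt; exact: sb.
Qed.

Lemma root_index_event_bound n i s : uniq s -> {subset s <= boxes n (size L)} ->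
  (forall t, t \in s -> label L t [::] = i) -> (0 < i < n)%N ->
  \sum_(t <- s) fine (P (index_event n (label L t))) <= n%:R^-1.
Proof.
move=> us sb si i0; rewrite sum_index_event//.
have mC : measurable [set om | T1 om \in root_cell n (fun=> i)].
  rewrite (_ : [set _ | _] = T1 @^-1` root_cell n (fun=> i)); last first.
    by apply/seteqP; split=> om' /=; rewrite inE.
  by rewrite -[X in measurable X]setTI; apply: mT1 => //; exact: measurable_itv.
have mU : measurable (\bigcup_(t in [set` s]) index_event n (label L t)).
  apply: fin_bigcup_measurable => // t ts.
  by apply: measurable_index_event => w; apply: label_lt; exact: sb.
rewrite -lee_fin fineK ?fin_num_measure// -(root_cell_probability (I := fun=> i))//.
apply: le_measure; rewrite ?inE// => om [t /= ts [It0 Iw _]].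
have /andP[i0' i_n] := i0.
have e : root_index (T1 om) n = i by rewrite -(si _ ts) -Iw// ptree_nil.
by rewrite inE /root_cell /= in_itv /=; apply/(root_indexE _ _ i0') => //; lia.
Qed.

(** Whenever [T1 > 0], being alive coincides for large [n] with having index below [n],
    simultaneously for the finitely many words involved, and the root index is then positive; so the
    indicator of the union of index events is eventually that of the target. *)
Lemma index_event_sum_cvg :
  \sum_(t <- boxes n (size L)) fine (P (index_event n (label L t))) @[n --> \oo] -->
  fine (P [set om | exactly (alive om) L obs]).
Proof.
have -> : (fun n => \sum_(t <- boxes n (size L)) fine (P (index_event n (label L t)))) =
    (fun n => fine (P (Ev n))).
  by apply/funext => n; rewrite sum_index_event// uniq_boxes.
have mT s : measurable [set om | s < T1 om].
  rewrite (_ : [set _ | _] = T1 @^-1` `]s, +oo[%classic); last first.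
    by apply/seteqP; split=> om /=; rewrite in_itv /= andbT.
  by rewrite -[X in measurable X]setTI; apply: mT1.
apply: (@cvg_probability _ _ _ _ _ _ (~` [set om | 0 < T1 om])).
- move=> n; apply: fin_bigcup_measurable => // t tn.
  by apply: measurable_index_event => w; exact: label_lt.
- exact: measurable_exactly.
- exact: measurableC.
- by rewrite probability_setC// T1_exp// oppr0 expR0 subee.
move=> om /contrapT /= T0.
have key w : \forall n \near \oo, alive om w <-> (om_index n om w < n)%N.
  rewrite /alive birthE; exact: (alive_index (fun u j => E_gt0 u j om) T0).
have k1 : \forall n \near \oo, forall w, w \in L -> (alive om w <-> (om_index n om w < n)%N).
  by apply: eventually_all => w _.
have k2 : \forall n \near \oo, forall w, w \in obs ->
    (alive om (rcons w (kids L w)) <-> (om_index n om (rcons w (kids L w)) < n)%N).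
  by apply: eventually_all => w _.
have k3 : \forall n \near \oo, (0 < om_index n om [::])%N.
  near=> n; rewrite /om_index /= /index_at /= truncn_gt0.
  have e0 := expR_gt0 (- T1 om); rewrite -ler_pdivrMr// div1r.
  near: n; exists (Num.truncn (expR (- T1 om))^-1).+1 => // m /= Cm.
  by apply: le_trans (ltW (truncnS_gt _)) _; rewrite ler_nat.
near=> n.
have j1 : forall w, w \in L -> (alive om w <-> (om_index n om w < n)%N) by near: n.
have j2 : forall w, w \in obs ->
    (alive om (rcons w (kids L w)) <-> (om_index n om (rcons w (kids L w)) < n)%N) by near: n.
have j3 : (0 < om_index n om [::])%N by near: n.
split=> [[t tn [_ Iw Io]]|[LA oA]].
  split=> [w wL|w wo]; first by apply/j1 => //; rewrite Iw//; exact: label_lt.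
  by move=> /(j2 _ wo); rewrite ltnNge Io.
exists [seq om_index n om w | w <- L].
  by rewrite /= mem_boxes size_map eqxx all_map; apply/allP => w wL; apply/(j1 _ wL)/LA.
split=> [|w wL|w wo].
- by rewrite label_map// ptree_nil.
- by rewrite label_map.
- by rewrite leqNgt; apply/negP => /(j2 _ wo); exact: oA.
Unshelve. all: by end_near.
Qed.

End discretized_process.

(** * Comparison of the two pattern probabilities *)

Section pattern_sums.
Context {R : realType}.

Lemma sum_indicator_unique (T : eqType) (s : seq T) (b : pred T) : uniq s ->
  {in s &, forall x y, b x -> b y -> x = y} ->
  \sum_(x <- s) (b x)%:R = (has b s)%:R :> R.
Proof.
move=> us ub; case: hasP => [[x xs bx]|nb].
  rewrite (bigD1_seq x)//= bx big_seq_cond big1 ?addr0// => y /andP[ys yx].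
  by case by_: (b y) => //; move: yx; rewrite (ub y x)// eqxx.
rewrite big_seq big1// => x xs; case bx: (b x) => //.
by exfalso; apply: nb; exists x.
Qed.

Variables (L obs : seq (seq nat)).
Hypothesis tL : ptree L.
Hypothesis oL : observes L obs.

Lemma size_ptree : size L = (size L).-1.+1.
Proof. by have [M ->] := ptree_head tL. Qed.

Lemma label_root i t : label L (i :: t) [::] = i.
Proof. by have [M ->] := ptree_head tL. Qed.

Lemma pattern_label s t : is_tree s -> t \in boxes (size s) (size L) ->
  pattern s L obs (label L t) <->
  exactly (fun w => (vertex_at s (label L t [::]) w < size s)%N) L obs /\
  [seq vertex_at s (label L t [::]) w | w <- L] = t.
Proof.
move=> ts tb; have lt w : w \in L -> (label L t w < size s)%N by exact: label_lt.
have st : size t = size L by move: tb; rewrite mem_boxes => /andP[/eqP].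
rewrite -(patternP ts tL oL (erefl _) lt); split=> [[vE vo]|[[_ vo] mt]].
  split; first by split=> // w wL; rewrite vE// lt.
  by rewrite -[RHS](map_label (ptree_uniq tL) st); apply/eq_in_map.
by split=> // w wL; rewrite -{2}mt label_map.
Qed.

Lemma sum_patterns s : is_tree s -> (0 < size s)%N ->
  \sum_(t <- boxes (size s) (size L) | (0 < label L t [::])%N)
    (pattern s L obs (label L t))%:R =
  \sum_(1 <= v < size s)
    (`[< exactly (fun w => (vertex_at s v w < size s)%N) L obs >])%:R :> R.
Proof.
move=> ts s0; set n := size s.
set ex := fun v => `[< exactly (fun w => (vertex_at s v w < n)%N) L obs >].
rewrite big_mkcond; transitivity (\sum_(t <- boxes n (size L)) \sum_(1 <= v < n)
    (if [seq vertex_at s v w | w <- L] == t then (ex v)%:R else 0 : R)).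
  apply: eq_big_seq => t tb; have rootE v : [seq vertex_at s v w | w <- L] = t ->
      label L t [::] = v.
    by move=> <-; rewrite label_map// ptree_nil.
  case: posnP => root0.
    rewrite big_seq big1// => v; rewrite mem_index_iota => /andP[v0 _].
    by case: eqP => // /rootE; rewrite root0 => e; rewrite -e in v0.
  rewrite (bigD1_seq (label L t [::])) ?iota_uniq//=; last first.
    by rewrite mem_index_iota root0 label_lt// ptree_nil.
  rewrite big1 ?addr0; last first.
    by move=> v vl; case: eqP => // /rootE e; rewrite e eqxx in vl.
  have pE := pattern_label ts tb.
  case: eqP => [mt|mt]; last first.
    by case: (boolP (pattern _ _ _ _)) => // /pE[_].
  congr (nat_of_bool _)%:R; apply/idP/idP => [/pE[]|/asboolP e]; first by move=> /asboolP.
  by apply/pE; split.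
rewrite exchange_big; apply: eq_bigr => v _.
rewrite sum_label_delta ?ptree_uniq//; case: ifPn => // /allPn[w wL nw].
by case: asboolP => // -[/(_ _ wL)]; rewrite (negPf nw).
Qed.

Variables (mu : probability R R) (alpha : R).
Hypothesis alpha0 : 0 <= alpha.
Hypothesis mu01 : mu [set x : R | (0 <= x)%R /\ (x <= 1)%R] = 1%E.

Notation p n t := (expect_tree mu alpha n (fun s => (pattern s L obs (label L t))%:R : R)).

Lemma expect_ge0 n f : (forall s, 0 <= f s) -> 0 <= expect_tree mu alpha n f.
Proof.
move=> f0; rewrite -[leLHS](mul0r (expect_tree mu alpha n f)) -expect_treeZ.
by apply: (le_expect_tree mu alpha0) => s _ _ _; rewrite mul0r.
Qed.

Lemma sum_pattern_expectation n : (0 < n)%N ->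
  \sum_(t <- boxes n (size L) | (0 < label L t [::])%N) p n t =
  expect_tree mu alpha n (fun s => \sum_(1 <= v < n)
    (`[< exactly (fun w => (vertex_at s v w < n)%N) L obs >])%:R).
Proof.
move=> n0; rewrite -big_filter -expect_tree_sum.
apply: (eq_expect_tree mu alpha0) => s sn ts _.
by rewrite big_filter -sn sum_patterns// sn.
Qed.

(** In a given tree at most one label with root position [i] satisfies the pattern, so the sum is
    the probability of one event. *)
Lemma sum_pattern_root_le1 n i : (0 < n)%N -> (i < n)%N ->
  0 <= \sum_(t <- boxes n (size L).-1) p n (i :: t) <= 1.
Proof.
move=> n0 i_n; apply/andP; split.
  by apply: sumr_ge0 => t _; exact: expect_ge0.
rewrite -expect_tree_sum -[leRHS](expect_tree_cst alpha0 mu01 1 n0).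
apply: (le_expect_tree mu alpha0) => s sn ts _.
rewrite (@sum_indicator_unique _ _ (fun t => pattern s L obs (label L (i :: t)))).
- by case: has; rewrite ?ler01.
- exact: uniq_boxes.
move=> t t' tb tb'.
have mem u : u \in boxes n (size L).-1 -> i :: u \in boxes (size s) (size L).
  by rewrite sn !mem_boxes size_ptree /= eqSS i_n.
move=> /(pattern_label ts (mem _ tb))[_ e] /(pattern_label ts (mem _ tb'))[_].
by rewrite !label_root in e * => e'; move: e; rewrite e' => -[].
Qed.

Lemma pattern_expectation0 n t : t \in boxes n (size L) ->
  ~ good_values L (label L t) -> p n t = 0.
Proof.
move=> tb ng; rewrite -[RHS](mul0r (p n t)) -expect_treeZ.
apply: (eq_expect_tree mu alpha0) => s sn ts _; rewrite mul0r.
case: (boolP (pattern _ _ _ _)) => // /(pattern_good ts tL oL) g; exfalso; apply: ng.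
by apply: g => w wL; rewrite sn; exact: label_lt.
Qed.

Lemma pattern_expectation n t : t \in boxes n (size L) -> (0 < label L t [::])%N ->
  good_values L (label L t) ->
  p n t = \prod_(2 <= N < n) step_prob mu alpha L obs (label L t) N.
Proof.
move=> tb t0 g; have tn := label_lt tb (ptree_nil tL).
apply: (expect_pattern alpha0 mu01 tL oL g t0).
  exact: leq_ltn_trans tn.
by move=> w; exact: label_lt.
Qed.

(** Regroups the non-root words by parent, to match products over words on the tree side with
    products over individuals on the branching side. *)
Lemma big_nonroot (idx : R) (op : Monoid.com_law idx) (F : seq nat -> R) :
  \big[op/idx]_(w <- L | w != [::]) F w =
  \big[op/idx]_(u <- obs) \big[op/idx]_(c < kids L u) F (rcons u c).
Proof.
have [uo oL' Lo] := oL.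
rewrite -big_filter (perm_big [seq rcons u c | u <- obs, c <- iota 0 (kids L u)]) /=.
  rewrite big_allpairs_dep /=; apply: eq_bigr => u _.
  have -> : iota 0 (kids L u) = index_iota 0 (kids L u) by rewrite /index_iota subn0.
  by rewrite big_mkord.
apply: uniq_perm; first by rewrite filter_uniq// ptree_uniq.
  apply: allpairs_uniq_dep => // [u _|[u c] [u' c'] _ _ /= /rcons_inj[-> ->//]].
  exact: iota_uniq.
move=> w; rewrite mem_filter; apply/andP/allpairsPdep => [[]|[u [c [uo' + ->]]]].
  case/lastP: w => // u c _ ucL; exists u, c; split=> //; first exact: Lo ucL.
  by move: ucL; rewrite (ptree_mem_rcons _ _ tL) mem_iota => /andP[].
by rewrite mem_iota rcons_neq0 (ptree_mem_rcons _ _ tL) (oL' _ uo').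
Qed.

Lemma prod_kids_const (c : R) : \prod_(u <- obs) c ^+ kids L u = c ^+ (size L).-1.
Proof.
rewrite -(size_nonroot tL) size_filter -iter_mulr_1 -big_const_seq big_nonroot.
by apply: eq_bigr => u _; rewrite prodr_const card_ord.
Qed.

End pattern_sums.

(** * Generic points *)

Section generic_points.
Context {R : realType}.
Variable h : R -> R.
Hypothesis h_nd : {homo h : x y / x <= y}.

Definition generic (X : seq R) : Prop :=
  [/\ forall a, a \in X -> 0 < a < 1, uniq X &
      forall a b, a \in X -> b \in X -> a < b -> small_jump h (ln (b / a))].

Lemma countable_setU (A B : set R) : countable A -> countable B -> countable (A `|` B).
Proof.
move=> cA cB; rewrite -bigcup2E; apply: bigcup_countable; first exact: countableP.
by move=> [|[|i]] _ //=; exact: countable0.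
Qed.

Lemma generic_rcons X : generic X -> exists2 D : set R, countable D &
  forall y, 0 < y < 1 -> ~ D y -> generic (rcons X y).
Proof.
move=> [X01 uX X_jump]; have [J cJ nJ] := nondecreasing_small_jumps h_nd.
(* The new coordinate may lie on either side of an earlier [a], so besides [a] itself both [a exp z]
   and [a exp (- z)] are excluded for every jump point [z]. *)
pose D := \bigcup_(a in [set` X]) ([set a] `|` ((fun z => a * expR z) @` J) `|`
  ((fun z => a * expR (- z)) @` J)).
exists D.
  apply: bigcup_countable; first by apply: finite_set_countable; exact: finite_seq.
  move=> a _; apply: countable_setU; last exact: card_le_trans (card_image_le _ _) cJ.
  by apply: countable_setU; [exact: countable1|exact: card_le_trans (card_image_le _ _) cJ].
move=> y y01 Dy; have y0 : 0 < y by case/andP: y01.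
have notin a : a \in X -> [/\ a <> y, ~ J (ln (y / a)) & ~ J (ln (a / y))].
  move=> aX; have a0 : 0 < a by case/andP: (X01 _ aX).
  split=> [ay|Jy|Jy]; apply: Dy; exists a => //.
  - by left; left.
  - left; right; exists (ln (y / a)) => //.
    by rewrite lnK ?posrE ?divr_gt0// mulrC divfK// gt_eqF.
  - right; exists (ln (a / y)) => //.
    by rewrite expRN lnK ?posrE ?divr_gt0// invf_div mulrC divfK// gt_eqF.
split.
- by move=> a; rewrite mem_rcons inE => /predU1P[->//|/X01].
- by rewrite rcons_uniq uX andbT; apply/negP => /notin[].
move=> a b; rewrite !mem_rcons !inE => /predU1P[->|aX] /predU1P[->|bX] ab.
- by rewrite ltxx in ab.
- by apply: nJ; have [] := notin _ bX.
- by apply: nJ; have [] := notin _ aX.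
- exact: X_jump.
Qed.

End generic_points.

(** * Comparison of the two sums over positions *)

Section core.
Context {R : realType} (mu : probability R R) (alpha : R).
Hypothesis alpha0 : 0 <= alpha.
Hypothesis mu01 : mu [set x : R | (0 <= x)%R /\ (x <= 1)%R] = 1%E.
Context (d : measure_display) (Omega : measurableType d) (P : probability Omega R).
Variables (E : seq nat -> nat -> Omega -> \bar R) (T1 : Omega -> R).
Hypothesis mE : forall u j, measurable_fun setT (E u j).
Hypothesis E_gt0 : forall u j om, (0 < E u j om)%E.
Hypothesis condE : forall u i (B : nat -> set R) (s : R),
  (forall j, measurable (B j)) -> 0 <= s ->
  P ([set om | forall j, (j < i)%N -> E u j om \in EFin @` B j]
       `&` [set om | (s%:E < E u i om)%E])
  = (\int[P]_(om in [set om | forall j, (j < i)%N -> E u j om \in EFin @` B j])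
       (survival mu alpha (fun j => fine (E u j om)) i s)%:E)%E.
Hypothesis mT1 : measurable_fun setT T1.
Hypothesis T1_exp : forall s : R, 0 <= s -> P [set om | s < T1 om] = (expR (- s))%:E.
Hypothesis indep : forall (us : seq (seq nat)) (k : nat)
  (B : seq nat -> nat -> set (\bar R)) (C : set R),
  uniq us -> measurable C -> (forall u j, measurable (B u j)) ->
  P ([set om | T1 om \in C]
       `&` [set om | forall u, u \in us -> forall j, (j < k)%N -> E u j om \in B u j])
  = (P [set om | T1 om \in C] *
     \prod_(u <- us) P [set om | forall j, (j < k)%N -> E u j om \in B u j])%E.

Variables (L obs : seq (seq nat)).
Hypothesis tL : ptree L.
Hypothesis oL : observes L obs.

Notation h := (hfun mu alpha).
Notation p n t := (expect_tree mu alpha n (fun s => (pattern s L obs (label L t))%:R : R)).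
Notation q n t := (fine (P (index_event E T1 L obs n (label L t)))).
Notation tails n I := (\prod_(u <- obs)
  fine (P (tail (E u) (self_or_kid I u) (kids L u) (ln (n%:R / (last_value L I u)%:R))))).

Lemma index_event_set0 n I : (forall w, w \in L -> (I w < n)%N) ->
  ~ nondecreasing_values L I -> index_event E T1 L obs n I = set0.
Proof.
move=> In nI; apply/seteqP; split=> // om Iom; apply: nI.
exact: (index_event_nondecreasing E_gt0 tL In Iom).
Qed.

Lemma nondecreasing_self_or_kid I u j : nondecreasing_values L I -> u \in obs ->
  (j < kids L u)%N -> (self_or_kid I u j <= self_or_kid I u j.+1)%N.
Proof.
move=> [I0 IS] uo jk; have [_ oL' _] := oL.
have := @self_or_kid_mem _ tL u j.+1 (oL' _ uo) jk.
by case: j {jk} => [|j] /=; [exact: I0|exact: IS].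
Qed.

Section at_generic_point.
Variables (I : nat -> seq nat -> nat) (x : seq nat -> R).
Hypothesis Ix : forall w, w \in L -> scales (I ^~ w) (x w).
Hypothesis x01 : forall w, w \in L -> 0 < x w < 1.
Hypothesis x_kid : forall w c, rcons w c \in L -> x w < x (rcons w c).
Hypothesis x_sib : forall w c, rcons w c.+1 \in L -> x (rcons w c) < x (rcons w c.+1).
Hypothesis x_jump : forall w w', w \in L -> w' \in L -> x w < x w' ->
  small_jump h (ln (x w' / x w)).

(** Each individual [u] receives the factor [n ^+ kids L u]; regrouping by parent then gives
    literally the limit found in [discrete_cvg]. *)
Lemma tails_cvg : n%:R ^+ (size L).-1 * tails n (I n) @[n --> \oo] -->
  (\prod_(w <- L | w != [::]) kid_intensity mu alpha x (parent_word w) (word_kid w)) *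
  expR (- \sum_(w <- obs) total_hazard mu alpha L x w).
Proof.
have [uo oL' Lo] := oL.
apply: (@near_eq_cvgr _ (fun n => \prod_(u <- obs | u \in obs) (n%:R ^+ kids L u *
    fine (P (tail (E u) (self_or_kid (I n) u) (kids L u)
      (ln (n%:R / (last_value L (I n) u)%:R))))))).
  by apply: nearW => n; rewrite -big_seq big_split /= (prod_kids_const tL oL).
apply: (@cvg_eqr _ _ (\prod_(u <- obs | u \in obs)
   ((\prod_(l < kids L u) kid_intensity mu alpha x u l) *
    expR (- total_hazard mu alpha L x u)))).
  rewrite -big_seq big_split /= -expR_sum sumrN (big_nonroot tL oL); congr (_ * _).
  apply: eq_bigr => u _; apply: eq_bigr => l _.
  by rewrite parent_word_rcons /word_kid last_rcons.
apply: cvg_prod_seq => u uo'; have uL := oL' _ uo'.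
have mem j : (j <= kids L u)%N -> self_or_kid id u j \in L.
  by move=> jk; exact: self_or_kid_mem.
have x_lt j : (j < kids L u)%N -> self_or_kid x u j < self_or_kid x u j.+1.
  by move=> /mem; case: j => [|j] /=; [exact: x_kid|exact: x_sib].
apply: (tail_cvg (hfun_nondecreasing mu alpha0) (hfun_ge0 mu alpha0)
  (hfun_primitive mu alpha0) (cumulative0 h) (cumulative_nd mu alpha0) alpha0
  (y := fun n => self_or_kid (I n) u) (x := self_or_kid x u) (D := kids L u)
  _ _ x_lt _ _ (survivalE mu alpha0) (mE u) (E_gt0 u) (condE u)).
- by move=> j /mem; case: j => [|j] /=; exact: Ix.
- by have /andP[] := x01 uL.
- by rewrite self_or_kidE; have /andP[] := x01 (mem _ (leqnn _)).
move=> j l jl lk; have := x_mono x_lt jl lk.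
rewrite (self_or_kidE x u j) (self_or_kidE x u l); apply: x_jump; apply: mem => //.
exact: leq_trans (ltnW jl) lk.
Qed.

End at_generic_point.

(* Index [0] is the root of the whole tree, which attracts newcomers at a
   different rate; it is left out. *)
Definition discrepancy (n : nat) (t : seq nat) : R :=
  if label L t [::] == 0%N then 0 else n%:R ^+ (size L).-1 * (p n t - n%:R * q n t).

Lemma index_event_probabilityZ n I : (0 < I [::])%N ->
  (forall w, w \in L -> (I w < n)%N) -> nondecreasing_values L I ->
  n%:R * fine (P (index_event E T1 L obs n I)) = tails n I.
Proof.
move=> I0 In mI; rewrite (index_event_probability mE E_gt0 mT1 T1_exp indep tL oL I0 In mI) /=.
rewrite mulrA divff ?mul1r// pnatr_eq0 -lt0n.
by apply: leq_ltn_trans (In _ (ptree_nil tL)).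
Qed.

(** If the coordinates increase along parents and siblings, both terms have the same limit.
    Otherwise two words are in the wrong order at [X], hence on the grid for large [n], and both
    probabilities are zero, since either model forces their positions into the right order. *)
Lemma discrepancy_cvg0 X : size X = size L -> generic h X ->
  discrepancy n (grid n X) @[n --> \oo] --> 0.
Proof.
move=> sX [X01 uX X_jump].
pose I n w := label L (grid n X) w; pose x w := nth 0 X (index w L).
have idx w : w \in L -> (index w L < size X)%N by rewrite sX index_mem.
have xX w : w \in L -> x w \in X by move=> wL; apply: mem_nth; exact: idx.
have x01 w : w \in L -> 0 < x w < 1 by move=> /xX /X01.
have Ix w : w \in L -> scales (I ^~ w) (x w).
  move=> wL; have -> : I ^~ w = (fun n => Num.truncn (n%:R * x w)).
    by apply/funext => n; rewrite /I /label /grid (nth_map 0)// idx.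
  by apply: scales_floor; case/andP: (x01 _ wL) => /ltW.
have x_inj : {in L &, injective x}.
  move=> w w' wL wL' /eqP; rewrite nth_uniq ?idx// => /eqP e.
  by rewrite -(nth_index [::] wL) e nth_index.
have x_jump w w' : w \in L -> w' \in L -> x w < x w' -> small_jump h (ln (x w' / x w)).
  by move=> wL wL'; apply: X_jump; exact: xX.
have pos : \forall n \near \oo, forall w, w \in L -> (0 < I n w < n)%N.
  apply: eventually_all => w wL; have /andP[x0 x1] := x01 _ wL.
  near=> n; apply/andP; split; near: n; first exact: scales_ge (Ix _ wL) x0.
  exact: scales_ltn (Ix _ wL) scales_n x1.
have box n : (forall w, w \in L -> (0 < I n w < n)%N) -> grid n X \in boxes n (size L).
  move=> In; rewrite mem_boxes size_map sX eqxx.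
  have <- : [seq I n w | w <- L] = grid n X.
    by rewrite /I map_label ?(ptree_uniq tL)// size_map sX.
  by rewrite all_map; apply/allP => w /In /andP[].
have nilL := ptree_nil tL.
have [[x_kid x_sib]|ninc] := pselect ((forall w c, rcons w c \in L -> x w < x (rcons w c)) /\
    (forall w c, rcons w c.+1 \in L -> x (rcons w c) < x (rcons w c.+1))).
  have c1 := discrete_cvg alpha0 mu01 tL oL Ix x01 x_kid x_sib x_inj x_jump.
  have c2 := tails_cvg Ix x01 x_kid x_sib x_jump.
  have good := eventually_good tL Ix x01 x_kid x_sib x_inj.
  apply: (@near_eq_cvgr _ (fun n => n%:R ^+ (size L).-1 *
      (\prod_(2 <= N < n) step_prob mu alpha L obs (I n) N) -
      n%:R ^+ (size L).-1 * tails n (I n))); last first.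
    by apply: cvg_eqr (cvgB c1 c2); rewrite subrr.
  near=> n.
  have [g In] : good_values L (I n) /\ (forall w, w \in L -> (0 < I n w < n)%N) by near: n.
  have I0 : (0 < label L (grid n X) [::])%N by case/andP: (In _ nilL).
  have In' w : w \in L -> (I n w < n)%N by move=> /In /andP[].
  rewrite /discrepancy eqn0Ngt I0 /= mulrBr (pattern_expectation tL oL alpha0 mu01 _ I0 g); last exact: box.
  rewrite (index_event_probabilityZ I0 In')//; have [g1 g2 _] := g.
  by split=> [w|w c] wL; apply: ltnW; [exact: g1|exact: g2].
have [u [v [uL [vL [vu [gI mI]]]]]] : exists u v, u \in L /\ v \in L /\ x v < x u /\
    (forall J, good_values L J -> (J u <= J v)%N) /\
    (forall J, nondecreasing_values L J -> (J u <= J v)%N).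
    have [[w [c [wL ge]]]|n1] := pselect (exists w c, rcons w c \in L /\ ~ (x w < x (rcons w c))).
    have wL' := mem_parent tL wL; exists w, (rcons w c); split=> //; split=> //; split.
      move/negP: ge; rewrite -leNgt le_eqVlt => /predU1P[/(x_inj _ _ wL wL') e|//].
      by have := congr1 size e; rewrite size_rcons; lia.
    split=> [J [J1 _ _]|J [J1 J2]]; first exact: ltnW (J1 _ _ wL).
    elim: c {ge} wL => [|c IH] wL; first exact: J1.
    by apply: leq_trans (IH (mem_sibling tL wL)) _; exact: J2.
  have [[w [c [wL ge]]]|n2] := pselect (exists w c, rcons w c.+1 \in L /\
      ~ (x (rcons w c) < x (rcons w c.+1))).
    have wL' := mem_sibling tL wL; exists (rcons w c), (rcons w c.+1).
    split=> //; split=> //; split.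
      move/negP: ge; rewrite -leNgt le_eqVlt => /predU1P[/(x_inj _ _ wL wL') e|//].
      by move/rcons_inj: e => -[]; lia.
    by split=> [J [_ J2 _]|J [_ J2]]; [exact: ltnW (J2 _ _ wL)|exact: J2].
  exfalso; apply: ninc; split=> w c wL; apply: contrapT => ge.
    by apply: n1; exists w, c.
  by apply: n2; exists w, c.
have lt : \forall n \near \oo, (I n v < I n u)%N.
  exact: scales_ltn (Ix _ vL) (Ix _ uL) vu.
apply: cvg_near_cst; near=> n.
have In : forall w, w \in L -> (0 < I n w < n)%N by near: n.
have ltn : (I n v < I n u)%N by near: n.
have In' w : w \in L -> (I n w < n)%N by move=> /In /andP[].
rewrite /discrepancy (pattern_expectation0 tL oL mu alpha0) ?index_event_set0//.
- by rewrite measure0 mulr0 subrr mulr0; case: ifP.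
- by move=> /mI; rewrite leqNgt ltn.
- exact: box.
- by move=> /gI; rewrite leqNgt ltn.
Unshelve. all: by end_near.
Qed.

(** Applied with [c = rate_bound], where the last inequality is the condition that
    [prod_step_prob_bound] needs. *)
Lemma root_index_lower (y : R) (c : R) : 0 < y < 1 -> exists N0 : nat, forall n, (N0 <= n)%N ->
  [/\ (0 < Num.truncn (n%:R * y) < n)%N, y / 2 * n%:R <= (Num.truncn (n%:R * y))%:R &
      c <= 2 * (Num.truncn (n%:R * y))%:R].
Proof.
move=> /andP[y0 y1]; have s := scales_floor (ltW y0).
have [N0 _ hN] : \forall n \near \oo, [/\ (0 < Num.truncn (n%:R * y) < n)%N,
    y / 2 * n%:R <= (Num.truncn (n%:R * y))%:R &
    c <= 2 * (Num.truncn (n%:R * y))%:R].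
  near=> n; split.
  - apply/andP; split; near: n; first exact: scales_ge s y0.
    exact: scales_ltn s scales_n y1.
  - by apply: ltW; near: n; apply: scales_gt s _; lra.
  have : ((Num.truncn c).+1 <= Num.truncn (n%:R * y))%N.
    by near: n; exact: scales_ge s y0.
  rewrite -(ler_nat R) => k; have := truncnS_gt c; move: k.
  by set a := (_.+1)%:R; set b := (Num.truncn _)%:R; have : 0 <= b by []; lra.
by exists N0 => n Nn; exact: hN.
Unshelve. all: by end_near.
Qed.

(** With the root at [y], all admissible positions are at least about [n y / 2], so every attachment
    or cell costs [O(1 / n)], once for each non-root word. The constant diverges as [y] tends to
    [0]. *)
Lemma discrepancy_bound (y : R) : 0 < y < 1 -> exists C : R, exists N0 : nat, forall n t,
  (N0 <= n)%N -> size t = (size L).-1 -> all (fun i => (i < n)%N) t ->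
  `|discrepancy n (Num.truncn (n%:R * y) :: t)| <= C.
Proof.
move=> y01; have [y0 y1] := andP y01; have [uo oL' _] := oL.
have [N0 hN] := root_index_lower (rate_bound alpha L obs) y01.
(* Bounds the hazards of [tail_le] for all individuals at once: [n] over any position is at most
   [2 / y], and no individual has more than [size L] kids. *)
pose K := (1 + alpha + (size L)%:R) * h (ln (2 / y) + (size L)%:R).
have h0 := hfun_ge0 mu alpha0.
have K0 : 0 <= K by rewrite mulr_ge0// addr_ge0// addr_ge0.
have cb0 := coef_bound_ge0 alpha0 L.
exists ((coef_bound alpha L / y) ^+ (size L).-1 + (K * (2 / y)) ^+ (size L).-1), N0.
move=> n t Nn st tn; have [/andP[i0 i_n] yi ri] := hN n Nn.
set i := Num.truncn (n%:R * y) in i0 i_n yi ri *.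
have i0' : 0 < i%:R :> R by rewrite ltr0n.
have n0' : 0 <= n%:R :> R by [].
have ratio : n%:R / i%:R <= 2 / y.
  by rewrite ler_pdivrMr// mulrAC ler_pdivlMr//; lra.
have tb : (i :: t) \in boxes n (size L) by rewrite mem_boxes (size_ptree tL) /= eqSS st eqxx i_n.
have lt w : w \in L -> (label L (i :: t) w < n)%N by exact: label_lt.
have lroot : label L (i :: t) [::] = i by exact: label_root.
set I := label L (i :: t) in lt lroot *.
have C1 : 0 <= (coef_bound alpha L / y) ^+ (size L).-1.
  by rewrite exprn_ge0// divr_ge0// ltW.
have C2 : 0 <= (K * (2 / y)) ^+ (size L).-1.
  by rewrite exprn_ge0// mulr_ge0// divr_ge0// ltW.
have pb : 0 <= n%:R ^+ (size L).-1 * p n (i :: t) <= (coef_bound alpha L / y) ^+ (size L).-1.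
  have [g|ng] := pselect (good_values L I); last first.
    by rewrite (pattern_expectation0 tL oL mu alpha0 tb ng) mulr0 lexx.
  have I0 : (0 < I [::])%N by rewrite lroot.
  rewrite (pattern_expectation tL oL alpha0 mu01 tb I0 g).
  have := prod_step_prob_bound alpha0 mu01 tL oL g I0 lt.
  rewrite lroot => /(_ ri) /andP[b1 b2]; rewrite mulr_ge0 ?exprn_ge0//=.
  apply: le_trans (ler_wpM2l (exprn_ge0 _ n0') b2) _; rewrite -exprMn.
  apply: lerXn2r; rewrite ?nnegrE; first by rewrite mulr_ge0// divr_ge0// mulr_ge0.
    by rewrite divr_ge0// ltW.
  by rewrite mulrCA ler_wpM2l// ler_pdivrMr ?mulr_gt0// ler_pdivlMl//; lra.
have qb : 0 <= n%:R ^+ (size L).-1 * (n%:R * q n (i :: t)) <= (K * (2 / y)) ^+ (size L).-1.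
  have [mI|nI] := pselect (nondecreasing_values L I); last first.
    by rewrite index_event_set0// measure0 !mulr0 lexx.
  have I0 : (0 < I [::])%N by rewrite lroot.
  have -> : n%:R ^+ (size L).-1 * (n%:R * q n (i :: t)) = \prod_(u <- obs) (n%:R ^+ kids L u *
      fine (P (tail (E u) (self_or_kid I u) (kids L u) (ln (n%:R / (last_value L I u)%:R))))).
    by rewrite index_event_probabilityZ// big_split /= (prod_kids_const tL oL).
  rewrite -(prod_kids_const tL oL); apply/andP; split.
    by apply: prodr_ge0 => u _; rewrite mulr_ge0 ?exprn_ge0// fine_ge0.
  rewrite big_seq [leRHS]big_seq; apply: ler_prod => u uo'; have uL := oL' _ uo'.
  rewrite mulr_ge0 ?exprn_ge0 ?fine_ge0//=.
  have iu : (i <= I u)%N by have := nondecreasing_ge_root tL mI uL; rewrite lroot.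
  have u0 : (0 < I u)%N by exact: leq_trans iu.
  have := tail_le (hfun_nondecreasing mu alpha0) h0 (hfun_primitive mu alpha0)
    (cumulative_nd mu alpha0) alpha0 (y := self_or_kid I u) (D := kids L u) u0
    (fun j => nondecreasing_self_or_kid mI uo') (survivalE mu alpha0) (mE u) (E_gt0 u) (condE u)
    (n := n).
  rewrite -/(last_value L I u) => tl; apply: le_trans (ler_wpM2l (exprn_ge0 _ n0') (tl _)) _.
    by move=> j jk; rewrite self_or_kidE lt// self_or_kid_mem.
  have kL : (kids L u)%:R <= (size L)%:R :> R by rewrite ler_nat kids_le_size.
  have u0' : 0 < (I u)%:R :> R by rewrite ltr0n.
  have ru : n%:R / (I u)%:R <= n%:R / i%:R :> R.
    by rewrite ler_wpM2l// lef_pV2 ?posrE// ler_nat.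
  rewrite -exprMn /=; apply: lerXn2r; rewrite ?nnegrE.
  - by rewrite mulr_ge0// divr_ge0// mulr_ge0// addr_ge0// addr_ge0.
  - by rewrite mulr_ge0// divr_ge0// ltW.
  rewrite mulrCA; apply: ler_pM; [by rewrite mulr_ge0// addr_ge0// addr_ge0|by rewrite divr_ge0| |].
    apply: ler_pM => //; [by rewrite addr_ge0// addr_ge0|by rewrite lerD2l|].
    apply: (hfun_nondecreasing mu alpha0); apply: lerD => //.
    rewrite ler_ln ?posrE ?divr_gt0 ?(lt_trans _ (i_n : (i < n)%N))//.
      exact: le_trans ratio.
    by rewrite ltr0n; exact: ltn_trans i_n.
  exact: le_trans ratio.
rewrite /discrepancy label_root// eqn0Ngt i0 /= mulrBr.
move: pb qb => /andP[p1 p2] /andP[q1 q2].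
by apply: le_trans (ler_normB _ _) _; rewrite !ger0_norm// lerD.
Qed.

Definition root_average (n i : nat) : R :=
  n%:R ^- (size L).-1 * box_sum n (size L).-1 (discrepancy n) [:: i].

(** Uniform in the root position, also near [0] where [discrepancy_bound] degenerates: given the
    root, the pattern probabilities sum to at most [1], and so do the index events after
    multiplication by [n]. *)
Lemma root_average_bound n i : (i < n)%N -> `|root_average n i| <= 2.
Proof.
move=> i_n; have n0 : (0 < n)%N by exact: leq_ltn_trans i_n.
have n0' : 0 < n%:R :> R by rewrite ltr0n.
rewrite /root_average box_sumE; case: (posnP i) => i0.
  rewrite big1 ?mulr0 ?normr0// => t _.
  by rewrite /discrepancy cat1s label_root// i0.
have -> : \sum_(t <- boxes n (size L).-1) discrepancy n ([:: i] ++ t) =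
    n%:R ^+ (size L).-1 * (\sum_(t <- boxes n (size L).-1) p n (i :: t) -
      n%:R * \sum_(t <- boxes n (size L).-1) q n (i :: t)).
  rewrite mulr_sumr -sumrB mulr_sumr; apply: eq_bigr => t _.
  by rewrite /discrepancy cat1s label_root// eqn0Ngt i0.
rewrite mulKf ?expf_neq0 ?gt_eqF//.
have /andP[p1 p2] := sum_pattern_root_le1 tL oL alpha0 mu01 n0 i_n.
have q2 : \sum_(t <- boxes n (size L).-1) q n (i :: t) <= n%:R^-1.
  have := @root_index_event_bound _ _ _ P E T1 mE E_gt0 mT1 T1_exp L obs tL oL n i
    [seq i :: t | t <- boxes n (size L).-1]; rewrite big_map; apply.
  - by rewrite map_inj_uniq ?uniq_boxes// => a b [].
  - move=> _ /mapP[t + ->]; rewrite !mem_boxes (size_ptree tL) /= eqSS i_n => /andP[-> ->].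
    by [].
  - by move=> _ /mapP[t _ ->]; exact: label_root.
  - by rewrite i0.
have q1 : 0 <= \sum_(t <- boxes n (size L).-1) q n (i :: t).
  by apply: sumr_ge0 => t _; rewrite fine_ge0.
apply: le_trans (ler_normB _ _) _; rewrite (ger0_norm p1) ger0_norm; last by rewrite mulr_ge0// ltW.
have : n%:R * \sum_(t <- boxes n (size L).-1) q n (i :: t) <= 1.
  by rewrite -ler_pdivlMl// mulr1.
by move: p2; set a := \sum_(_ <- _) _; set b := _ * _ => *; lra.
Qed.

Lemma root_average_cvg0 : n%:R^-1 * (\sum_(i < n) root_average n i) @[n --> \oo] --> 0.
Proof.
have g0 : generic h [::] by split.
have [D cD gD] := generic_rcons (hfun_nondecreasing mu alpha0) g0.
apply: (riemann_sum_cvg0 (C := 2) (N0 := 0%N) cD).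
  by move=> n i _; exact: root_average_bound.
move=> y y01 Dy; have gy := gD y y01 Dy.
apply: (@box_sum_cvg0 _ (generic h) discrepancy (size L).-1 [:: y]) => //.
- by move=> Y; apply: generic_rcons; exact: hfun_nondecreasing.
- by move=> Y sY gY; apply: discrepancy_cvg0 => //=; rewrite sY -(size_ptree tL).
- exact: discrepancy_bound.
Qed.

Lemma sum_root_average n : (0 < n)%N -> n%:R^-1 * (\sum_(i < n) root_average n i) =
  n%:R^-1 * expect_tree mu alpha n (fun s => \sum_(1 <= v < n)
    (`[< exactly (fun w => (vertex_at s v w < n)%N) L obs >])%:R) -
  \sum_(t <- boxes n (size L)) q n t.
Proof.
move=> n0; have n0' : n%:R != 0 :> R by rewrite pnatr_eq0 -lt0n.
rewrite -(sum_pattern_expectation tL oL mu alpha0 n0) -mulr_sumr.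
rewrite -[\sum_(i < n) _]/(box_sum n (size L).-1.+1 (discrepancy n) [::]) -(size_ptree tL).
rewrite box_sumE [X in _ - X](_ : _ = \sum_(t <- boxes n (size L) | (0 < label L t [::])%N) q n t).
  transitivity (n%:R^-1 * \sum_(t <- boxes n (size L) | (0 < label L t [::])%N)
    (p n t - n%:R * q n t)); last by rewrite sumrB -mulr_sumr mulrBr mulKf.
  congr (_ * _); rewrite mulr_sumr [RHS]big_mkcond /=; apply: eq_bigr => t _.
  rewrite /discrepancy lt0n; case: eqP => //= _; first by rewrite mulr0.
  by rewrite mulKf// expf_neq0.
rewrite [RHS]big_mkcond /=; apply: eq_bigr => t _; case: posnP => // t0.
rewrite (_ : index_event _ _ _ _ _ _ = set0) ?measure0//.
by apply/seteqP; split=> // om [I0 _ _]; rewrite t0 in I0.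
Qed.

Lemma expected_occurrences_cvg :
  n%:R^-1 * expect_tree mu alpha n (fun s => \sum_(1 <= v < n)
    (`[< exactly (fun w => (vertex_at s v w < n)%N) L obs >])%:R) @[n --> \oo] -->
  fine (P [set om | exactly (alive E T1 om) L obs]).
Proof.
apply: (@near_eq_cvgr _ (fun n => n%:R^-1 * (\sum_(i < n) root_average n i) +
    \sum_(t <- boxes n (size L)) q n t)); last first.
  apply: cvg_eqr (cvgD root_average_cvg0 (index_event_sum_cvg mE E_gt0 mT1 T1_exp tL oL)).
  by rewrite add0r.
near=> n; rewrite sum_root_average ?subrK//; near: n; by exists 1%N.
Unshelve. all: by end_near.
Qed.

End core.

(** * From plane patterns to fringe and degree counts *)

Section counting.
Context {R : realType} (mu : probability R R) (alpha : R).
Hypothesis alpha0 : 0 <= alpha.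
Hypothesis mu01 : mu [set x : R | (0 <= x)%R /\ (x <= 1)%R] = 1%E.
Context (d : measure_display) (Omega : measurableType d) (P : probability Omega R).
Variables (E : seq nat -> nat -> Omega -> \bar R) (T1 : Omega -> R).
Hypothesis mE : forall u j, measurable_fun setT (E u j).
Hypothesis E_gt0 : forall u j om, (0 < E u j om)%E.
Hypothesis condE : forall u i (B : nat -> set R) (s : R),
  (forall j, measurable (B j)) -> 0 <= s ->
  P ([set om | forall j, (j < i)%N -> E u j om \in EFin @` B j]
       `&` [set om | (s%:E < E u i om)%E])
  = (\int[P]_(om in [set om | forall j, (j < i)%N -> E u j om \in EFin @` B j])
       (survival mu alpha (fun j => fine (E u j om)) i s)%:E)%E.
Hypothesis mT1 : measurable_fun setT T1.
Hypothesis T1_exp : forall s : R, 0 <= s -> P [set om | s < T1 om] = (expR (- s))%:E.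
Hypothesis indep : forall (us : seq (seq nat)) (k : nat)
  (B : seq nat -> nat -> set (\bar R)) (C : set R),
  uniq us -> measurable C -> (forall u j, measurable (B u j)) ->
  P ([set om | T1 om \in C]
       `&` [set om | forall u, u \in us -> forall j, (j < k)%N -> E u j om \in B u j])
  = (P [set om | T1 om \in C] *
     \prod_(u <- us) P [set om | forall j, (j < k)%N -> E u j om \in B u j])%E.

Lemma expect_treeD n f g : expect_tree mu alpha n (fun s => f s + g s) =
  expect_tree mu alpha n f + expect_tree mu alpha n g.
Proof. by rewrite /expect_tree -big_split /=; apply: eq_bigr => ws _; rewrite mulrDr. Qed.

Lemma count_iota (Q : pred nat) n : (0 < n)%N ->
  (count Q (iota 0 n))%:R = (Q 0%N)%:R + \sum_(1 <= v < n) (Q v)%:R :> R.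
Proof.
case: n => // n _ /=; rewrite natrD; congr (_ + _).
by rewrite /index_iota subn1 /= -sum1_count natr_sum big_mkcond; apply: eq_bigr => v _; case: (Q v).
Qed.

(** Common form of the two conclusions: a vertex property that is a finite disjoint union of
    patterns. The root of the whole tree, to which the pattern formula is not applied, adds at most
    [1 / n]. *)
Lemma count_cvg (WW : seq (seq (seq nat))) (ob : seq (seq nat) -> seq (seq nat))
    (Q : seq nat -> pred nat) :
  (forall L, L \in WW -> ptree L /\ observes L (ob L)) ->
  (forall s v, is_tree s -> nth 0%N s 0 = 0%N -> (0 < v < size s)%N ->
    (Q s v)%:R = \sum_(L <- WW)
      (`[< exactly (fun w => (vertex_at s v w < size s)%N) L (ob L) >])%:R :> R) ->
  expect_tree mu alpha n (fun s => (count (Q s) (iota 0 (size s)))%:R / n%:R)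
    @[n --> \oo] -->
  \sum_(L <- WW) fine (P [set om | exactly (alive E T1 om) L (ob L)]).
Proof.
move=> hW hQ.
apply: (@near_eq_cvgr _ (fun n => n%:R^-1 * expect_tree mu alpha n (fun s => (Q s 0%N)%:R) +
  \sum_(L <- WW | L \in WW) n%:R^-1 * expect_tree mu alpha n (fun s => \sum_(1 <= v < n)
    (`[< exactly (fun w => (vertex_at s v w < n)%N) L (ob L) >])%:R))).
  near=> n; have n0 : (0 < n)%N by near: n; exists 1%N.
  rewrite -big_seq -mulr_sumr -expect_tree_sum -mulrDr -expect_treeD -expect_treeZ.
  apply: (eq_expect_tree mu alpha0) => s sn ts s0; rewrite mulrC; congr (_ * _).
  rewrite sn count_iota// exchange_big; congr (_ + _).
  rewrite big_seq [RHS]big_seq; apply: eq_bigr => v; rewrite mem_index_iota => vn.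
  by rewrite -sn hQ// sn.
rewrite [X in _ --> X]big_seq -[X in _ --> X]add0r; apply: cvgD.
  apply: squeeze_cvgr (cvg_cst 0) cvg_invn.
  near=> n; have n0 : (0 < n)%N by near: n; exists 1%N.
  rewrite mulr_ge0 ?invr_ge0 ?(expect_ge0 mu alpha0)//=.
  rewrite ler_piMr ?invr_ge0// -[leRHS](expect_tree_cst alpha0 mu01 1 n0).
  by apply: (le_expect_tree mu alpha0) => s _ _ _; case: (Q s 0%N); rewrite ?ler01.
apply: cvg_sum_seq => L /hW[tL oL].
exact: (expected_occurrences_cvg alpha0 mu01 mE E_gt0 condE mT1 T1_exp indep tL oL).
Unshelve. all: by end_near.
Qed.

Lemma fringe_countE s k tp :
  fringe_count s k tp = count (fun v => `[< fringe_iso s v k tp >]) (iota 0 (size s)).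
Proof.
rewrite /fringe_count -sum1_card -sum1_count.
have -> : iota 0 (size s) = index_iota 0 (size s) by rewrite /index_iota subn0.
rewrite big_mkord; apply: eq_bigl => v.
exact: asboolb.
Qed.

(** The same list [WW] splits the shape in both models, because the alive individuals and the words
    leading to existing vertices are both left-closed sets. *)
Lemma expected_fringe_cvg k tp : valid_shape k tp ->
  expect_tree mu alpha n (fun s => (fringe_count s k tp)%:R / n%:R) @[n --> \oo] -->
  fine (P [set om | geneal_iso E T1 k tp om]).
Proof.
move=> [k0 tp_lt]; have [WW [uW tW isoW Wiso WWu]] := plane_trees_of_shape tp k0.
have -> : fine (P [set om | geneal_iso E T1 k tp om]) =
    \sum_(L <- WW) fine (P [set om | exactly (alive E T1 om) L L]).
  have closed om : left_closed (alive E T1 om) by exact: alive_closed.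
  rewrite (sum_probability P (X := fun L => [set om | exactly (alive E T1 om) L L]) uW).
  - congr (fine (P _)); apply/seteqP; split=> om.
      by move=> /(isoW _ (closed om))[L LW eL]; exists L.
    by move=> [L LW eL]; exact: (Wiso _ _ (closed om) LW eL).
  - by move=> L _; exact: measurable_exactly.
  apply/trivIsetP => L M LW MW; apply: contraNeq => /set0P[om [eL eM]].
  by apply/eqP; exact: (WWu _ _ _ (closed om) LW MW eL eM).
have -> : (fun n => expect_tree mu alpha n (fun s => (fringe_count s k tp)%:R / n%:R)) =
    (fun n => expect_tree mu alpha n (fun s =>
      (count (fun v => `[< fringe_iso s v k tp >]) (iota 0 (size s)))%:R / n%:R)).
  by apply/funext => n; congr expect_tree; apply/funext => s; rewrite fringe_countE.
apply: (@count_cvg WW id (fun s v => `[< fringe_iso s v k tp >])).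
  by move=> L /tW[tL _]; split=> //; exact: observes_all.
move=> s v ts s0 vs; have closed := vertex_at_left_closed v ts.
rewrite (@sum_indicator_unique _ _ _ (fun L => `[< exactly _ L L >]) uW).
  congr (nat_of_bool _)%:R; apply/asboolP/hasP.
    move=> /(fringe_isoP ts s0 vs k0 tp_lt) /(isoW _ closed)[L LW eL].
    by exists L => //; apply/asboolP.
  move=> [L LW /asboolP eL]; apply/(fringe_isoP ts s0 vs k0 tp_lt).
  exact: (Wiso _ _ closed LW eL).
by move=> L M LW MW /asboolP eL /asboolP eM; exact: (WWu _ _ _ closed LW MW eL eM).
Qed.

(** Waiting times are positive, so all [k] kids are alive as soon as the last of them is. *)
Lemma exactly_alive_star k om :
  exactly (alive E T1 om) (star k) [:: [::]] <->
  (\sum_(j < k) E [::] j om <= (T1 om)%:E)%E /\ ((T1 om)%:E < \sum_(j < k.+1) E [::] j om)%E.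
Proof.
pose S m := (\sum_(j < m) E [::] j om)%E.
have S_le m m' : (m <= m')%N -> (S m <= S m')%E.
  move=> /subnK <-; elim: (m' - m)%N => // j IH; apply: le_trans IH _.
  by rewrite /S [leRHS]big_ord_recr /= leeDl// ltW.
have alive_kid c : alive E T1 om [:: c] <-> (S c.+1 <= (T1 om)%:E)%E.
  by rewrite /alive /birth /= adde0.
have alive_root : alive E T1 om [::] <-> (S 0%N <= (T1 om)%:E)%E.
  by rewrite /alive /birth /= /S big_ord0.
have mem w : w \in star k <-> w = [::] \/ exists2 c, (c < k)%N & w = [:: c].
  rewrite inE; split=> [/predU1P[->|/mapP[c + ->]]|[->//|[c ck ->]]]; first by left.
    by rewrite mem_iota => /andP[_ ck]; right; exists c.
  by apply/orP; right; apply/mapP; exists c => //; rewrite mem_iota.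
split=> [[aL aO]|[Sk kS]].
  split; last first.
    have := aO [::]; rewrite inE eqxx kids_star => /(_ isT) na.
    by rewrite ltNge; apply/negP => /(proj2 (alive_kid k)).
  case: k mem aL {aO} => [|k] mem aL; first by apply/alive_root/aL/mem; left.
  by apply/alive_kid/aL/mem; right; exists k.
split=> [w /mem[->|[c ck ->]]|w].
- by apply/alive_root; apply: le_trans Sk; exact: S_le.
- by apply/alive_kid; apply: le_trans Sk; exact: S_le.
rewrite inE => /eqP ->; rewrite kids_star => /alive_kid.
by rewrite leNgt kS.
Qed.

Lemma expected_degree_cvg k : (1 <= k)%N ->
  expect_tree mu alpha n (fun s => (deg_count s k)%:R / n%:R) @[n --> \oo] -->
  fine (P [set om | (\sum_(j < k.-1) E [::] j om <= (T1 om)%:E)%E /\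
                    ((T1 om)%:E < \sum_(j < k) E [::] j om)%E]).
Proof.
case: k => // k _; rewrite /=.
rewrite (_ : [set om | _] = [set om | exactly (alive E T1 om) (star k) [:: [::]]]); last first.
  by apply/seteqP; split=> om /exactly_alive_star.
have := @count_cvg [:: star k] (fun=> [:: [::]]) (fun s v => degT s (size s) v == k.+1).
rewrite big_seq1; apply.
  by move=> L; rewrite inE => /eqP ->; split; [exact: ptree_star|exact: observes_star].
move=> s v ts _ vs; rewrite big_seq1; congr (nat_of_bool _)%:R.
by apply/eqP/asboolP => /(degT_star k ts vs).
Qed.

End counting.

Theorem theorem4p1 (R : realType) (alpha : R) (mu : probability R R)
  (d : measure_display) (Omega : measurableType d) (P : probability Omega R)
  (E : seq nat -> nat -> Omega -> \bar R) (T1 : Omega -> R) :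
  0 <= alpha ->
  mu [set x : R | (0 <= x)%R /\ (x <= 1)%R] = 1%E ->
  (mu [set (0%R : R)] < 1)%E ->
  (mu [set (1%R : R)] < 1)%E ->
  (* the inter-birth times: measurable, with values in (0, +oo] *)
  (forall u j, measurable_fun setT (E u j)) ->
  (forall u j om, (0 < E u j om)%E) ->
  (* conditional law: given E u 0, ..., E u (i-1), E u i has the hazard rate *)
  (forall u i (B : nat -> set R) (s : R),
      (forall j, measurable (B j)) -> 0 <= s ->
      P ([set om | forall j, (j < i)%N -> E u j om \in EFin @` B j]
           `&` [set om | (s%:E < E u i om)%E])
      = (\int[P]_(om in [set om | forall j, (j < i)%N -> E u j om \in EFin @` B j])
           (survival mu alpha (fun j => fine (E u j om)) i s)%:E)%E) ->
  (* T1 ~ Exp(1) *)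
  measurable_fun setT T1 ->
  (forall s : R, 0 <= s -> P [set om | s < T1 om] = (expR (- s))%:E) ->
  (* independence of T1 and the families (E u .)_u *)
  (forall (us : seq (seq nat)) (k : nat) (B : seq nat -> nat -> set (\bar R)) (C : set R),
      uniq us -> measurable C -> (forall u j, measurable (B u j)) ->
      P ([set om | T1 om \in C]
           `&` [set om | forall u, u \in us -> forall j, (j < k)%N -> E u j om \in B u j])
      = (P [set om | T1 om \in C] *
         \prod_(u <- us) P [set om | forall j, (j < k)%N -> E u j om \in B u j])%E) ->
  (* expected fringe convergence *)
  (forall (k : nat) (tp : nat -> nat), valid_shape k tp ->
     (fun n : nat => expect_tree mu alpha n
                       (fun s => (fringe_count s k tp)%:R / n%:R))
       @ \oo --> fine (P [set om | geneal_iso E T1 k tp om])) /\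
  (* degree distribution *)
  (forall k : nat, (1 <= k)%N ->
     (fun n : nat => expect_tree mu alpha n
                       (fun s => (deg_count s k)%:R / n%:R))
       @ \oo --> fine (P [set om | (\sum_(j < k.-1) E [::] j om <= (T1 om)%:E)%E /\
                                   ((T1 om)%:E < \sum_(j < k) E [::] j om)%E])).

Proof.
move=> alpha0 mu01 _ _ mE E_gt0 condE mT1 T1_exp indep; split=> k.
  by move=> tp; exact: (expected_fringe_cvg alpha0 mu01 mE E_gt0 condE mT1 T1_exp indep).
exact: (expected_degree_cvg alpha0 mu01 mE E_gt0 condE mT1 T1_exp indep).
Qed.
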